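(* For every integer $K\ge 3$ there is a constant $C_{\mathscr B,iid}>0$ depending only on $K$ such that the following holds. Let $n,p\ge 1$, and let $X_1,\dots,X_n\in\mathbb R^p$ be i.i.d. random vectors with $\mathbf E X_i=0$, $\operatorname{Var}(X_i)$ positive definite and $\mathbf E(\|X_i\|^K)<\infty$. Suppose there exist i.i.d. random vectors $Y_1,\dots,Y_n\in\mathbb R^p$, independent of $X_1,\dots,X_n$, such that $\mathbf E(\|Y_i\|^K)<\infty$, $\mathbf E(X_i^k)=\mathbf E(Y_i^k)$ for all $k=1,\dots,K-1$, and $Y_i\overset{d}{=}Z_i+U_i$ for some independent random vectors $Z_i,U_i\in\mathbb R^p$ with $\mathbf E Z_i=\mathbf E U_i=0$ and $Z_i\sim\mathcal N(0,\Sigma_z)$ for some symmetric positive definite matrix $\Sigma_z$. Put $C_z:=\|\Sigma_z^{-1/2}\|$, $S_n:=n^{-1/2}\sum_{i=1}^nX_i$ and $\tilde S_n:=n^{-1/2}\sum_{i=1}^nY_i$. Then $$\sup_{B\in\mathscr B}\bigl|\mathbf P(S_n\in B)-\mathbf P(\tilde S_n\in B)\bigr|\le C_{\mathscr B,iid}\,\frac{\bigl\{C_z^K\,\mathbf E\bigl(\|X_1\|^K+\|Y_1\|^K\bigr)\bigr\}^{1/(K-2)}}{n^{1/2}}.$$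
   Context: $\|\cdot\|$ is the Euclidean norm for vectors and the operator norm for matrices. $\mathscr B$ is the set of all closed Euclidean balls in $\mathbb R^p$. For a vector $X\in\mathbb R^p$, $X^k$ denotes the tensor power $X^{\otimes k}$; thus $\mathbf E(X^k)=\mathbf E(Y^k)$ means $\mathbf E(x_{i_1}\cdots x_{i_k})=\mathbf E(y_{i_1}\cdots y_{i_k})$ for all indices $1\le i_1,\dots,i_k\le p$, where $x_j,y_j$ are the coordinates of $X,Y$. *)

(* Defs.v *)
From HB Require Import structures.
From mathcomp Require Import all_boot all_order all_algebra.
From mathcomp Require Import all_classical all_reals all_analysis.

Set Implicit Arguments.
Unset Strict Implicit.
Unset Printing Implicit Defensive.

Import Order.TTheory GRing.Theory Num.Theory.
Import numFieldNormedType.Exports.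

Local Open Scope classical_set_scope.
Local Open Scope ring_scope.

(* R^p is 'cV[R]_p, equipped with the sigma-algebra generated by the
   coordinate maps, i.e. the Borel sigma-algebra of R^p. *)
Section borel_cV.
Variables (R : realType) (p : nat).

Definition cV_coord (j : 'I_p) (x : 'cV[R]_p) : R := x j 0.

Let cV_set0 : g_sigma_preimage cV_coord set0.
Proof. exact: sigma_algebra0. Qed.

Let cV_setC A : g_sigma_preimage cV_coord A -> g_sigma_preimage cV_coord (~` A).
Proof. exact: sigma_algebraC. Qed.

Let cV_bigcup (F : (set 'cV[R]_p)^nat) :
  (forall i, g_sigma_preimage cV_coord (F i)) ->
  g_sigma_preimage cV_coord (\bigcup_i (F i)).
Proof. exact: sigma_algebra_bigcup. Qed.

HB.instance Definition _ := @isMeasurable.Build default_measure_display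
  'cV[R]_p (g_sigma_preimage cV_coord) cV_set0 cV_setC cV_bigcup.

End borel_cV.

Lemma measurable_fun_cVP d (T : measurableType d) (R : realType) p
    (f : T -> 'cV[R]_p) :
  measurable_fun setT f <->
  forall j, measurable_fun setT (fun t => f t j 0).
Proof.
apply: (@iff_trans _ (g_sigma_preimage
    (fun i => @cV_coord R p i \o f) `<=` measurable)).
  rewrite g_sigma_preimage_comp; split=> [mf A [/= C preC <-]|prefS].
    exact: mf.
  by move=> _ A mA; apply: prefS; exists A.
split=> [fS i|mf].
- move=> _ A mA; apply: fS; apply: sub_sigma_algebra.
  case: p i => [[] []//|n i] in f *.
  rewrite -bigcup_mkord_ord.
  exists i; first exact: ltn_ord.
  by exists A => //; rewrite inord_val.
- apply: smallest_sub; first exact: sigma_algebra_measurable.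
  case: p => [|n] in f mf *; first by rewrite big_ord0.
  rewrite -bigcup_mkord_ord; apply: bigcup_sub => i Ii.
  by move=> A [B mB <-]; exact: mf.
Qed.

Section linear_algebra.
Variables (R : realType) (p : nat).

Definition enorm (x : 'cV[R]_p) : R := Num.sqrt (\sum_(j < p) x j 0 ^+ 2).

Definition opnorm (A : 'M[R]_p) : R :=
  sup [set enorm (A *m x) | x in [set x : 'cV[R]_p | enorm x <= 1]].

Definition sym_posdef (A : 'M[R]_p) : Prop :=
  A^T = A /\ forall v : 'cV[R]_p, v != 0 -> 0 < (v^T *m A *m v) 0 0.

(* A^{-1/2}, the unique symmetric positive definite square root of A^{-1};
   only meaningful when A is symmetric positive definite. *)
Definition invsqrtmx (A : 'M[R]_p) : 'M[R]_p :=
  xget 0 [set S : 'M[R]_p | sym_posdef S /\ S *m S = invmx A].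

Definition closed_eball (c : 'cV[R]_p) (r : R) : set 'cV[R]_p :=
  [set x | enorm (x - c) <= r].

Definition closed_eballs : set (set 'cV[R]_p) :=
  [set B | exists c r, 0 <= r /\ B = closed_eball c r].

End linear_algebra.

Section random_elements.
Local Open Scope ereal_scope.

Definition eq_dist d1 (T1 : measurableType d1) d2 (T2 : measurableType d2)
    d' (E : measurableType d') (R : realType)
    (P1 : probability T1 R) (X1 : T1 -> E)
    (P2 : probability T2 R) (X2 : T2 -> E) : Prop :=
  forall A : set E, measurable A -> P1 (X1 @^-1` A) = P2 (X2 @^-1` A).

Definition independent2 d (T : measurableType d) (R : realType)
    (P : probability T R) d1 (E1 : measurableType d1) d2 (E2 : measurableType d2)
    (X : T -> E1) (Y : T -> E2) : Prop :=
  forall A B, measurable A -> measurable B ->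
    P (X @^-1` A `&` Y @^-1` B) = P (X @^-1` A) * P (Y @^-1` B).

Definition mutually_independent d (T : measurableType d) (R : realType)
    (P : probability T R) (I : finType) d' (E : measurableType d')
    (X : I -> T -> E) : Prop :=
  forall (J : {set I}) (A : I -> set E), (forall i, measurable (A i)) ->
    P (\bigcap_(i in [set` J]) X i @^-1` A i) =
    \prod_(i in J) P (X i @^-1` A i).

Definition iid d (T : measurableType d) (R : realType)
    (P : probability T R) (I : finType) d' (E : measurableType d')
    (X : I -> T -> E) : Prop :=
  mutually_independent P X /\ forall i j, eq_dist P (X i) P (X j).

End random_elements.

Section random_vectors.
Context {d : measure_display} {T : measurableType d} {R : realType}.
Variables (P : probability T R) (p : nat).
Implicit Type X : T -> 'cV[R]_p.

(* Since +oo - +oo is infinite in \bar R, the vanishing of the expectation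
   entails the integrability of each coordinate. *)
Definition centered X : Prop := forall j, ('E_P[fun t => X t j 0%R] = 0)%E.

Definition covmx X : 'M[R]_p :=
  \matrix_(j, k) fine (covariance P (fun t => X t j 0) (fun t => X t k 0)).

Definition normmoment (K : nat) X : \bar R := ('E_P[fun t => (enorm (X t) ^+ K)%R])%E.

Definition tensormoment (k : nat) X (idx : 'I_k -> 'I_p) : \bar R :=
  ('E_P[fun t => (\prod_(l < k) X t (idx l) 0)%R])%E.

Definition standard_gaussian X : Prop :=
  mutually_independent P (fun (j : 'I_p) t => X t j 0) /\
  forall (j : 'I_p) (A : set R), measurable A ->
    P ((fun t => X t j 0) @^-1` A) = normal_prob 0 1 A.

Definition normalized_sum n (X : 'I_n -> T -> 'cV[R]_p) (t : T) : 'cV[R]_p :=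
  (Num.sqrt n%:R)^-1 *: \sum_(i < n) X i t.

End random_vectors.

(* X ~ N(0, Sigma): X has the law of A W, where A A^T = Sigma and W is a
   standard Gaussian vector, possibly living on another probability space. *)
Definition centered_gaussian d (T : measurableType d) (R : realType)
    (P : probability T R) (p : nat) (Sigma : 'M[R]_p) (X : T -> 'cV[R]_p)
    : Prop :=
  exists (d' : measure_display) (T' : measurableType d')
    (P' : probability T' R) (W : {RV P' >-> 'cV[R]_p}) (A : 'M[R]_p),
  [/\ standard_gaussian P' W, A *m A^T = Sigma
    & eq_dist P X P' (fun t => A *m W t)].

(* Main.v *)
Require Import Defs.
From HB Require Import structures.
From mathcomp Require Import all_boot all_order all_algebra.
From mathcomp Require Import all_classical all_reals all_analysis.
From mathcomp Require Import measurable_realfun.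
From mathcomp Require Import ring lra.
From mathcomp Require Import spectral sesquilinear.
From mathcomp Require Import zify.
From mathcomp Require complex.

Set Implicit Arguments.
Unset Strict Implicit.
Unset Printing Implicit Defensive.

Import Order.TTheory GRing.Theory Num.Theory.
Import numFieldNormedType.Exports.

Local Open Scope classical_set_scope.
Local Open Scope ring_scope.

(** Write [mu], [nu] for the laws of [X_1], [Y_1] and [s = 1 / C_z].  Since
    [Sigma_z - s^2] is positive semidefinite, [Y_1] has the law of [s G + V]
    with [G] standard Gaussian and independent of [V].

    Lindeberg's telescoping compares the law of the sum of the [X_i] with that
    of the [Y_i], both smoothed by an additional Gaussian [eps G].  Swapping one
    summand leaves a Gaussian factor of scale [r >= eps], and the Cameron-Martin
    density [exp (k.w - |k|^2 / 2)], [k = x / r], moves the summand [x] into the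
    weight.  Its expansion in [k] up to degree [K - 1] is a polynomial, on which
    [mu] and [nu] agree; the remainder has Gaussian [L^1] norm at most
    [C_K |k|^K], with no dependence on the dimension.  The remaining factor is
    bounded by the ball discrepancy at the previous step, which gives a
    recursion in the number of summands.

    The smoothing is removed by Chebyshev's inequality: the smoothed indicator
    of a ball is a nonincreasing function of the distance to the center, so its
    lower and upper parts are handled by the layer cake formula and cost one
    third of the discrepancy, while its middle part is sandwiched between the
    indicators of two concentric balls.  The Gaussian probability of such a
    shell is bounded, uniformly in the dimension and in the center, by means of
    the homothety that maps the larger ball to the smaller one. *)

(** The recursion closes because of a choice of scales. In units of [sigma = 1 / C_z], one swap
    costs about [theta^(K-2) / r^K], where [theta] is the power with exponent [1 / (K - 2)] in the
    final bound. As long as [r >= theta] this is at most [theta / r^3], so every [K >= 3] behaves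
    like the third moment case. The smoothing width is [tau = smoothM * theta], and the induction
    hypothesis [beC * theta / sqrt j] then produces a sum of [j^(-1/2) (N - j)^(-3/2)] with
    [N = tau^2 + m], of order [sqrt m / (N tau)]. The ratio [theta / tau = 1 / smoothM] lets the old
    constant return only as a fraction of itself. The sum needs [tau >= 1], that is, a lower bound
    on [theta] by a constant depending on [K] alone. The Gaussian component supplies it: it keeps
    [Y_1] away from the origin at scale [sigma].

    Independence is used only to identify laws of sums; afterwards, laws act as commuting operators
    on nonnegative functions with values in the extended reals. Inequalities are kept as sums on
    both sides, since subtraction is unsafe there. Gaussian facts all come from one affine change of
    variables and a characterization by shifts. *)

(** * Integrals of nonnegative functions: densities and Tonelli *)

Section integral_tools.
Local Open Scope ereal_scope.

Import HBNNSimple.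

Lemma ge0_integral_density d (T : measurableType d) (R : realType)
    (m m' : {measure set T -> \bar R}) (h : T -> R) :
  measurable_fun setT h -> (forall x, (0 <= h x)%R) ->
  (forall A, measurable A -> m' A = \int[m]_(x in A) (h x)%:E) ->
  forall f : T -> \bar R, measurable_fun setT f -> (forall x, 0 <= f x) ->
  \int[m']_x f x = \int[m]_x (f x * (h x)%:E).
Proof.
move=> mh h0 hm f mf f0; pose f_ := nnsfun_approx measurableT mf.
have mhE : measurable_fun setT (EFin \o h) by exact/measurable_EFinP.
have nnsfunE (g : {nnsfun T >-> R}) :
    \int[m']_x (g x)%:E = \int[m]_x ((g x)%:E * (h x)%:E).
  under [LHS]eq_integral do rewrite fimfunE -fsumEFin//.
  rewrite [LHS]ge0_integral_fsum//; last 2 first.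
    - by move=> r; exact/measurable_EFinP/measurableT_comp.
    - by move=> n x _; rewrite EFinM nnfun_muleindic_ge0.
  under [RHS]eq_integral.
    move=> x xD; rewrite muleC fimfunE -fsumEFin// ge0_mule_fsumr; last first.
      by move=> r; rewrite EFinM nnfun_muleindic_ge0.
    over.
  rewrite [RHS]ge0_integral_fsum//; last 2 first.
    - move=> r; apply: emeasurable_funM => //.
      by apply/measurable_EFinP; do 2 apply/measurableT_comp => //.
    - by move=> n x _; rewrite mule_ge0 ?lee_fin// -lee_fin EFinM nnfun_muleindic_ge0.
  apply: eq_fsbigr => r _; rewrite integralZl_indic_nnsfun//=.
  have mr : measurable (g @^-1` [set r]) by [].
  rewrite integral_indic// setIT hm//.
  (* That [r] is nonnegative is read off at a point where [g] takes this value; over an empty fibre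
     both sides vanish whatever the sign of [r]. *)
  have [->|/set0P[x0 gx0]] := eqVneq (g @^-1` [set r]) set0.
    rewrite integral_set0 mule0; apply/esym/integral0_eq => x _.
    by rewrite indic0 mulr0 mule0.
  have r0 : (0 <= r)%R by rewrite -gx0.
  rewrite -ge0_integralZl//; last 2 first.
    - exact: measurable_funTS.
    - by move=> x _; rewrite lee_fin.
  rewrite integral_mkcond; apply: eq_integral => x _.
  rewrite patchE indicE; case: ifPn => _.
    by rewrite mulr1 muleC.
  by rewrite mulr0 mule0.
transitivity (limn (fun n => \int[m']_x (f_ n x)%:E)).
  rewrite -monotone_convergence//=.
  - apply: eq_integral => x _; apply/esym/cvg_lim => //=.
    exact: cvg_nnsfun_approx.
  - by move=> n; apply: measurableT_comp.
  - by move=> n x _; rewrite lee_fin.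
  - by move=> x _ a b ab; rewrite lee_fin//; exact/lefP/nd_nnsfun_approx.
under eq_fun do rewrite nnsfunE.
rewrite -monotone_convergence//=.
- apply: eq_integral => x _; apply/cvg_lim => //.
  under eq_cvg do rewrite muleC.
  rewrite [f x * _]muleC.
  apply: cvgeZl => //; exact: cvg_nnsfun_approx.
- by move=> n; apply: emeasurable_funM => //; apply: measurableT_comp.
- by move=> n x _; rewrite mule_ge0 ?lee_fin.
- move=> x _ a b ab; rewrite lee_wpmul2r ?lee_fin//.
  exact/lefP/nd_nnsfun_approx.
Qed.

Section swap.
Context d1 d2 (T1 : measurableType d1) (T2 : measurableType d2) (R : realType).
Variables (m1 : {sigma_finite_measure set T1 -> \bar R}).
Variables (m2 : {sigma_finite_measure set T2 -> \bar R}).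
Variable F : T1 -> T2 -> \bar R.
Hypothesis mF : measurable_fun setT (fun z => F z.1 z.2).
Hypothesis F0 : forall x y, 0 <= F x y.

Lemma ge0_integral_swap :
  \int[m1]_x \int[m2]_y F x y = \int[m2]_y \int[m1]_x F x y.
Proof. exact: (fubini_tonelli (fun z => F z.1 z.2)). Qed.

Lemma measurable_integral2 : measurable_fun setT (fun x => \int[m2]_y F x y).
Proof. exact: (measurable_fun_fubini_tonelli_F (fun z => F z.1 z.2)). Qed.

End swap.

Lemma ge0_le_integralT d (T : measurableType d) (R : realType)
    (m : {measure set T -> \bar R}) (f g : T -> \bar R) :
  measurable_fun setT f -> measurable_fun setT g ->
  (forall x, 0 <= f x) -> (forall x, f x <= g x) ->
  \int[m]_x f x <= \int[m]_x g x.
Proof. by move=> mf mg f0 fg; apply: ge0_le_integral. Qed.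

Lemma integral_cst_probability d (T : measurableType d) (R : realType)
    (P : probability T R) (r : \bar R) : \int[P]_x r = r.
Proof.
by rewrite integral_cst// -[RHS]mule1; congr (_ * _); exact: probability_setT.
Qed.

End integral_tools.

(** * Inner product and squared norm *)

Section euclidean.
Context {R : realType} {p : nat}.
Implicit Types x y z : 'cV[R]_p.

Definition dotv x y : R := \sum_(j < p) x j 0 * y j 0.

Definition sqn x : R := dotv x x.

Lemma dotvC x y : dotv x y = dotv y x.
Proof. by apply: eq_bigr => j _; rewrite mulrC. Qed.

Lemma dotvDl x y z : dotv (x + y) z = dotv x z + dotv y z.
Proof. by rewrite -big_split; apply: eq_bigr => j _; rewrite mxE mulrDl. Qed.

Lemma dotvZl a x z : dotv (a *: x) z = a * dotv x z.
Proof. by rewrite big_distrr; apply: eq_bigr => j _ /=; rewrite mxE mulrA. Qed.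

Lemma dotvNl x z : dotv (- x) z = - dotv x z.
Proof. by rewrite -scaleN1r dotvZl mulN1r. Qed.

Lemma dotvDr x y z : dotv z (x + y) = dotv z x + dotv z y.
Proof. by rewrite dotvC dotvDl !(dotvC z). Qed.

Lemma dotvZr a x z : dotv z (a *: x) = a * dotv z x.
Proof. by rewrite dotvC dotvZl dotvC. Qed.

Lemma dotvNr x z : dotv z (- x) = - dotv z x.
Proof. by rewrite dotvC dotvNl dotvC. Qed.

Lemma dotv0l x : dotv 0 x = 0.
Proof. by rewrite -(scale0r 0) dotvZl mul0r. Qed.

Lemma dotv0r x : dotv x 0 = 0.
Proof. by rewrite dotvC dotv0l. Qed.

Definition dotvE := (dotvDl, dotvDr, dotvNl, dotvNr, dotvZl, dotvZr).

Lemma sqn_ge0 x : 0 <= sqn x.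
Proof. by apply: sumr_ge0 => j _; rewrite -expr2 sqr_ge0. Qed.

Lemma sqn0 : sqn 0 = 0. Proof. exact: dotv0l. Qed.

Lemma sqn_eq0 x : (sqn x == 0) = (x == 0).
Proof.
apply/idP/idP => [|/eqP ->]; last by rewrite sqn0.
rewrite psumr_eq0 => [/allP x0|j _]; last by rewrite -expr2 sqr_ge0.
apply/eqP/colP => j; rewrite mxE.
by have := x0 j (mem_index_enum _); rewrite mulf_eq0 orbb => /eqP.
Qed.

Lemma sqn_gt0 x : (0 < sqn x) = (x != 0).
Proof. by rewrite lt0r sqn_eq0 sqn_ge0 andbT. Qed.

Lemma sqnD x y : sqn (x + y) = sqn x + 2 * dotv x y + sqn y.
Proof. by rewrite /sqn !dotvE (dotvC y x); ring. Qed.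

Lemma sqnN x : sqn (- x) = sqn x.
Proof. by rewrite /sqn !dotvE opprK. Qed.

Lemma sqnB x y : sqn (x - y) = sqn x - 2 * dotv x y + sqn y.
Proof. by rewrite sqnD sqnN dotvNr; ring. Qed.

Lemma sqnZ a x : sqn (a *: x) = a ^+ 2 * sqn x.
Proof. by rewrite /sqn !dotvE; ring. Qed.

(** Cauchy-Schwarz, from the nonnegativity of the squared norm of [|y|^2 x - (x.y) y], which equals
    [|y|^2] times the difference of the two sides. *)
Lemma dotv_sqr_le x y : dotv x y ^+ 2 <= sqn x * sqn y.
Proof.
have [->|y0] := eqVneq y 0; first by rewrite dotv0r sqn0 mulr0 expr0n.
have y1 : 0 < sqn y by rewrite sqn_gt0.
have := sqn_ge0 (sqn y *: x - dotv x y *: y).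
rewrite sqnB !sqnZ !dotvE => h.
have : 0 <= sqn y * (sqn x * sqn y - dotv x y ^+ 2).
  by apply: le_trans h _; rewrite le_eqVlt; apply/orP; left; apply/eqP; ring.
by rewrite pmulr_rge0// subr_ge0.
Qed.

Lemma enormE x : enorm x = Num.sqrt (sqn x).
Proof. by congr Num.sqrt; apply: eq_bigr => j _; rewrite expr2. Qed.

Lemma enorm_ge0 x : 0 <= enorm x.
Proof. exact: sqrtr_ge0. Qed.

Lemma enorm_sqr x : enorm x ^+ 2 = sqn x.
Proof. by rewrite enormE sqr_sqrtr// sqn_ge0. Qed.

Lemma normr_dotv_le x y : `|dotv x y| <= enorm x * enorm y.
Proof.
rewrite -(@ler_pXn2r _ 2)// ?nnegrE ?mulr_ge0 ?enorm_ge0//.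
by rewrite real_normK ?num_real// exprMn !enorm_sqr dotv_sqr_le.
Qed.

Lemma enormZ a x : enorm (a *: x) = `|a| * enorm x.
Proof. by rewrite !enormE sqnZ sqrtrM ?sqr_ge0// sqrtr_sqr. Qed.

Lemma normr_entry_le x j : `|x j 0| <= enorm x.
Proof.
rewrite -(@ler_pXn2r _ 2)// ?nnegrE ?enorm_ge0//.
rewrite real_normK ?num_real// enorm_sqr /sqn /dotv (bigD1 j)//= -expr2 lerDl.
by apply: sumr_ge0 => k _; rewrite -expr2 sqr_ge0.
Qed.

Lemma dotv_mulmx (A : 'M[R]_p) x y : dotv (A *m x) y = dotv x (A^T *m y).
Proof.
rewrite /dotv; under eq_bigr do rewrite mxE big_distrl.
under [RHS]eq_bigr do rewrite mxE big_distrr.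
rewrite exchange_big; apply: eq_bigr => i _; apply: eq_bigr => j _ /=.
by rewrite mxE; ring.
Qed.

Lemma dotv_trmx x y : dotv x y = (x^T *m y) 0 0.
Proof. by rewrite mxE; apply: eq_bigr => j _; rewrite mxE. Qed.

End euclidean.

(** * Measurability of vector operations *)

Section measurability.
Context {d} {T : measurableType d} {R : realType} {p : nat}.
Implicit Types (f g : T -> 'cV[R]_p).

Lemma measurable_cV_entry f j : measurable_fun setT f ->
  measurable_fun setT (fun t => f t j 0).
Proof. by move=> /measurable_fun_cVP. Qed.

Lemma measurable_cVD f g : measurable_fun setT f -> measurable_fun setT g ->
  measurable_fun setT (fun t => f t + g t).
Proof.
move=> mf mg; apply/measurable_fun_cVP => j; under eq_fun do rewrite mxE.
by apply: measurable_funD; exact: measurable_cV_entry.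
Qed.

Lemma measurable_cVZ (r : T -> R) f : measurable_fun setT r ->
  measurable_fun setT f -> measurable_fun setT (fun t => r t *: f t).
Proof.
move=> mr mf; apply/measurable_fun_cVP => j; under eq_fun do rewrite mxE.
by apply: measurable_funM => //; exact: measurable_cV_entry.
Qed.

Lemma measurable_cVN f : measurable_fun setT f ->
  measurable_fun setT (fun t => - f t).
Proof.
move=> mf; under eq_fun do rewrite -scaleN1r.
exact: measurable_cVZ.
Qed.

Lemma measurable_cVB f g : measurable_fun setT f -> measurable_fun setT g ->
  measurable_fun setT (fun t => f t - g t).
Proof. by move=> mf mg; apply: measurable_cVD => //; exact: measurable_cVN. Qed.

Lemma measurable_cV_mulmx (A : 'M[R]_p) f : measurable_fun setT f ->
  measurable_fun setT (fun t => A *m f t).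
Proof.
move=> mf; apply/measurable_fun_cVP => j; under eq_fun do rewrite mxE.
apply: measurable_sum => i.
by apply: measurable_funM => //; exact: measurable_cV_entry.
Qed.

Lemma measurable_cV_sum (I : Type) (s : seq I) (F : I -> T -> 'cV[R]_p) :
  (forall i, measurable_fun setT (F i)) ->
  measurable_fun setT (fun t => \sum_(i <- s) F i t).
Proof.
move=> mF; apply/measurable_fun_cVP => j; under eq_fun do rewrite summxE.
by apply: measurable_sum => i; exact: measurable_cV_entry.
Qed.

Lemma measurable_dotv f g : measurable_fun setT f -> measurable_fun setT g ->
  measurable_fun setT (fun t => dotv (f t) (g t)).
Proof.
move=> mf mg; apply: measurable_sum => j.
by apply: measurable_funM; exact: measurable_cV_entry.
Qed.

Lemma measurable_sqn f : measurable_fun setT f ->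
  measurable_fun setT (fun t => sqn (f t)).
Proof. by move=> mf; exact: measurable_dotv. Qed.

Lemma measurable_enorm f : measurable_fun setT f ->
  measurable_fun setT (fun t => enorm (f t)).
Proof.
move=> mf; under eq_fun do rewrite enormE.
apply: (@measurableT_comp _ _ _ _ _ _ (@Num.sqrt R)); last exact: measurable_sqn.
by apply: continuous_measurable_fun; exact: sqrt_continuous.
Qed.

End measurability.

(** * Affine changes of variables on the line *)

Section lebesgue_affine.
Local Open Scope ereal_scope.
Context {R : realType}.
Notation mu := (@lebesgue_measure R).

(** The image of Lebesgue measure under [x |-> a x + b], multiplied by [a], gives every half-open
    interval its length; uniqueness of Lebesgue measure does the rest. *)
Lemma ge0_integral_lebesgue_affine (a b : R) (f : R -> \bar R) :
  (0 < a)%R -> measurable_fun setT f -> (forall x, 0 <= f x) ->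
  \int[mu]_x f x = a%:E * \int[mu]_x f (a * x + b)%R.
Proof.
move=> a0 mf f0; pose phi (x : measurableTypeR R) : measurableTypeR R := (a * x + b)%R.
have mphi : measurable_fun setT phi.
  by apply: measurable_funD => //; apply: measurable_funM.
pose nna := NngNum (ltW a0).
pose nu0 : {measure set (measurableTypeR R) -> \bar R} :=
  mscale nna (pushforward mu phi).
pose nu := nu0 mphi.
have muE A : measurable A -> mu A = nu A.
  apply: lebesgue_measure_unique => X [[u v] _ <-].
  rewrite [RHS](_ : _ = a%:E * mu (phi @^-1` `]u, v]%classic))//.
  have -> : phi @^-1` `]u, v]%classic = `]((u - b) / a)%R, ((v - b) / a)%R]%classic.
    apply/seteqP; split => x /=; rewrite !in_itv/= /phi ltr_pdivrMr// ler_pdivlMr//;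
      rewrite ltrBlDr lerBrDr mulrC//.
  rewrite !lebesgue_measure_itv/= !lte_fin ltr_pM2r ?invr_gt0// ltrD2r.
  case: ifPn => uv; last by rewrite mule0.
  rewrite -!EFinB -EFinM; congr (_%:E).
  by field; rewrite gt_eqF.
rewrite (eq_measure_integral nu) => [|A mA _]; last exact: muE.
rewrite ge0_integral_mscale//= ge0_integral_pushforward//.
Qed.

End lebesgue_affine.

Section normal_integral.
Local Open Scope ereal_scope.
Context {R : realType}.
Notation N := (@normal_prob R 0%R 1%R).

Lemma ge0_integral_normal (f : R -> \bar R) :
  measurable_fun setT f -> (forall x, 0 <= f x) ->
  \int[N]_x f x = \int[lebesgue_measure]_x (f x * (normal_pdf 0 1 x)%:E).
Proof.
move=> mf f0; apply: (@ge0_integral_density _ (measurableTypeR R)) => //.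
- exact: measurable_normal_pdf.
- exact: normal_pdf_ge0.
Qed.

(** Density of the law of [a * G + b] with respect to that of [G], for [G] standard normal. *)
Definition wt1 (a b x : R) : R :=
  (a^-1 * expR (x ^+ 2 / 2 - (x - b) ^+ 2 / (2 * a ^+ 2)))%R.

Lemma normal_pdf01E (x : R) :
  normal_pdf 0 1 x = (normal_peak 1 * expR (- (x ^+ 2 / 2)))%R.
Proof.
rewrite normal_pdfE ?oner_eq0//; congr (_ * expR _)%R.
by rewrite subr0 expr1n mulNr.
Qed.

Lemma ge0_integral_normal_affine (a b : R) (f : R -> \bar R) : (0 < a)%R ->
  measurable_fun setT f -> (forall x, 0 <= f x) ->
  \int[N]_x f (a * x + b)%R = \int[N]_x (f x * (wt1 a b x)%:E).
Proof.
move=> a0 mf f0.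
have mw : measurable_fun setT (wt1 a b).
  apply: measurable_funM => //; apply: measurableT_comp => //.
  by apply: measurable_funB; apply: measurable_funM => //;
    apply: measurable_funX => //; apply: measurable_funB.
have mphi : measurable_fun setT (fun x : R => (a * x + b)%R).
  by apply: measurable_funD => //; apply: measurable_funM.
have w0 x : (0 <= wt1 a b x)%R by rewrite mulr_ge0 ?expR_ge0// invr_ge0 ltW.
rewrite !ge0_integral_normal//; last 3 first.
- by apply: emeasurable_funM => //; exact/measurable_EFinP.
- by move=> x; rewrite mule_ge0// lee_fin.
- exact: measurableT_comp.
rewrite [RHS](@ge0_integral_lebesgue_affine R a b)//; last 2 first.
- apply: emeasurable_funM => //; first apply: emeasurable_funM => //.
    exact/measurable_EFinP.
  by apply/measurable_EFinP; exact: measurable_normal_pdf.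
- move=> x; rewrite !mule_ge0// lee_fin//; exact: normal_pdf_ge0.
rewrite -ge0_integralZl//; last 3 first.
- apply: emeasurable_funM => //; first apply: emeasurable_funM => //.
  + exact: measurableT_comp.
  + by apply/measurable_EFinP; exact: measurableT_comp.
  + apply/measurable_EFinP; apply: measurableT_comp => //.
    exact: measurable_normal_pdf.
- move=> x _; rewrite !mule_ge0// lee_fin//; exact: normal_pdf_ge0.
- by rewrite lee_fin ltW.
apply: eq_integral => x _; rewrite !normal_pdf01E /wt1.
rewrite -[in RHS]muleA [RHS]muleCA; congr *%E.
rewrite -!EFinM; congr (_%:E).
rewrite mulrA [(_ * (normal_peak 1 * _))%R]mulrCA mulrA -!mulrA; congr (_ * _)%R.
rewrite mulrCA !mulrA.
rewrite -[in RHS]mulrA -expRD mulVf ?gt_eqF// mul1r; congr expR.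
by field; rewrite gt_eqF.
Qed.

End normal_integral.

(** * The standard Gaussian law in dimension [p] *)

Section gauss.
Context {R : realType}.

Definition consv p (x : R) (v : 'cV[R]_p) : 'cV[R]_p.+1 :=
  \col_i (if unlift ord0 i is Some j then v j 0 else x).

Definition tailv p (v : 'cV[R]_p.+1) : 'cV[R]_p := \col_j v (lift ord0 j) 0.

Lemma consv0 p x (v : 'cV[R]_p) : consv x v ord0 0 = x.
Proof. by rewrite mxE unlift_none. Qed.

Lemma consvS p x (v : 'cV[R]_p) j : consv x v (lift ord0 j) 0 = v j 0.
Proof. by rewrite mxE liftK. Qed.

Lemma consvP p (w : 'cV[R]_p.+1) : w = consv (w ord0 0) (tailv w).
Proof.
by apply/colP => i; case: (unliftP ord0 i) => [j|] ->; rewrite ?consvS ?consv0// mxE.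
Qed.

Lemma consvD p x y (v w : 'cV[R]_p) : consv x v + consv y w = consv (x + y) (v + w).
Proof.
by apply/colP => i; case: (unliftP ord0 i) => [j|] ->;
  rewrite mxE !(consvS,consv0)// mxE.
Qed.

Lemma consvZ p a x (v : 'cV[R]_p) : a *: consv x v = consv (a * x) (a *: v).
Proof.
by apply/colP => i; case: (unliftP ord0 i) => [j|] ->;
  rewrite mxE !(consvS,consv0)// mxE.
Qed.

Lemma dotv_consv p x y (v w : 'cV[R]_p) :
  dotv (consv x v) (consv y w) = x * y + dotv v w.
Proof.
rewrite /dotv big_ord_recl !consv0; congr (_ + _).
by apply: eq_bigr => j _; rewrite !consvS.
Qed.

Lemma measurable_consv d (T : measurableType d) p (f : T -> R) (g : T -> 'cV[R]_p) :
  measurable_fun setT f -> measurable_fun setT g ->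
  measurable_fun setT (fun t => consv (f t) (g t)).
Proof.
move=> mf mg; apply/measurable_fun_cVP => i.
case: (unliftP ord0 i) => [j|] ->; last by under eq_fun do rewrite consv0.
by under eq_fun do rewrite consvS; exact: measurable_cV_entry.
Qed.

Definition consv_pair p (z : measurableTypeR R * 'cV[R]_p) := consv z.1 z.2.

Let measurable_consv_pair p : measurable_fun setT (@consv_pair p).
Proof. exact: measurable_consv. Qed.

HB.instance Definition _ p :=
  isMeasurableFun.Build _ _ _ _ _ (@measurable_consv_pair p).

Definition stdnormal : probability (measurableTypeR R) R := normal_prob 0 1.

(** The recursion on the dimension makes integrals unfold by Tonelli, one coordinate at a time. *)
Fixpoint gauss (p : nat) : probability 'cV[R]_p R :=
  match p with
  | 0 => \d_(0 : 'cV[R]_0)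
  | p.+1 => distribution (stdnormal \x gauss p)%E (@consv_pair p)
  end.

Local Open Scope ereal_scope.

Lemma ge0_integral_gaussS p (f : 'cV[R]_p.+1 -> \bar R) :
  measurable_fun setT f -> (forall x, 0 <= f x) ->
  \int[gauss p.+1]_g f g = \int[stdnormal]_x \int[gauss p]_v f (consv x v).
Proof.
move=> mf f0; rewrite ge0_integral_distribution// fubini_tonelli1//=.
by apply: measurableT_comp => //; exact: measurable_consv.
Qed.

(** Density of the law of [a *: g + b] with respect to that of the standard Gaussian vector [g]. *)
Definition wt p (a : R) (b x : 'cV[R]_p) : R :=
  (a ^- p * expR (sqn x / 2 - sqn (x - b) / (2 * a ^+ 2)))%R.

Lemma wt_ge0 p a (b x : 'cV[R]_p) : (0 < a)%R -> (0 <= wt a b x)%R.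
Proof. by move=> a0; rewrite mulr_ge0 ?expR_ge0// invr_ge0 exprn_ge0// ltW. Qed.

Lemma wt_consv p a x y (b v : 'cV[R]_p) :
  wt a (consv x b) (consv y v) = (wt1 a x y * wt a b v)%R.
Proof.
rewrite /wt /wt1 -[in LHS](scaleN1r (consv _ _)) consvZ consvD /sqn !dotv_consv.
rewrite !mulN1r !scaleN1r mulrACA -expRD exprS invfM; congr (_ * expR _)%R.
ring.
Qed.

Lemma measurable_wt p a d (T : measurableType d) (f g : T -> 'cV[R]_p) :
  measurable_fun setT f -> measurable_fun setT g ->
  measurable_fun setT (fun t => wt a (f t) (g t)).
Proof.
move=> mf mg; apply: measurable_funM => //; apply: measurableT_comp => //.
by apply: measurable_funB; apply: measurable_funM => //; apply: measurable_sqn => //;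
  exact: measurable_cVB.
Qed.

(** The density [wt] factors over the coordinates, so induction on [p] reduces to the line. The case
    [a = 1] is the Cameron-Martin formula; other values of [a] give exponential moments, bounds on
    balls and the comparison of concentric balls. *)
Lemma ge0_integral_gauss_affine p (a : R) (b : 'cV[R]_p) (f : 'cV[R]_p -> \bar R) :
  (0 < a)%R -> measurable_fun setT f -> (forall x, 0 <= f x) ->
  \int[gauss p]_g f (a *: g + b)%R = \int[gauss p]_g (f g * (wt a b g)%:E).
Proof.
move=> a0; elim: p b f => [|p IH] b f mf f0.
  rewrite /= !integral_dirac// ?diracT ?mul1e; last 2 first.
    by apply: emeasurable_funM => //; apply/measurable_EFinP; exact: measurable_wt.
    by apply: measurableT_comp => //; apply: measurable_cVD => //; exact: measurable_cVZ.
  rewrite (_ : wt a b 0 = 1%R) ?mule1.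
    by congr f; apply/colP => -[].
  rewrite /wt expr0 invr1 mul1r /sqn /dotv !big_ord0 !mul0r subr0.
  exact: expR0.
have mab : measurable_fun setT (fun g : 'cV[R]_p.+1 => a *: g + b)%R.
  by apply: measurable_cVD => //; exact: measurable_cVZ.
have mw : measurable_fun setT (wt a b) by exact: measurable_wt.
rewrite (ge0_integral_gaussS (measurableT_comp mf mab) (fun g => f0 _)).
rewrite (ge0_integral_gaussS (f := fun g => f g * (wt a b g)%:E)); last 2 first.
- by apply: emeasurable_funM => //; exact/measurable_EFinP.
- by move=> g; rewrite mule_ge0// lee_fin wt_ge0.
pose F (x : R) := \int[gauss p]_v f (consv x (a *: v + tailv b)%R).
have mF : measurable_fun setT F.
  apply: (@measurable_integral2 _ _ _ _ _ (gauss p)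
    (fun x v => f (consv x (a *: v + tailv b)%R))) => //.
  apply: measurableT_comp => //; apply: measurable_consv => //.
  by apply: measurable_cVD => //; exact: measurable_cVZ.
transitivity (\int[stdnormal]_x F (a * x + b ord0 0)%R).
  apply: eq_integral => x _; apply: eq_integral => v _.
  by rewrite /= [in LHS](consvP b) consvZ consvD.
rewrite ge0_integral_normal_affine//; last by move=> x; exact: integral_ge0.
apply: eq_integral => x _; rewrite /F (IH _ (fun v => f (consv x v)))//; last first.
  by apply: measurableT_comp => //; exact: measurable_consv.
apply: etrans (esym (ge0_integralZr (gauss p) measurableT _ _ _)) _; last first.
- apply: eq_integral => v _.
  by rewrite [in RHS](consvP b) wt_consv EFinM -muleA; congr (_ * _); rewrite muleC.
- by rewrite lee_fin mulr_ge0 ?expR_ge0// invr_ge0 ltW.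
- by move=> v _; rewrite mule_ge0// lee_fin wt_ge0.
- apply: emeasurable_funM; last by apply/measurable_EFinP; exact: measurable_wt.
  by apply: measurableT_comp => //; exact: measurable_consv.
Qed.

End gauss.

(** * Characterization of the Gaussian law by shifts; linear images *)

Section gauss_characterization.
Local Open Scope ereal_scope.
Context {R : realType} {p : nat}.
Notation E := 'cV[R]_p.
Implicit Types (f : E -> \bar R) (x y b : E).

Definition cmd b x : R := expR (dotv b x - sqn b / 2).

Lemma cmd_ge0 b x : (0 <= cmd b x)%R. Proof. exact: expR_ge0. Qed.

Lemma measurable_cmd d (T : measurableType d) (g h : T -> E) :
  measurable_fun setT g -> measurable_fun setT h ->
  measurable_fun setT (fun t => cmd (g t) (h t)).
Proof.
move=> mg mh; apply: measurableT_comp => //; apply: measurable_funB.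
  exact: measurable_dotv.
by apply: measurable_funM => //; exact: measurable_sqn.
Qed.

Lemma wt1E b x : wt 1 b x = cmd b x.
Proof.
rewrite /wt expr1n invr1 mul1r /cmd sqnB expr1n mulr1 (dotvC b); congr expR.
by field.
Qed.

Lemma ge0_integral_gauss_shift b f :
  measurable_fun setT f -> (forall x, 0 <= f x) ->
  \int[gauss p]_g f (g + b)%R = \int[gauss p]_g (f g * (cmd b g)%:E).
Proof.
move=> mf f0; have := @ge0_integral_gauss_affine R p 1 b f ltr01 mf f0.
under eq_integral do rewrite scale1r.
by under [in X in _ = X -> _]eq_integral do rewrite wt1E.
Qed.

(** Up to a constant, the reciprocal of the Gaussian density: the Gaussian law weighted by [esq] is
    a multiple of Lebesgue measure. Only its translation invariance is used. *)
Definition esq x : R := expR (sqn x / 2).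

Lemma measurable_esq d (T : measurableType d) (g : T -> E) :
  measurable_fun setT g -> measurable_fun setT (fun t => (esq (g t))%:E).
Proof.
move=> mg; apply/measurable_EFinP; rewrite /esq.
apply: (@measurableT_comp _ _ _ _ _ _ (@expR R)) => //.
by apply: measurable_funM => //; exact: measurable_sqn.
Qed.

Section unique.
Context d (T : measurableType d) (P : probability T R) (X : T -> E).
Hypothesis mX : measurable_fun setT X.
Hypothesis Xshift : forall b f, measurable_fun setT f -> (forall x, 0 <= f x) ->
  \int[P]_t f (X t + b)%R = \int[P]_t (f (X t) * (cmd b (X t))%:E).

(** The product of [esq (x - b)] and [cmd b x] is [esq x]: the shift formula says that the law of
    [X] weighted by [esq] is translation invariant. *)
Let esq_shift b f : measurable_fun setT f -> (forall x, 0 <= f x) ->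
  \int[P]_t (f (X t + b)%R * (esq (X t))%:E) = \int[P]_t (f (X t) * (esq (X t))%:E).
Proof.
move=> mf f0; pose h x := f x * (esq (x - b))%:E.
transitivity (\int[P]_t h (X t + b)%R).
  by apply: eq_integral => t _; rewrite /h addrK.
rewrite Xshift.
- apply: eq_integral => t _; rewrite /h -muleA -EFinM /esq /cmd -expRD sqnB.
  by congr (_ * (expR _)%:E); rewrite dotvC; field.
- apply: emeasurable_funM => //; apply: measurable_esq; exact: measurable_cVB.
- by move=> x; rewrite mule_ge0// lee_fin expR_ge0.
Qed.

(** Integral of [G] against the product of two translation invariant measures, one built on the law
    of [X] and one on [gauss p]. Shears preserve such a product. *)
Let J (G : E -> E -> \bar R) :=
  \int[P]_t \int[gauss p]_y (G (X t) y * (esq (X t))%:E * (esq y)%:E).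

Let mG_comp (G : E -> E -> \bar R) d' (S : measurableType d') (g h : S -> E) :
  measurable_fun setT (fun z : E * E => G z.1 z.2) ->
  measurable_fun setT g -> measurable_fun setT h ->
  measurable_fun setT (fun s => G (g s) (h s)).
Proof.
move=> mG mg mh.
exact: (measurableT_comp mG (measurable_fun_pair mg mh)).
Qed.

Let maddE : measurable_fun setT (fun z : E * E => (z.1 + z.2)%R).
Proof. exact: measurable_cVD. Qed.

Let J1 G : measurable_fun setT (fun z : E * E => G z.1 z.2) ->
  (forall x y, 0 <= G x y) -> J (fun x y => G (x + y)%R y) = J G.
Proof.
move=> mG G0.
pose F (H : E -> E -> \bar R) t y := H (X t) y * (esq (X t))%:E * (esq y)%:E.
have swapF H : measurable_fun setT (fun z : E * E => H z.1 z.2) ->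
    (forall x y, 0 <= H x y) -> J H = \int[gauss p]_y \int[P]_t F H t y.
  move=> mH H0; apply: (@ge0_integral_swap _ _ _ _ _ P (gauss p) (F H)).
    apply: emeasurable_funM; last exact: measurable_esq.
    apply: emeasurable_funM; last by apply: measurable_esq; exact: measurableT_comp.
    by apply: mG_comp => //; exact: measurableT_comp.
  by move=> t y; rewrite !mule_ge0// lee_fin expR_ge0.
rewrite (swapF (fun x y => G (x + y)%R y)); last 2 first.
- exact: (mG_comp mG maddE measurable_snd).
- by move=> *; exact: G0.
rewrite (swapF _ mG G0); apply: eq_integral => y _; rewrite /F.
under eq_integral do rewrite -muleA (muleC (esq _)%:E) muleA.
under [RHS]eq_integral do rewrite -muleA (muleC (esq _)%:E) muleA.
apply: (@esq_shift y (fun x => G x y * (esq y)%:E)).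
  apply: emeasurable_funM; last exact: measurable_cst.
  exact: mG_comp.
by move=> x; rewrite mule_ge0// lee_fin expR_ge0.
Qed.

Let gesq_shift b f : measurable_fun setT f -> (forall x, 0 <= f x) ->
  \int[gauss p]_t (f (t + b)%R * (esq t)%:E) = \int[gauss p]_t (f t * (esq t)%:E).
Proof.
move=> mf f0; pose h x := f x * (esq (x - b))%:E.
transitivity (\int[gauss p]_t h (t + b)%R).
  by apply: eq_integral => t _; rewrite /h addrK.
rewrite ge0_integral_gauss_shift.
- apply: eq_integral => t _; rewrite /h -muleA -EFinM /esq /cmd -expRD sqnB.
  by congr (_ * (expR _)%:E); rewrite dotvC; field.
- apply: emeasurable_funM => //; apply: measurable_esq; exact: measurable_cVB.
- by move=> x; rewrite mule_ge0// lee_fin expR_ge0.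
Qed.

Let J2 G : measurable_fun setT (fun z : E * E => G z.1 z.2) ->
  (forall x y, 0 <= G x y) -> J (fun x y => G x (y - x)%R) = J G.
Proof.
move=> mG G0; apply: eq_integral => t _.
apply: (gesq_shift (- X t) (f := fun y => G (X t) y * (esq (X t))%:E)).
  apply: emeasurable_funM; last exact: measurable_cst.
  exact: mG_comp.
by move=> x; rewrite mule_ge0// lee_fin expR_ge0.
Qed.

(* The quarter turn (x, y) |-> (y, - x) is a product of three shears, each of
   which preserves [J]. *)
Lemma gauss_unique f : measurable_fun setT f -> (forall x, 0 <= f x) ->
  \int[P]_t f (X t) = \int[gauss p]_x f x.
Proof.
move=> mf f0.
(* The exponential cancels both weights, so [J G] is the integral of [f (X t)]. After the quarter
   turn [f] is evaluated at [y], and the same cancellation leaves the Gaussian integral of [f]. *)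
pose G x y := f x * (expR (- (sqn x / 2) - sqn y / 2))%:E.
have mG : measurable_fun setT (fun z : E * E => G z.1 z.2).
  apply: emeasurable_funM; first exact: measurableT_comp.
  apply/measurable_EFinP; apply: measurableT_comp => //.
  apply: measurable_funB; [apply: measurableT_comp => //|];
    by apply: measurable_funM => //; exact: measurable_sqn.
have G0 x y : 0 <= G x y by rewrite mule_ge0// lee_fin expR_ge0.
have <- : J G = \int[P]_t f (X t).
  apply: eq_integral => t _; rewrite -[RHS](@integral_cst_probability _ _ _ (gauss p)).
  apply: eq_integral => y _; rewrite /G -!muleA -!EFinM -!expRD.
  by rewrite (_ : (_ + _)%R = 0%R) ?expR0 ?mule1//; ring.
transitivity (J (fun x y => G y (- x)%R)); last first.
  rewrite -[RHS](@integral_cst_probability _ _ _ P).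
  apply: eq_integral => t _; apply: eq_integral => y _.
  rewrite /G -!muleA -!EFinM -!expRD sqnN.
  by rewrite (_ : (_ + _)%R = 0%R) ?expR0 ?mule1//; ring.
pose G1 x y := G (x + y)%R y; pose G2 x y := G1 x (y - x)%R.
have mG1 : measurable_fun setT (fun z : E * E => G1 z.1 z.2).
  exact: (mG_comp mG maddE measurable_snd).
have mG2 : measurable_fun setT (fun z : E * E => G2 z.1 z.2).
  apply: (mG_comp mG1 measurable_fst); exact: measurable_cVB.
rewrite -(J1 mG G0) -(@J2 G1 mG1 (fun x y => G0 _ _)) -(@J1 G2 mG2 (fun x y => G0 _ _)).
apply: eq_integral => t _; apply: eq_integral => y _.
have e1 : (y - (X t + y) = - X t)%R by rewrite opprD addrCA subrr addr0.
by rewrite /G2 /G1 e1 addrC addKr.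
Qed.

End unique.

Lemma dotv_mulmxr (A : 'M[R]_p) x y : dotv x (A *m y) = dotv (A^T *m x) y.
Proof. by rewrite dotv_mulmx trmxK. Qed.

(** The vector [A x + B y] satisfies the shift formula that characterizes [gauss p]: a shift [b]
    equals [A b1 + B b2] with [b1 = A^T b] and [b2 = B^T b], it is split between the two variables,
    and [|b|^2 = |b1|^2 + |b2|^2]. Rotation invariance, additivity of variances and the splitting of
    a Gaussian vector are all instances. *)
Lemma ge0_integral_gauss_lin (A B : 'M[R]_p) f : (A *m A^T + B *m B^T = 1%:M)%R ->
  measurable_fun setT f -> (forall x, 0 <= f x) ->
  \int[gauss p]_x \int[gauss p]_y f (A *m x + B *m y)%R = \int[gauss p]_x f x.
Proof.
move=> AB1 mf f0.
have mAB : measurable_fun setT (fun z : E * E => A *m z.1 + B *m z.2)%R.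
  by apply: measurable_cVD; exact: measurable_cV_mulmx.
have mAy x : measurable_fun setT (fun y => A *m x + B *m y)%R.
  by apply: measurable_cVD => //; exact: measurable_cV_mulmx.
have mAx y : measurable_fun setT (fun x => A *m x + B *m y)%R.
  by apply: measurable_cVD => //; exact: measurable_cV_mulmx.
rewrite -(fubini_tonelli1 (fun z : E * E => f (A *m z.1 + B *m z.2)%R))//; last first.
  exact: measurableT_comp.
apply: (@gauss_unique _ _ (gauss p \x gauss p) (fun z => A *m z.1 + B *m z.2)%R) => //.
have tonelli (F : E * E -> \bar R) : measurable_fun setT F -> (forall z, 0 <= F z) ->
    \int[gauss p \x gauss p]_z F z = \int[gauss p]_x \int[gauss p]_y F (x, y).
  exact: fubini_tonelli1.
move=> b {}f {}mf {}f0.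
have m1 : measurable_fun setT (fun z : E * E => f (A *m z.1 + B *m z.2 + b)%R).
  by apply: (@measurableT_comp _ _ _ _ _ _ f) => //; exact: measurable_cVD.
have m2 : measurable_fun setT
    (fun z : E * E => f (A *m z.1 + B *m z.2)%R * (cmd b (A *m z.1 + B *m z.2))%:E).
  apply: emeasurable_funM; first exact: measurableT_comp.
  by apply/measurable_EFinP; exact: measurable_cmd.
rewrite (tonelli _ m1 (fun z => f0 _)) (tonelli _ m2) /=; last first.
  by move=> z; rewrite mule_ge0// lee_fin cmd_ge0.
pose b1 := A^T *m b; pose b2 := B^T *m b.
have bE : b = (A *m b1 + B *m b2)%R by rewrite !mulmxA -mulmxDl AB1 mul1mx.
pose H x := \int[gauss p]_y (f (A *m x + B *m y)%R * (cmd b2 y)%:E).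
have H0 x : 0 <= H x by apply: integral_ge0 => y _; rewrite mule_ge0// lee_fin cmd_ge0.
have mH : measurable_fun setT H.
  apply: (@measurable_integral2 _ _ _ _ _ (gauss p)
    (fun x y => f (A *m x + B *m y)%R * (cmd b2 y)%:E)).
    apply: emeasurable_funM; first exact: measurableT_comp.
    by apply/measurable_EFinP; exact: measurable_cmd.
  by move=> *; rewrite mule_ge0// lee_fin cmd_ge0.
transitivity (\int[gauss p]_x H (x + b1)%R).
  apply: eq_integral => x _.
  rewrite /H -(ge0_integral_gauss_shift b2 (f := fun y => f (A *m (x + b1) + B *m y)%R))//.
    by apply: eq_integral => y _; rewrite {1}bE !mulmxDr addrACA.
  exact: measurableT_comp.
apply: etrans (ge0_integral_gauss_shift b1 mH H0) _; apply: eq_integral => x _.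
rewrite /H; apply: etrans (esym (ge0_integralZr (gauss p) measurableT _ _ _)) _; last first.
- apply: eq_integral => y _; rewrite -muleA -EFinM -expRD; congr (_ * (expR _)%:E).
  rewrite dotvDr !dotv_mulmxr -/b1 -/b2.
  have -> : sqn b = (sqn b1 + sqn b2)%R.
    transitivity (dotv b (A *m b1 + B *m b2)%R); first by rewrite -bE.
    by rewrite dotvDr (dotv_mulmxr A) (dotv_mulmxr B).
  by field.
- by rewrite lee_fin cmd_ge0.
- by move=> y _; rewrite mule_ge0// lee_fin cmd_ge0.
- apply: emeasurable_funM; first exact: measurableT_comp.
  by apply/measurable_EFinP; exact: measurable_cmd.
Qed.

End gauss_characterization.

(** * Abstract standard Gaussian vectors have law [gauss p] *)

Section standard_gaussian_law.
Context {R : realType}.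

Lemma gauss_rect p (A : 'I_p -> set R) : (forall j, measurable (A j)) ->
  gauss p [set v : 'cV[R]_p | forall j, A j (v j 0)] =
  (\prod_(j < p) normal_prob 0 1 (A j))%E.
Proof.
elim: p A => [|p IH] A mA.
  rewrite big_ord0 /= diracE mem_set//=; by case.
rewrite big_ord_recl -IH; last by move=> j; exact: mA.
rewrite /= /distribution /pushforward.
rewrite (_ : _ @^-1` _ = A ord0 `*` [set v : 'cV[R]_p | forall j, A (lift ord0 j) (v j 0)]).
  have mt : measurable [set v : 'cV[R]_p | forall j, A (lift ord0 j) (v j 0)]; last first.
    by rewrite product_measure1E//; exact: mA.
  have -> : [set v : 'cV[R]_p | forall j, A (lift ord0 j) (v j 0)] =
     \bigcap_(j in [set: 'I_p]) ((fun v : 'cV[R]_p => v j 0) @^-1` A (lift ord0 j)).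
    by apply/seteqP; split => v /= h j => [_|]; apply: h.
  apply: fin_bigcap_measurable => // j _.
  rewrite -[X in measurable X]setTI; apply: (measurable_cV_entry (f := id)) => //.
apply/seteqP; split => -[x v] /=; rewrite /consv_pair /=.
  by move=> h; split => [|j]; [have := h ord0|have := h (lift ord0 j)]; rewrite ?consv0 ?consvS.
by move=> [h0 h] i; case: (unliftP ord0 i) => [j|] ->; rewrite ?consv0 ?consvS.
Qed.

Let rects p : set (set 'cV[R]_p) :=
  [set B | exists A : 'I_p -> set R, (forall j, measurable (A j)) /\
    B = [set v : 'cV[R]_p | forall j, A j (v j 0)]].

Let measurable_rect p (A : 'I_p -> set R) : (forall j, measurable (A j)) ->
  measurable [set v : 'cV[R]_p | forall j, A j (v j 0)].
Proof.
move=> mA; have -> : [set v : 'cV[R]_p | forall j, A j (v j 0)] =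
    \bigcap_(j in [set: 'I_p]) ((fun v : 'cV[R]_p => v j 0) @^-1` A j).
  by apply/seteqP; split => v /= h j => [_|]; apply: h.
apply: fin_bigcap_measurable => // j _.
by rewrite -[X in measurable X]setTI; apply: (measurable_cV_entry (f := id)).
Qed.

Let measurable_rects p : (measurable : set (set 'cV[R]_p)) = <<s @rects p >>.
Proof.
apply/seteqP; split; last first.
  apply: smallest_sub; first exact: sigma_algebra_measurable.
  by move=> _ [A [mA ->]]; exact: measurable_rect.
change (g_sigma_preimage (@cV_coord R p) `<=` <<s @rects p >>).
apply: smallest_sub; first exact: smallest_sigma_algebra.
case: p => [|n]; first by rewrite big_ord0.
rewrite -bigcup_mkord_ord; apply: bigcup_sub => i Ii _ [B mB <-].
apply: sub_sigma_algebra; exists (fun j => if j == inord i then B else setT).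
split => [j|]; first by case: ifP.
apply/seteqP; split => v /=; rewrite /cV_coord.
  by move=> [_ Bv] j; case: eqP => // ->.
by move=> /(_ (inord i)); rewrite eqxx.
Qed.

(** Both laws give a box the product of its one-dimensional normal probabilities, and boxes form a
    generating family stable under intersection. *)
Lemma standard_gaussian_law d (T : measurableType d) (P : probability T R) p
    (W : {RV P >-> 'cV[R]_p}) : standard_gaussian P W ->
  forall A, measurable A -> distribution P W A = gauss p A.
Proof.
move=> [indW lawW]; apply: (measure_unique (@rects p) (fun=> setT)).
- exact: measurable_rects.
- move=> _ _ [A [mA ->]] [B [mB ->]]; exists (fun j => A j `&` B j).
  split => [j|]; first exact: measurableI.
  by apply/seteqP; split => v /= => [[h1 h2] j|h]; split => //; move=> j; case: (h j).
- move=> _; exists (fun=> setT); split => //; by apply/seteqP; split.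
- by rewrite bigcup_const.
- move=> _ [A [mA ->]]; apply: etrans (esym (gauss_rect mA)).
  have := indW [set: 'I_p]%SET A mA.
  rewrite (eq_bigl xpredT) => [|j]; last by rewrite inE.
  under eq_bigr do rewrite lawW//.
  move=> <-; congr (P _); apply/seteqP; split => t /= h j => [_|]; apply: h.
  by rewrite /= inE.
- by move=> k; apply: (@le_lt_trans _ _ 1%E); [exact: probability_le1|exact: ltry].
Qed.

Lemma ge0_integral_standard_gaussian d (T : measurableType d) (P : probability T R) p
    (W : {RV P >-> 'cV[R]_p}) (f : 'cV[R]_p -> \bar R) : standard_gaussian P W ->
  measurable_fun setT f -> (forall x, (0 <= f x)%E) ->
  (\int[P]_t f (W t) = \int[gauss p]_x f x)%E.
Proof.
move=> sW mf f0; rewrite -(ge0_integral_distribution W)//.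
by apply: eq_measure_integral => A mA _; exact: (standard_gaussian_law sW).
Qed.

End standard_gaussian_law.

(** * Convolution operators *)

Section operators.
Context {R : realType} {p : nat}.
Notation E := 'cV[R]_p.
Local Open Scope ereal_scope.
Implicit Types (f : E -> \bar R) (mu nu : probability E R).

Definition nnmeas f := measurable_fun setT f /\ forall x, 0 <= f x.

(** Laws act on functions as operators. Commuting these operators plays the role of reordering
    independent summands, without any joint probability space. *)
Definition cv mu f (x : E) : \bar R := \int[mu]_y f (x + y)%R.

Definition gs (s : R) f (x : E) : \bar R := \int[gauss p]_g f (x + s *: g)%R.

Lemma nnmeas_ind d (T : measurableType d) (Q : probability T R) (k : E -> T -> E) f :
  measurable_fun setT (fun z : E * T => k z.1 z.2) -> nnmeas f ->
  nnmeas (fun x => \int[Q]_t f (k x t)).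
Proof.
move=> mk [mf f0]; split; last by move=> x; exact: integral_ge0.
apply: (@measurable_integral2 _ _ _ _ _ Q (fun x t => f (k x t))) => //.
exact: (measurableT_comp mf mk).
Qed.

Lemma nnmeas_cv mu f : nnmeas f -> nnmeas (cv mu f).
Proof. by apply: nnmeas_ind; exact: measurable_cVD. Qed.

Lemma nnmeas_gs s f : nnmeas f -> nnmeas (gs s f).
Proof.
by apply: nnmeas_ind; apply: measurable_cVD => //; exact: measurable_cVZ.
Qed.

Lemma nnmeas_shift (b : E) f : nnmeas f -> nnmeas (fun x => f (x + b)%R).
Proof.
by move=> [mf f0]; split => //; apply: (measurableT_comp mf); exact: measurable_cVD.
Qed.

Lemma integral_swap_probability mu nu (F : E -> E -> \bar R) :
  measurable_fun setT (fun z : E * E => F z.1 z.2) -> (forall x y, 0 <= F x y) ->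
  \int[mu]_x \int[nu]_y F x y = \int[nu]_y \int[mu]_x F x y.
Proof. exact: ge0_integral_swap. Qed.

Lemma cv_comm mu nu f : nnmeas f -> cv mu (cv nu f) = cv nu (cv mu f).
Proof.
move=> [mf f0]; apply/funext => x; rewrite /cv.
apply: (etrans (@integral_swap_probability mu nu (fun y z => f (x + y + z)%R) _ _)).
- by apply: (measurableT_comp mf); do 2 apply: measurable_cVD => //.
- by move=> *; exact: f0.
- by apply: eq_integral => y _; apply: eq_integral => z _; rewrite addrAC.
Qed.

Lemma cv_gs mu s f : nnmeas f -> cv mu (gs s f) = gs s (cv mu f).
Proof.
move=> [mf f0]; apply/funext => x; rewrite /cv /gs.
apply: (etrans (@integral_swap_probability mu (gauss p) (fun y z => f (x + y + s *: z)%R) _ _)).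
- apply: (measurableT_comp mf); apply: measurable_cVD; first exact: measurable_cVD.
  exact: measurable_cVZ.
- by move=> *; exact: f0.
- by apply: eq_integral => y _; apply: eq_integral => z _; rewrite addrAC.
Qed.

(** Variances add: this is the linear image formula for the scalar matrices [s / r] and [s' / r],
    where [r^2 = s^2 + s'^2]. *)
Lemma gs_gs s s' f : (0 < s)%R -> nnmeas f ->
  gs s (gs s' f) = gs (Num.sqrt (s ^+ 2 + s' ^+ 2)) f.
Proof.
move=> s0 [mf f0]; apply/funext => x.
set r := Num.sqrt _; have r0 : (0 < r)%R.
  by rewrite sqrtr_gt0 ltr_pwDl ?exprn_gt0 ?sqr_ge0.
have r2 : (r ^+ 2 = s ^+ 2 + s' ^+ 2)%R.
  by rewrite sqr_sqrtr// addr_ge0 ?sqr_ge0.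
have AB1 : ((s / r)%:M *m (s / r)%:M^T + (s' / r)%:M *m (s' / r)%:M^T = 1%:M :> 'M[R]_p)%R.
  rewrite !tr_scalar_mx -!scalar_mxM -raddfD -!expr2 !exprMn -mulrDl -r2 exprVn.
  by rewrite divff// expf_neq0// gt_eqF.
apply: etrans (ge0_integral_gauss_lin (f := fun g => f (x + r *: g)%R) AB1 _ _).
- apply: eq_integral => y _; apply: eq_integral => z _.
  rewrite !mul_scalar_mx scalerDr !scalerA ![(r * _)%R]mulrC.
  by rewrite !divfK ?gt_eqF// addrA.
- apply: (measurableT_comp mf); apply: measurable_cVD => //.
  exact: measurable_cVZ.
- by move=> g; exact: f0.
Qed.

Lemma cv_le1 mu f : nnmeas f -> (forall x, f x <= 1) -> forall x, cv mu f x <= 1.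
Proof.
move=> hf f1 x; rewrite -(integral_cst_probability mu 1).
have [mf f0] := nnmeas_shift x hf; apply: ge0_le_integralT => //.
  by under eq_fun do rewrite addrC.
by move=> y; exact: (proj2 hf).
Qed.

End operators.

(** * Balls and their probabilities *)

Section balls.
Context {R : realType} {p : nat}.
Notation E := 'cV[R]_p.
Implicit Types (c g x : E) (u : R).

(** The parameter is the squared radius and may be negative, in which case the ball is empty;
    smoothing shifts it by [p * eps^2]. *)
Definition sqball c u : set E := [set x | sqn (x - c) <= u].

Lemma measurable_sqball c u : measurable (sqball c u).
Proof.
have mf : measurable_fun setT (fun x : E => sqn (x - c)).
  by apply: measurable_sqn; exact: measurable_cVB.
have := mf measurableT `]-oo, u]%classic (measurable_itv _).
by rewrite setTI (_ : _ @^-1` _ = sqball c u).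
Qed.

Definition prb (mu : probability E R) (A : set E) : R := fine (mu A).

Lemma prbE (mu : probability E R) A : measurable A -> (prb mu A)%:E = mu A.
Proof. by move=> mA; rewrite /prb fineK// fin_num_measure. Qed.

Lemma prb_ge0 (mu : probability E R) A : 0 <= prb mu A.
Proof. by rewrite /prb fine_ge0. Qed.

Lemma prb_le1 (mu : probability E R) A : measurable A -> prb mu A <= 1.
Proof. by move=> mA; rewrite -lee_fin prbE// probability_le1. Qed.

Lemma le_prb (mu : probability E R) A B : measurable A -> measurable B ->
  A `<=` B -> prb mu A <= prb mu B.
Proof.
by move=> mA mB AB; rewrite -lee_fin !prbE//; apply: le_measure; rewrite ?inE.
Qed.

Lemma prb_indic (mu : probability E R) A : measurable A ->
  ((prb mu A)%:E = \int[mu]_x (\1_A x)%:E)%E.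
Proof. by move=> mA; rewrite prbE// integral_indic// setIT. Qed.

End balls.

(** * Exponential and quadratic moments of the Gaussian law *)

Section gauss_moments.
Context {R : realType} {p : nat}.
Notation E := 'cV[R]_p.
Notation gamma := (@gauss R p).
Implicit Types (b c g x : E) (u : R).
Local Open Scope ereal_scope.

Lemma integral_wt (a : R) b : (0 < a)%R -> \int[gamma]_g (wt a b g)%:E = 1.
Proof.
move=> a0; rewrite -[RHS](integral_cst_probability gamma 1).
rewrite (@ge0_integral_gauss_affine R p a b (fun=> 1))//.
by apply: eq_integral => x _; rewrite mul1e.
Qed.

Lemma integral_cmd b : \int[gamma]_g (cmd b g)%:E = 1.
Proof. by rewrite -[RHS](integral_wt b ltr01); under [RHS]eq_integral do rewrite wt1E. Qed.

Lemma integral_le_scaled (Q : probability E R) (f h : E -> R) (k : R) : (0 <= k)%R ->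
  measurable_fun setT f -> measurable_fun setT h -> (forall x, 0 <= f x)%R ->
  (forall x, 0 <= h x)%R -> (forall x, f x <= k * h x)%R ->
  \int[Q]_x (f x)%:E <= k%:E * \int[Q]_x (h x)%:E.
Proof.
move=> k0 mf mh f0 h0 fh; rewrite -ge0_integralZl//; last 2 first.
- exact/measurable_EFinP.
- by move=> x _; rewrite lee_fin.
apply: ge0_le_integralT.
- exact/measurable_EFinP.
- by apply/measurable_EFinP; apply: measurable_funM.
- by move=> x; rewrite lee_fin.
- by move=> x; rewrite -EFinM lee_fin.
Qed.

Lemma integral_leD (Q : probability E R) (f h : E -> R) (A B : R) :
  measurable_fun setT f -> measurable_fun setT h -> (forall x, 0 <= f x)%R ->
  (forall x, 0 <= h x)%R -> \int[Q]_x (f x)%:E <= A%:E -> \int[Q]_x (h x)%:E <= B%:E ->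
  \int[Q]_x (f x + h x)%:E <= (A + B)%:E.
Proof.
move=> mf mh f0 h0 fA hB; rewrite EFinD; apply: le_trans (leeD fA hB).
rewrite -ge0_integralD//.
- by move=> x _; rewrite lee_fin.
- exact/measurable_EFinP.
- by move=> x _; rewrite lee_fin.
- exact/measurable_EFinP.
Qed.

Lemma integral_expR_dotv b : \int[gamma]_g (expR (dotv b g))%:E <= (expR (sqn b / 2))%:E.
Proof.
rewrite -[leRHS]mule1 -(integral_cmd b); apply: integral_le_scaled.
- exact: expR_ge0.
- by apply: measurableT_comp => //; exact: measurable_dotv.
- exact: measurable_cmd.
- by move=> x; exact: expR_ge0.
- by move=> x; exact: cmd_ge0.
- by move=> x; rewrite /cmd -expRD addrC subrK.
Qed.

(** The integrand is a constant multiple of the density [wt a 0] with [a = (1 - s)^(-1/2)], whose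
    total mass is one. *)
Lemma integral_expR_sqn (s : R) : (s < 1)%R ->
  \int[gamma]_g (expR (s * sqn g / 2))%:E <= ((Num.sqrt (1 - s))^-1 ^+ p)%:E.
Proof.
move=> s1; have a0 : (0 < (Num.sqrt (1 - s))^-1)%R by rewrite invr_gt0 sqrtr_gt0 subr_gt0.
rewrite -[leRHS]mule1 -(integral_wt 0 a0); apply: integral_le_scaled.
- by rewrite exprn_ge0// ltW.
- apply: measurableT_comp => //; apply: measurable_funM => //.
  by apply: measurable_funM => //; exact: measurable_sqn.
- exact: measurable_wt.
- by move=> x; exact: expR_ge0.
- by move=> x; exact: wt_ge0.
- move=> x; rewrite /wt mulrA divff ?expf_neq0 ?gt_eqF// mul1r subr0 ler_expR.
  rewrite exprVn sqr_sqrtr ?subr_ge0 ?(ltW s1)//.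
  by rewrite le_eqVlt; apply/orP; left; apply/eqP; field; rewrite subr_eq0 gt_eqF.
Qed.


Lemma sqr_le_expR (z : R) : (z ^+ 2 <= 2 * (expR z + expR (- z)))%R.
Proof.
have pos (x : R) : (0 <= x)%R -> (x ^+ 2 <= 2 * expR x)%R.
  by move=> x0; have := @expR_ge1Dxn R x 1 x0; rewrite (_ : 2`! = 2)%N//; lra.
have [z0|/ltW z0] := leP 0%R z.
  by have := pos z z0; have := expR_ge0 (- z); lra.
have := pos (- z)%R; rewrite oppr_ge0 sqrrN => /(_ z0).
by have := expR_ge0 z; lra.
Qed.

(** An elementary form of [- log (1 - s) <= s + 2 s^2], through [(1 + z / 2)^2 <= exp z]. *)
Lemma onem_expR_ge1 (s : R) :
  (- (1 / 2) <= s <= 1 / 2)%R -> (1 <= (1 - s) * expR (s + 2 * s ^+ 2))%R.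
Proof.
move=> /andP[s1 s2]; set z := (s + 2 * s ^+ 2)%R.
have h : ((1 + z / 2) ^+ 2 <= expR z)%R.
  rewrite [in leRHS](_ : z = z / 2 + z / 2)%R; last by field.
  rewrite expRD -expr2 lerXn2r ?nnegrE ?expR_ge0 ?expR_ge1Dx//.
  by rewrite /z; nra.
have s3 : (0 <= 1 - s)%R by lra.
apply: le_trans (ler_wpM2l s3 h); rewrite /z.
rewrite [leRHS](_ : _ = 1 + s ^+ 2 * (5/4 - 5/4 * s - s ^+ 3))%R; last by field.
rewrite lerDl mulr_ge0 ?sqr_ge0//.
have : (s ^+ 3 <= 1/4)%R by nra.
by move=> ?; lra.
Qed.

Let mdot b : measurable_fun setT (fun g : E => expR (dotv b g)).
Proof. by apply: measurableT_comp => //; exact: measurable_dotv. Qed.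

Let center (s : R) (g : E) : R := (s * (sqn g - p%:R) / 2)%R.

Let mcenter s : measurable_fun setT (fun g : E => expR (center s g)).
Proof.
apply: measurableT_comp => //; apply: measurable_funM => //.
apply: measurable_funM => //; apply: measurable_funB => //; exact: measurable_sqn.
Qed.

(** Subtracting [p] cancels the term of order [s p] in the exponent and leaves [s^2 p], hence a
    bound that does not grow with the dimension. *)
Let integral_expR_center s : (s ^+ 2 * p%:R <= 1 / 4)%R -> (- (1 / 2) <= s <= 1 / 2)%R ->
  \int[gamma]_g (expR (center s g))%:E <= (expR 1)%:E.
Proof.
move=> sp /andP[sl sr].
have s1 : (s < 1)%R by lra.
have p0 : (0 <= p%:R :> R)%R by [].
apply: (@le_trans _ _ ((expR (- (s * p%:R / 2)))%:E *
    \int[gamma]_g (expR (s * sqn g / 2))%:E)).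
  apply: integral_le_scaled => //.
  - apply: measurableT_comp => //; apply: measurable_funM => //.
    by apply: measurable_funM => //; exact: measurable_sqn.
  - by move=> x; rewrite -expRD ler_expR /center; lra.
apply: (@le_trans _ _ ((expR (- (s * p%:R / 2)))%:E * (expR ((s + 2 * s ^+ 2) / 2 * p%:R))%:E)).
  rewrite lee_wpmul2l ?lee_fin ?expR_ge0//.
  apply: (le_trans (integral_expR_sqn s1)); rewrite lee_fin expRM_natr.
  rewrite lerXn2r ?nnegrE ?expR_ge0 ?invr_ge0 ?sqrtr_ge0//.
  rewrite -[leRHS]invrK lef_pV2 ?posrE ?sqrtr_gt0 ?invr_gt0 ?expR_gt0 ?subr_gt0//.
  rewrite -expRN -(@ler_pXn2r _ 2)// ?nnegrE ?expR_ge0 ?sqrtr_ge0//.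
  rewrite sqr_sqrtr ?subr_ge0 ?(ltW s1)// expr2 -expRD.
  rewrite (_ : _ + _ = - (s + 2 * s ^+ 2))%R; last by field.
  rewrite expRN -[leLHS]mul1r ler_pdivrMr ?expR_gt0//.
  by apply: onem_expR_ge1; rewrite sl.
rewrite -EFinM -expRD lee_fin ler_expR.
rewrite [leLHS](_ : _ = s ^+ 2 * p%:R)%R; last by field.
by lra.
Qed.

(** The exact value is [2 alpha^2 p + |b|^2]. Losing a constant allows exponential moments to be
    used instead of fourth moments, by [z^2 <= 2 (exp z + exp (- z))]. *)
Lemma gauss_quadratic_moment (alpha : R) b :
  \int[gamma]_g ((alpha * (sqn g - p%:R) + dotv b g) ^+ 2)%:E <=
  (128 * expR 1 * (alpha ^+ 2 * p%:R + sqn b))%:E.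
Proof.
have [p0|p0] := posnP p.
  rewrite integral0_eq ?lee_fin; last first.
    move=> g _; rewrite (_ : _ + _ = 0)%R ?expr0n//.
    move: g b; rewrite /sqn /dotv p0 => g b; rewrite !big_ord0; ring.
  by rewrite !mulr_ge0 ?expR_ge0// addr_ge0 ?sqn_ge0// mulr_ge0// sqr_ge0.
have pR : (0 < p%:R :> R)%R by rewrite ltr0n.
have p1 : (1 <= p%:R :> R)%R by rewrite ler1n.
(* This [s] is the largest one with [s^2 p <= 1 / 4], as required for a dimension-free exponential
   moment. *)
pose r : R := Num.sqrt p%:R; pose s : R := ((2 * r)^-1)%R.
have r0 : (0 < r)%R by rewrite sqrtr_gt0.
have r2 : (r ^+ 2 = p%:R)%R by rewrite sqr_sqrtr// ltW.
have r1 : (1 <= r)%R by rewrite -[1%R]sqrtr1 ler_wsqrtr.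
have s0 : (0 < s)%R by rewrite invr_gt0; lra.
have s2 : (s ^+ 2 * p%:R = 1 / 4)%R.
  by rewrite /s -r2; field; rewrite gt_eqF.
have s12 : (s <= 1 / 2)%R by rewrite /s invfM; have := invf_le1 r0; rewrite r1; lra.
pose nb : R := Num.sqrt (sqn b).
have nb2 : (nb ^+ 2 = sqn b)%R by rewrite sqr_sqrtr// sqn_ge0.
pose v : E := (nb^-1 *: b)%R.
have v1 : (sqn v <= 1)%R.
  rewrite sqnZ -nb2 exprVn; have [->|nb0] := eqVneq nb 0%R; first by rewrite expr0n mulr0.
  by rewrite mulVf// expf_neq0.
have bv : b = (nb *: v)%R.
  rewrite scalerA; have [nb0|nb0] := eqVneq nb 0%R; last by rewrite divff// scale1r.
  rewrite nb0 mul0r scale0r; apply/eqP; rewrite -sqn_eq0 -nb2 nb0 expr0n//.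
pose k1 : R := (64 * alpha ^+ 2 * p%:R)%R; pose k2 : R := (4 * sqn b)%R.
have k10 : (0 <= k1)%R by apply: mulr_ge0 => //; apply: mulr_ge0 => //; exact: sqr_ge0.
have k20 : (0 <= k2)%R by rewrite mulr_ge0// sqn_ge0.
pose F g : R := (k1 * expR (center s g) + k1 * expR (center (- s) g) +
  (k2 * expR (dotv v g) + k2 * expR (dotv (- v) g)))%R.
have le1 g : ((alpha * (sqn g - p%:R) + dotv b g) ^+ 2 <= F g)%R.
  set y := center s g; have ys : (center (- s) g = - y)%R by rewrite /y /center; lra.
  have h1 := sqr_le_expR y; have h2 := sqr_le_expR (dotv v g).
  rewrite /F ys dotvNl -/y.
  have -> : (sqn g - p%:R = 4 * r * y)%R.
    by rewrite /y /center /s; field; rewrite gt_eqF.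
  rewrite bv dotvZl.
  have -> : k1 = (64 * alpha ^+ 2 * r ^+ 2)%R by rewrite r2.
  have -> : k2 = (4 * nb ^+ 2)%R by rewrite nb2.
  have a1 : (0 <= 32 * (alpha * r) ^+ 2)%R by rewrite mulr_ge0// sqr_ge0.
  have a2 : (0 <= 2 * nb ^+ 2)%R by rewrite mulr_ge0// sqr_ge0.
  have := ler_wpM2l a1 h1; have := ler_wpM2l a2 h2.
  have := sqr_ge0 (alpha * (4 * r * y) - nb * dotv v g)%R.
  set X := expR y; set Y := expR (- y); set V := expR _; set V' := expR _.
  set z := dotv v g; clear; nra.
have mF1 k (f : E -> R) : measurable_fun setT f ->
    measurable_fun setT (fun x => (k * f x)%R).
  by move=> mf; apply: measurable_funM.
have F0 k (f : E -> R) x : (0 <= k)%R -> (0 <= k * expR (f x))%R.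
  by move=> k0; rewrite mulr_ge0// expR_ge0.
have m1 := mF1 k1 _ (mcenter s); have m2 := mF1 k1 _ (mcenter (- s)).
have m3 := mF1 k2 _ (mdot v); have m4 := mF1 k2 _ (mdot (- v)).
have le2 : \int[gamma]_g (F g)%:E <= (k1 * expR 1 + k1 * expR 1 + (k2 * expR 1 + k2 * expR 1))%:E.
  have Ik k (f : E -> R) : (0 <= k)%R -> measurable_fun setT (fun g => expR (f g)) ->
      \int[gamma]_g (expR (f g))%:E <= (expR 1)%:E ->
      \int[gamma]_g (k * expR (f g))%:E <= (k * expR 1)%:E.
    move=> k0 mf fi; apply: le_trans (_ : k%:E * \int[gamma]_g (expR (f g))%:E <= _).
      apply: integral_le_scaled => // [|x]; last by rewrite mulr_ge0// expR_ge0.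
      by apply: measurable_funM.
    by rewrite EFinM lee_wpmul2l// lee_fin.
  apply: integral_leD.
  - exact: measurable_funD m1 m2.
  - exact: measurable_funD m3 m4.
  - by move=> x; rewrite addr_ge0// F0.
  - by move=> x; rewrite addr_ge0// F0.
  - apply: integral_leD m1 m2 _ _ _ _; try (by move=> x; exact: F0); apply: Ik => //.
    + by apply: integral_expR_center; [rewrite s2|lra].
    + by apply: integral_expR_center; [rewrite sqrrN s2|lra].
  - apply: integral_leD m3 m4 _ _ _ _; try (by move=> x; exact: F0); apply: Ik => //.
    + apply: le_trans (integral_expR_dotv _) _; rewrite lee_fin ler_expR; lra.
    + apply: le_trans (integral_expR_dotv _) _; rewrite sqnN lee_fin ler_expR; lra.
apply: le_trans (le_trans (ge0_le_integralT _ _ _ _ _) le2) _.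
- apply/measurable_EFinP; apply: measurable_funX; apply: measurable_funD.
    by apply: measurable_funM => //; apply: measurable_funB => //; exact: measurable_sqn.
  exact: measurable_dotv.
- apply/measurable_EFinP; apply: measurable_funD.
    exact: measurable_funD m1 m2.
  exact: measurable_funD m3 m4.
- by move=> g; rewrite lee_fin sqr_ge0.
- by move=> g; rewrite lee_fin.
- rewrite lee_fin /k1 /k2.
  have e0 := expR_ge0 (1 : R).
  have := mulr_ge0 (expR_ge0 (1 : R)) (sqn_ge0 b).
  lra.
Qed.

End gauss_moments.

(** * Gaussian probability of a ball *)

Section gauss_ball.
Context {R : realType} {p : nat}.
Notation E := 'cV[R]_p.
Notation gamma := (@gauss R p).
Implicit Types (b c g x : E) (u : R).

(** Exponential Markov inequality: the indicator of the ball is at most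
    [exp ((u - |x - c|^2) / (2 u))]. This function is a multiple of the density [wt] with scale [a]
    and center [c / (1 + u)], so its integral is that multiple. *)
Lemma gauss_ball_laplace c u : 0 < u ->
  prb gamma (sqball c u) <=
  expR (1 / 2) * Num.sqrt (u / (1 + u)) ^+ p * expR (- (sqn c / (2 * (1 + u)))).
Proof.
move=> u0; set a := Num.sqrt (u / (1 + u)).
have u1 : 0 < 1 + u by lra.
have a0 : 0 < a by rewrite sqrtr_gt0 divr_gt0.
have a2 : a ^+ 2 = u / (1 + u) by rewrite sqr_sqrtr// divr_ge0// ltW.
set K : R := _ * expR _.
have K0 : 0 <= K by rewrite mulr_ge0 ?mulr_ge0 ?expR_ge0 ?exprn_ge0 ?(ltW a0).
rewrite -lee_fin prb_indic; last exact: measurable_sqball.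
rewrite -[leRHS]mule1 -(integral_wt ((1 + u)^-1 *: c) a0).
apply: integral_le_scaled => //.
- by apply: measurable_indic; exact: measurable_sqball.
- exact: measurable_wt.
- by move=> x; exact: wt_ge0.
- move=> x; have [xB|xB] := boolP (x \in sqball c u); last first.
    by rewrite indicE (negbTE xB) mulr_ge0// wt_ge0.
  rewrite indicE xB /K /wt mulrACA -mulrA -expRD.
  set e' := expR (_ + _); set ap := a ^+ p.
  have ap0 : ap != 0 by rewrite expf_neq0// gt_eqF.
  rewrite [leRHS](_ : _ = expR (1 / 2) * e'); last by field.
  rewrite /e' -expRD.
  rewrite -[leLHS]expR0 ler_expR.
  move: xB; rewrite inE /sqball /= => xB.
  have -> : 1 / 2 + (- (sqn c / (2 * (1 + u))) +
      (sqn x / 2 - sqn (x - (1 + u)^-1 *: c) / (2 * a ^+ 2))) =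
      (u - sqn (x - c)) / (2 * u).
    rewrite a2 !sqnB !sqnZ dotvZr; field; do ?[apply/andP; split]; rewrite ?gt_eqF//.
  by rewrite divr_ge0 ?subr_ge0// mulr_ge0// ltW.
Qed.

Let q u := u / (1 + u).

Let expRN_le1 (z : R) : 0 <= z -> expR (- z) <= (1 + z)^-1.
Proof.
move=> z0; rewrite expRN lef_pV2 ?posrE ?expR_gt0 ?expR_ge1Dx//; lra.
Qed.

Let expRN_le2 (z : R) : 0 <= z -> expR (- z) <= 4 * (1 + z) ^- 2.
Proof.
move=> z0; have h : (1 + z / 2) ^+ 2 <= expR z.
  rewrite [in leRHS](_ : z = z / 2 + z / 2)%R; last by field.
  rewrite expRD -expr2 lerXn2r ?nnegrE ?expR_ge0 ?expR_ge1Dx//; lra.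
have h2 : 0 < (1 + z) ^+ 2 by rewrite exprn_gt0//; lra.
rewrite expRN -[4]invrK -invfM lef_pV2 ?posrE ?expR_gt0//; last first.
  by rewrite mulr_gt0.
by apply: le_trans h; nra.
Qed.

Let bernoulli (x : R) n : 0 <= x -> 1 + n%:R * x <= (1 + x) ^+ n.
Proof.
move=> x0; elim: n => [|n IH]; first by rewrite mul0r addr0 expr0.
rewrite exprSr; have n0 : 0 <= n%:R :> R by [].
have x1 : 0 <= 1 + x by lra.
apply: le_trans (ler_wpM2r x1 IH); rewrite -natr1.
have := mulr_ge0 n0 (sqr_ge0 x); nra.
Qed.

Let bernoulli2 (x : R) n : (2 <= n)%N -> 0 <= x -> (n%:R * x / 2) ^+ 2 <= (1 + x) ^+ n.
Proof.
move=> n2 x0; apply: (@le_trans _ _ (1 + n%:R * x + n%:R * (n%:R - 1) / 2 * x ^+ 2)).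
  have n2' : 2 <= n%:R :> R by rewrite ler_nat.
  have h1 : 0 <= n%:R * (n%:R - 2) * x ^+ 2 :> R.
    by rewrite mulr_ge0 ?sqr_ge0// mulr_ge0//; lra.
  have h2 : 0 <= n%:R * x by rewrite mulr_ge0.
  nra.
elim: n {n2} => [|n IH]; first by rewrite !mul0r !addr0 expr0.
rewrite [leRHS]exprSr; have n0 : 0 <= n%:R :> R by [].
have x1 : 0 <= 1 + x by lra.
apply: le_trans (ler_wpM2r x1 IH); rewrite -natr1.
have h : 0 <= n%:R * (n%:R - 1) * x ^+ 3 :> R.
  case: n {IH} n0 => [|n] n0; first by rewrite !mul0r.
  by rewrite mulr_ge0 ?exprn_ge0// mulr_ge0// -natr1 addrK.
nra.
Qed.

Let ball_sqr c u : 0 < u ->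
  prb gamma (sqball c u) ^+ 2 <= expR 1 * (q u ^+ p * expR (- (sqn c / (1 + u)))).
Proof.
move=> u0; have u1 : 0 < 1 + u by lra.
have q0 : 0 <= q u by rewrite divr_ge0// ltW.
apply: le_trans (lerXn2r 2 _ _ (gauss_ball_laplace c u0)) _.
- by rewrite nnegrE prb_ge0.
- by rewrite nnegrE !mulr_ge0 ?expR_ge0// exprn_ge0// sqrtr_ge0.
rewrite !exprMn -!expRM_natl exprAC sqr_sqrtr// -mulrA.
rewrite le_eqVlt; apply/orP; left; apply/eqP.
congr (expR _ * (_ * expR _)); first by field.
  by rewrite exprMn.
by field; rewrite gt_eqF.
Qed.

Let q_bound1 u : 0 < u -> (0 < p)%N -> q u ^+ p <= q u.
Proof.
move=> u0 p0; have u1 : 0 < 1 + u by lra.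
have q0 : 0 <= q u by rewrite divr_ge0// ltW.
rewrite -(prednK p0) exprS ler_piMr// exprn_ile1// ler_pdivrMr//; lra.
Qed.

(** Two regimes: if [|c|^2 <= p], Bernoulli's inequality bounds [(u / (1 + u))^p] by [u / (u + p)];
    otherwise the decay in [c] is used through [exp (- z) <= 1 / (1 + z)]. *)
Lemma gauss_ball_sqrt c u : 0 < u -> (0 < p)%N ->
  prb gamma (sqball c u) ^+ 2 <= 2 * expR 1 * (u / (p%:R + sqn c)).
Proof.
move=> u0 p0; apply: le_trans (ball_sqr c u0) _.
have u1 : 0 < 1 + u by lra.
have e0 : 0 < expR 1 :> R := expR_gt0 1.
have pR : 0 < p%:R :> R by rewrite ltr0n.
have c0 := sqn_ge0 c.
have q0 : 0 <= q u by rewrite divr_ge0// ltW.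
rewrite [2 * _]mulrC -mulrA ler_pM2l//.
have z0 : 0 <= sqn c / (1 + u) by rewrite divr_ge0// ltW.
have ez1 : expR (- (sqn c / (1 + u))) <= 1 by rewrite -[leRHS]expR0 ler_expR oppr_le0.
have [cp|pc] := leP (sqn c) p%:R.
  apply: (@le_trans _ _ (u / (u + p%:R))).
    rewrite -[leRHS]mulr1; apply: ler_pM; rewrite ?exprn_ge0 ?expR_ge0//.
    rewrite -[q u]invrK exprVn -[leRHS]invrK lef_pV2 ?posrE; last 2 first.
    - by rewrite exprn_gt0// invr_gt0 divr_gt0.
    - by rewrite invr_gt0 divr_gt0//; lra.
    have -> : (q u)^-1 = 1 + u^-1 by rewrite /q; field; rewrite !gt_eqF.
    have -> : (u / (u + p%:R))^-1 = 1 + p%:R * u^-1.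
      by field; rewrite !gt_eqF//; lra.
    by apply: bernoulli; rewrite invr_ge0 ltW.
  rewrite ler_pdivrMr; last lra.
  rewrite mulrA mulrAC ler_pdivlMr; last lra.
  nra.
apply: (@le_trans _ _ (q u * (1 + sqn c / (1 + u))^-1)).
  apply: ler_pM; rewrite ?exprn_ge0 ?expR_ge0//; [exact: q_bound1|exact: expRN_le1].
have -> : q u * (1 + sqn c / (1 + u))^-1 = u / (1 + u + sqn c).
  by rewrite /q; field; rewrite !gt_eqF//; lra.
rewrite ler_pdivrMr; last lra.
rewrite mulrA mulrAC ler_pdivlMr; last lra.
nra.
Qed.

(** Same two regimes with quadratic instead of linear lower bounds. On the line, a ball of small
    squared radius [u] at the origin has probability of order [sqrt u], which is why [p = 1] with
    [u < 1] is excluded. *)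
Lemma gauss_ball_lin c u : 0 < u -> (0 < p)%N -> (2 <= p)%N || (1 <= u) ->
  prb gamma (sqball c u) ^+ 2 <= 64 * expR 1 * (u / (p%:R + sqn c)) ^+ 2.
Proof.
move=> u0 p0 hpu; apply: le_trans (ball_sqr c u0) _.
have u1 : 0 < 1 + u by lra.
have e0 : 0 < expR 1 :> R := expR_gt0 1.
have pR : 0 < p%:R :> R by rewrite ltr0n.
have c0 := sqn_ge0 c.
have q0 : 0 <= q u by rewrite divr_ge0// ltW.
have q1 : q u <= 1 by rewrite ler_pdivrMr//; lra.
rewrite [64 * _]mulrC -mulrA ler_pM2l//.
have z0 : 0 <= sqn c / (1 + u) by rewrite divr_ge0// ltW.
have ez1 : expR (- (sqn c / (1 + u))) <= 1 by rewrite -[leRHS]expR0 ler_expR oppr_le0.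
have pc0 : 0 < p%:R + sqn c by lra.
have [cp|pc] := leP (sqn c) p%:R.
  apply: (@le_trans _ _ (16 * (u / p%:R) ^+ 2)); last first.
    have -> : 64 * (u / (p%:R + sqn c)) ^+ 2 = 16 * (2 * u / (p%:R + sqn c)) ^+ 2.
      by field; rewrite gt_eqF.
    have a1 : 0 <= u / p%:R by rewrite divr_ge0// ltW.
    have a2 : 0 <= 2 * u / (p%:R + sqn c) by rewrite divr_ge0 ?mulr_ge0 ?(ltW u0) ?(ltW pc0).
    rewrite ler_pM2l// lerXn2r ?nnegrE//.
    rewrite ler_pdivrMr// mulrAC ler_pdivlMr//; nra.
  rewrite -[leRHS]mulr1; apply: ler_pM; rewrite ?exprn_ge0 ?expR_ge0//.
  have [p2|p1] := leqP 2 p.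
    rewrite -[q u]invrK exprVn -[leRHS]invrK lef_pV2 ?posrE; last 2 first.
    - by rewrite exprn_gt0// invr_gt0 divr_gt0.
    - by rewrite invr_gt0 mulr_gt0// exprn_gt0// divr_gt0.
    have -> : (q u)^-1 = 1 + u^-1 by rewrite /q; field; rewrite !gt_eqF.
    apply: le_trans (bernoulli2 p2 _); last by rewrite invr_ge0 ltW.
    apply: (@le_trans _ _ (((4 * (u / p%:R) ^+ 2))^-1)).
      have X0 : 0 < (u / p%:R) ^+ 2 by rewrite exprn_gt0// divr_gt0.
      by rewrite lef_pV2 ?posrE; lra.
    by rewrite le_eqVlt; apply/orP; left; apply/eqP; field; rewrite !gt_eqF.
  have {}p1 : p = 1%N by apply/eqP; rewrite eqn_leq p0 -ltnS p1.
  have hu : 1 <= u by move: hpu; rewrite p1.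
  have -> : q u ^+ p = q u by rewrite p1 expr1.
  have -> : p%:R = 1 :> R by rewrite p1.
  by rewrite divr1; apply: le_trans q1 _; nra.
apply: (@le_trans _ _ (16 * (u / sqn c) ^+ 2)); last first.
  have -> : 64 * (u / (p%:R + sqn c)) ^+ 2 = 16 * (2 * u / (p%:R + sqn c)) ^+ 2.
    by field; rewrite gt_eqF.
  rewrite ler_pM2l// lerXn2r ?nnegrE ?divr_ge0 ?mulr_ge0 ?ltW//; try lra.
  rewrite ltr_pdivrMr; last lra.
  rewrite mulrAC ltr_pdivlMr//; nra.
have c1 : 0 < sqn c by lra.
have z2 : expR (- (sqn c / (1 + u))) <= 4 * ((1 + u) / (1 + u + sqn c)) ^+ 2.
  apply: le_trans (expRN_le2 z0) _; rewrite le_eqVlt; apply/orP; left; apply/eqP.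
  by field; rewrite !gt_eqF//; lra.
have [p2|p1] := leqP 2 p.
  apply: (@le_trans _ _ (q u ^+ 2 * (4 * ((1 + u) / (1 + u + sqn c)) ^+ 2))).
    apply: ler_pM; rewrite ?exprn_ge0 ?expR_ge0//.
    rewrite -(subnKC p2) exprD ler_piMr ?exprn_ge0// exprn_ile1//.
  have -> : q u ^+ 2 * (4 * ((1 + u) / (1 + u + sqn c)) ^+ 2) =
     4 * (u / (1 + u + sqn c)) ^+ 2 by rewrite /q; field; rewrite !gt_eqF//; lra.
  apply: ler_pM; rewrite ?sqr_ge0//; first lra.
  rewrite lerXn2r ?nnegrE ?divr_ge0 ?ltW//; try lra.
  by rewrite ltr_pM2l// ltf_pV2 ?posrE//; lra.
have {}p1 : p = 1%N by apply/eqP; rewrite eqn_leq p0 -ltnS p1.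
have hu : 1 <= u by move: hpu; rewrite p1.
have -> : q u ^+ p = q u by rewrite p1 expr1.
apply: (@le_trans _ _ (1 * (4 * ((1 + u) / (1 + u + sqn c)) ^+ 2))).
  by apply: ler_pM; rewrite ?expR_ge0.
rewrite mul1r; have -> : 16 * (u / sqn c) ^+ 2 = 4 * (2 * u / sqn c) ^+ 2.
  by field; rewrite gt_eqF.
rewrite ler_pM2l// lerXn2r ?nnegrE ?divr_ge0 ?mulr_ge0 ?ltW//; try lra.
rewrite ltr_pdivrMr; last lra.
rewrite mulrAC ltr_pdivlMr//; nra.
Qed.

End gauss_ball.

(** * Gaussian probability of a shell *)

Section gauss_shell.
Context {R : realType} {p : nat}.
Notation E := 'cV[R]_p.
Notation gamma := (@gauss R p).
Implicit Types (b c g x : E) (u : R).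

(* The smaller ball is the image of the larger one under the homothety of
   center [c] and ratio [a]; the affine change of variables compares them. *)
Lemma gauss_shell_homothety (a u w : R) c (W : E -> R) : 1 / 2 <= a <= 1 ->
  measurable_fun setT W -> (forall g, 0 <= W g) ->
  (forall g, sqn (g - c) <= u ->
    (1 - a) * (p%:R - sqn g + dotv c g) + (1 - a) ^+ 2 * (2 * p%:R + u / 2) <= W g) ->
  (\int[gamma]_g (W g * \1_(sqball c u) g)%:E <= w%:E)%E ->
  prb gamma (sqball c u) <= prb gamma (sqball c (a ^+ 2 * u)) + w.
Proof.
move=> /andP[a12 a1] mW W0 hW hw.
have a0 : 0 < a by lra.
have ai0 : 0 < a^-1 by rewrite invr_gt0.
set B := sqball c u; have mB : measurable B := measurable_sqball c u.
have mB1 : measurable_fun setT (\1_B : E -> R) by exact: measurable_indic.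
(* With this [b], the map [g |-> a^-1 g + b] is the homothety of center [c] and ratio [1 / a]; it
   carries the small ball onto the large one. *)
pose b := c - a^-1 *: c.
have shrink : (\int[gamma]_g (\1_B g * wt a^-1 b g)%:E)%E =
    (prb gamma (sqball c (a ^+ 2 * u)))%:E.
  under eq_integral do rewrite EFinM.
  rewrite -(@ge0_integral_gauss_affine R p a^-1 b (EFin \o \1_B))//; last 2 first.
  - exact/measurable_EFinP.
  - by move=> x; rewrite lee_fin.
  rewrite prb_indic; last exact: measurable_sqball.
  apply: eq_integral => g _ /=; congr (_%:E); rewrite !indicE; congr (_%:R).
  congr nat_of_bool; apply/idP/idP; rewrite !inE /B /sqball /= => h.
    have -> : g - c = a *: (a^-1 *: g + b - c).
      rewrite /b !scalerDr !scalerN !scalerA divff ?gt_eqF// !scale1r.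
      by apply/colP => i; rewrite !mxE; ring.
    by rewrite sqnZ ler_pM2l ?exprn_gt0.
  have -> : a^-1 *: g + b - c = a^-1 *: (g - c).
    by rewrite /b; apply/colP => i; rewrite !mxE; ring.
  by rewrite sqnZ exprVn mulrC ler_pdivrMr ?exprn_gt0// mulrC.
rewrite -lee_fin EFinD -shrink prb_indic//.
apply: (@le_trans _ _ (\int[gamma]_g (\1_B g * wt a^-1 b g + W g * \1_B g)%:E)%E).
  apply: ge0_le_integralT.
  - exact/measurable_EFinP.
  - apply/measurable_EFinP; apply: measurable_funD; apply: measurable_funM => //.
    exact: measurable_wt.
  - by move=> g; rewrite lee_fin.
  - move=> g; rewrite lee_fin indicE.
    have [gB|gB] := boolP (g \in B); last by rewrite !mul0r mulr0 addr0.
    rewrite mul1r mulr1; move: gB; rewrite inE /B /sqball /= => gB.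
    apply: le_trans (_ : 1 <= wt a^-1 b g +
      ((1 - a) * (p%:R - sqn g + dotv c g) + (1 - a) ^+ 2 * (2 * p%:R + u / 2))) _.
      (* Since [1 / a = 1 + k <= exp k], the factor [a^p] of the density is at least [exp (- p k)].
         Then [exp X >= 1 + X] linearizes the whole density, and [- X] is the loss to be dominated
         by [W]. *)
      pose k := (1 - a) / a.
      have hk : expR (- (p%:R * k)) <= a^-1 ^- p.
        rewrite exprVn invrK -mulrN expRM_natl lerXn2r ?nnegrE ?expR_ge0 ?(ltW a0)//.
        rewrite expRN -[leRHS]invrK lef_pV2 ?posrE ?expR_gt0//.
        apply: le_trans (expR_ge1Dx k); rewrite /k.
        by rewrite le_eqVlt; apply/orP; left; apply/eqP; field; rewrite gt_eqF.
      set e := expR _ in hk.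
      have := ler_wpM2r (expR_ge0 (sqn g / 2 - sqn (g - b) / (2 * a^-1 ^+ 2))) hk.
      rewrite -expRD; set X := (X in expR X <= _) => h1.
      have h2 := le_trans (expR_ge1Dx X) h1.
      rewrite -/(wt a^-1 b g) in h2.
      suff : - X <= (1 - a) * (p%:R - sqn g + dotv c g) + (1 - a) ^+ 2 * (2 * p%:R + u / 2) by lra.
      have hX : - X = p%:R * k + (- (1 - a) * sqn g + (1 - a) * dotv c g
          + (1 - a) ^+ 2 / 2 * sqn (g - c)).
        rewrite /X /b !sqnB !sqnZ /sqn !dotvE (dotvC g c) /k.
        by field; rewrite gt_eqF.
      have kle : k <= (1 - a) + 2 * (1 - a) ^+ 2.
        rewrite /k ler_pdivrMr//.
        have : 0 <= (1 - a) * ((1 - a) * (2 * a - 1)) by rewrite !mulr_ge0//; lra.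
        nra.
      have p0 : 0 <= p%:R :> R by [].
      have := ler_wpM2l p0 kle.
      have e0 : 0 <= (1 - a) ^+ 2 / 2 by rewrite divr_ge0// sqr_ge0.
      have := ler_wpM2l e0 gB.
      rewrite hX; lra.
    by rewrite lerD2l hW.
under eq_integral do rewrite EFinD.
rewrite ge0_integralD//; last 4 first.
- by move=> g _; rewrite lee_fin mulr_ge0// wt_ge0.
- by apply/measurable_EFinP; apply: measurable_funM => //; exact: measurable_wt.
- by move=> g _; rewrite lee_fin mulr_ge0.
- by apply/measurable_EFinP; apply: measurable_funM.
exact: leeD.
Qed.


Let B_integral_le u c w : 0 <= w ->
  (\int[gamma]_g (w * \1_(sqball c u) g)%:E <= (w * prb gamma (sqball c u))%:E)%E.
Proof.
move=> w0; have mB := measurable_sqball c u.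
have mI : measurable_fun setT (\1_(sqball c u) : E -> R) by exact: measurable_indic.
rewrite EFinM prb_indic//; apply: integral_le_scaled => //; first by apply: measurable_funM.
by move=> g; rewrite mulr_ge0.
Qed.

(** The first order loss [Z = p - |g|^2 + c.g] is at most [kp / 2 + Z^2 / (2 kp)]. The constant part
    is integrated over the ball only, the square over the whole space; [kp] is left free to balance
    the two. *)
Lemma gauss_shell_quadratic (a u kp : R) c : 1 / 2 <= a <= 1 -> 0 <= u -> 0 < kp ->
  prb gamma (sqball c u) <= prb gamma (sqball c (a ^+ 2 * u)) +
   (((1 - a) * kp / 2 + (1 - a) ^+ 2 * (2 * p%:R + u / 2)) * prb gamma (sqball c u) +
   (1 - a) / (2 * kp) * (128 * expR 1 * (p%:R + sqn c))).
Proof.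
move=> a12 u0 kp0; have /andP[_ a1] := a12.
set e2 := (1 - a) ^+ 2 * _.
have e20 : 0 <= e2 by rewrite mulr_ge0 ?sqr_ge0// addr_ge0 ?mulr_ge0// divr_ge0.
have {a1} : 0 <= 1 - a by rewrite subr_ge0.
set eta := 1 - a => eta0.
pose Z g := p%:R - sqn g + dotv c g.
have ZE g : Z g = - 1 * (sqn g - p%:R) + dotv c g by rewrite /Z mulN1r opprB.
have mZ2 : measurable_fun setT (fun g => Z g ^+ 2).
  apply: measurable_funX; apply: measurable_funD; last exact: measurable_dotv.
  by apply: measurable_funB => //; exact: measurable_sqn.
have ek0 : 0 <= eta / (2 * kp) by rewrite divr_ge0// mulr_ge0// ltW.
have ec0 : 0 <= eta * kp / 2 + e2 by rewrite addr_ge0// divr_ge0// mulr_ge0// ltW.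
pose W g := eta * kp / 2 + e2 + eta / (2 * kp) * Z g ^+ 2.
have mkZ : measurable_fun setT (fun g => eta / (2 * kp) * Z g ^+ 2) by apply: measurable_funM.
have kZ0 g : 0 <= eta / (2 * kp) * Z g ^+ 2 by rewrite mulr_ge0 ?sqr_ge0.
have mW : measurable_fun setT W by apply: measurable_funD.
have W0 g : 0 <= W g by rewrite addr_ge0.
apply: (gauss_shell_homothety a12 mW W0).
  move=> g _; rewrite -/(Z g) -/eta -/e2 /W addrAC lerD2r.
  have -> : eta * kp / 2 + eta / (2 * kp) * Z g ^+ 2 =
     eta * Z g + eta / (2 * kp) * (Z g - kp) ^+ 2 by field; rewrite gt_eqF.
  by rewrite lerDl mulr_ge0// sqr_ge0.
have mB := measurable_sqball c u.
have mI : measurable_fun setT (\1_(sqball c u) : E -> R) by exact: measurable_indic.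
have mcI : measurable_fun setT (fun g => (eta * kp / 2 + e2) * \1_(sqball c u) g).
  by apply: measurable_funM.
apply: (@le_trans _ _ (\int[gamma]_g ((eta * kp / 2 + e2) * \1_(sqball c u) g +
     eta / (2 * kp) * Z g ^+ 2)%:E)%E).
  apply: ge0_le_integralT.
  - by apply/measurable_EFinP; apply: measurable_funM.
  - by apply/measurable_EFinP; apply: measurable_funD.
  - by move=> g; rewrite lee_fin mulr_ge0.
  - move=> g; rewrite lee_fin /W indicE mulrDl lerD2l.
    by case: (_ \in _); rewrite ?mulr1 ?mulr0.
apply: integral_leD => //.
- by move=> g; rewrite mulr_ge0.
- exact: B_integral_le.
- apply: (@le_trans _ _ ((eta / (2 * kp))%:E * \int[gamma]_g (Z g ^+ 2)%:E)%E).
    by apply: integral_le_scaled => // g; rewrite sqr_ge0.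
  rewrite [leRHS]EFinM lee_wpmul2l ?lee_fin//.
  have := @gauss_quadratic_moment R p (- 1) c.
  under eq_integral do rewrite -ZE.
  by rewrite sqrrN expr1n mul1r.
Qed.

(** On a ball of radius at most one the first order loss is [p - |g - c|^2 - c.(g - c)], bounded by
    [p + |c|] pointwise. This serves small balls on the line. *)
Lemma gauss_shell_bounded (a u : R) c : 1 / 2 <= a <= 1 -> 0 <= u <= 1 ->
  prb gamma (sqball c u) <= prb gamma (sqball c (a ^+ 2 * u)) +
   ((1 - a) * (p%:R + enorm c) + (1 - a) ^+ 2 * (2 * p%:R + u / 2)) *
     prb gamma (sqball c u).
Proof.
move=> a12 /andP[u0 u1]; have /andP[_ a1] := a12.
set e2 := (1 - a) ^+ 2 * _.
have e20 : 0 <= e2 by rewrite mulr_ge0 ?sqr_ge0// addr_ge0 ?mulr_ge0// divr_ge0.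
have {a1} : 0 <= 1 - a by rewrite subr_ge0.
set eta := 1 - a => eta0.
have w0 : 0 <= eta * (p%:R + enorm c) + e2.
  by rewrite addr_ge0// mulr_ge0// addr_ge0// enorm_ge0.
apply: (@gauss_shell_homothety a u _ c (fun=> eta * (p%:R + enorm c) + e2)) => //.
  move=> g hg; rewrite -/eta -/e2 lerD2r ler_wpM2l//.
  have -> : sqn g = sqn (g - c) + 2 * dotv c (g - c) + sqn c.
    by rewrite sqnB dotvDr dotvNr (dotvC g) /sqn; ring.
  have -> : dotv c g = dotv c (g - c) + sqn c by rewrite dotvDr dotvNr /sqn; ring.
  have h1 := sqn_ge0 (g - c).
  have h2 := le_trans (ler_norm _) (normr_dotv_le (- c) (g - c)).
  rewrite dotvNl in h2.
  have : enorm (- c) * enorm (g - c) <= enorm c * 1.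
    apply: ler_pM; rewrite ?enorm_ge0//; first by rewrite enormE sqnN -enormE.
    by rewrite enormE -[leRHS]sqrtr1 ler_wsqrtr// (le_trans hg).
  lra.
exact: B_integral_le.
Qed.

Let k : R := 2 * expR 1.

Let k2 : 2 <= k. Proof. by rewrite /k; have := @expR_ge1Dx R 1; lra. Qed.

Let k0 : 0 <= k. Proof. by apply: le_trans k2. Qed.

Lemma gauss_ball_le_sqrt c u : (0 < p)%N -> 0 < u ->
  prb gamma (sqball c u) <= k * (Num.sqrt u / Num.sqrt (p%:R + sqn c)).
Proof.
move=> p0 u0; have pR : 0 < p%:R :> R by rewrite ltr0n.
have m0 : 0 < p%:R + sqn c by have := sqn_ge0 c; lra.
rewrite -(@ler_pXn2r _ 2)// ?nnegrE ?prb_ge0//; last first.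
  by rewrite mulr_ge0// divr_ge0// sqrtr_ge0.
apply: le_trans (gauss_ball_sqrt c u0 p0) _.
rewrite [leRHS]exprMn [(_ / _) ^+ 2]exprMn exprVn !sqr_sqrtr ?(ltW u0) ?(ltW m0)//.
apply: ler_wpM2r; first by rewrite divr_ge0 ?(ltW u0) ?(ltW m0).
by rewrite -/k; have := k2; nra.
Qed.

Lemma gauss_ball_le_lin c u : (0 < p)%N -> 0 < u -> (2 <= p)%N || (1 <= u) ->
  prb gamma (sqball c u) <= 4 * k * (u / (p%:R + sqn c)).
Proof.
move=> p0 u0 hpu; have pR : 0 < p%:R :> R by rewrite ltr0n.
have m0 : 0 < p%:R + sqn c by have := sqn_ge0 c; lra.
rewrite -(@ler_pXn2r _ 2)// ?nnegrE ?prb_ge0//; last first.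
  by rewrite !mulr_ge0// ?invr_ge0 ltW.
apply: le_trans (gauss_ball_lin c u0 p0 hpu) _.
rewrite [leRHS]exprMn; apply: ler_wpM2r; first exact: sqr_ge0.
rewrite (_ : 64 * expR 1 = 32 * k); last by rewrite /k; lra.
by have := k2; nra.
Qed.


(** Controls the second order loss of the homothety: [r] is the radius, [pp] the dimension, [m]
    stands for [p + |c|^2] and [P] for the probability of the ball. The dimension is absorbed by
    [pp * d^2 <= r^2] and by the factor [1 / sqrt m] in the bound on [P]. *)
Let shell_error (P L d r pp m eta k' : R) : 0 < r -> 0 <= eta -> eta * r <= 2 * (L * d) ->
  1 <= L -> 0 < d -> d <= 1 -> 0 < pp -> pp <= m -> pp * d ^+ 2 <= r ^+ 2 -> 2 <= k' ->
  0 <= P -> P <= 1 -> P <= k' * (r / Num.sqrt m) ->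
  eta ^+ 2 * (2 * pp + r ^+ 2 / 2) * P <= 10 * k' * (L ^+ 2 * d).
Proof.
move=> r0 eta0 etar L1 d0 d1 pp0 ppm pdr k'2 P0 P1 hP.
have m0 : 0 < m by apply: lt_le_trans ppm.
have k'0 : 0 <= k' by apply: le_trans k'2.
have sm : 0 < Num.sqrt m by rewrite sqrtr_gt0.
have sp0 : 0 < Num.sqrt pp by rewrite sqrtr_gt0.
have sp2 : Num.sqrt pp ^+ 2 = pp by rewrite sqr_sqrtr// ltW.
have spm : Num.sqrt pp <= Num.sqrt m by rewrite ler_wsqrtr.
have spr : Num.sqrt pp * d <= r.
  rewrite -(@ler_pXn2r _ 2)// ?nnegrE ?(mulr_ge0 (ltW sp0) (ltW d0)) ?(ltW r0)//.
  by rewrite exprMn sp2.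
have Ld : 0 <= L ^+ 2 * d by rewrite mulr_ge0 ?sqr_ge0// ltW.
have hr2 : (eta * r) ^+ 2 <= 4 * (L ^+ 2 * d * d).
  apply: (@le_trans _ _ ((2 * (L * d)) ^+ 2)).
    have er0 : 0 <= eta * r by rewrite mulr_ge0// ltW.
    by apply: lerXn2r => //; rewrite nnegrE//; apply: le_trans etar.
  by rewrite le_eqVlt; apply/orP; left; apply/eqP; ring.
have hA : eta ^+ 2 * (2 * pp) * P <= 8 * k' * (L ^+ 2 * d).
  apply: (@le_trans _ _ (eta ^+ 2 * (2 * pp) * (k' * (r / Num.sqrt m)))).
    by apply: ler_wpM2l hP; rewrite mulr_ge0 ?sqr_ge0// mulr_ge0// ltW.
  have -> : eta ^+ 2 * (2 * pp) * (k' * (r / Num.sqrt m)) =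
     2 * k' * ((eta * r) ^+ 2) * (pp / (r * Num.sqrt m)).
    by field; rewrite !gt_eqF.
  have hB : pp / (r * Num.sqrt m) <= d^-1.
    rewrite ler_pdivrMr ?mulr_gt0// mulrC ler_pdivlMr// -sp2 expr2 -mulrA mulrC.
    by apply: ler_pM => //; rewrite ?mulr_ge0 ?ltW.
  apply: (@le_trans _ _ (2 * k' * (4 * (L ^+ 2 * d * d)) * d^-1)).
    have k20 : 0 <= 2 * k' by rewrite mulr_ge0.
    apply: ler_pM.
    - by rewrite mulr_ge0// sqr_ge0.
    - by rewrite divr_ge0 ?mulr_ge0 ?(ltW pp0) ?(ltW r0) ?(ltW sm).
    - exact: ler_wpM2l hr2.
    - exact: hB.
  by rewrite le_eqVlt; apply/orP; left; apply/eqP; field; rewrite gt_eqF.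
have hB : eta ^+ 2 * (r ^+ 2 / 2) * P <= 2 * k' * (L ^+ 2 * d).
  apply: (@le_trans _ _ (eta ^+ 2 * (r ^+ 2 / 2))).
    by rewrite ler_piMr// mulr_ge0 ?sqr_ge0// divr_ge0// sqr_ge0.
  have -> : eta ^+ 2 * (r ^+ 2 / 2) = (eta * r) ^+ 2 / 2 by ring.
  have : L ^+ 2 * d * d <= L ^+ 2 * d by rewrite ler_piMr.
  by clear -hr2 k'2 Ld; nra.
by rewrite mulrDr mulrDl; clear -hA hB; lra.
Qed.

(** The allowed thickness is the fluctuation of [|x + delta g - c|^2] when its mean is about
    [u2 + p delta^2], which is exactly what smoothing at scale [delta] leaves undetermined. *)
Lemma gauss_shell (L delta u1 u2 : R) c : (0 < p)%N -> 1 <= L -> 0 < delta <= 1 ->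
  u1 <= u2 -> u2 - u1 <= L * delta * Num.sqrt (u2 + p%:R * delta ^+ 2) ->
  prb gamma (sqball c u2) - prb gamma (sqball c u1) <= 200 * expR 1 * L ^+ 2 * delta.
Proof.
move=> p0 L1 /andP[d0 d1] u12 hu.
have -> : 200 * expR 1 = 100 * k by rewrite /k; lra.
have pR : 1 <= p%:R :> R by rewrite ler1n.
have c0 := sqn_ge0 c; set m := p%:R + sqn c.
have m1 : 1 <= m by rewrite /m; lra.
have m0 : 0 < m by lra.
set P1 := prb gamma (sqball c u1); have P10 : 0 <= P1 := prb_ge0 _ _.
have P21 := prb_le1 gamma (measurable_sqball c u2).
have P20 : 0 <= prb gamma (sqball c u2) := prb_ge0 _ _.
have LL : L <= L ^+ 2 by nra.
have Ld : 0 <= L * delta by nra.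
have LLd : L * delta <= L ^+ 2 * delta by nra.
have sm : 0 < Num.sqrt m by rewrite sqrtr_gt0.
have sm1 : 1 <= Num.sqrt m by rewrite -[1]sqrtr1 ler_wsqrtr.
(* Below [p delta^2] the whole ball has probability of order [delta], since
   [sqrt u2 <= sqrt p * delta]. *)
have [u2s|u2s] := ltP u2 (p%:R * delta ^+ 2).
  have pd : 0 < p%:R * delta ^+ 2 by rewrite mulr_gt0 ?exprn_gt0//; lra.
  have h1 : prb gamma (sqball c u2) <= prb gamma (sqball c (p%:R * delta ^+ 2)).
    apply: le_prb; [exact: measurable_sqball..|].
    by move=> x /=; rewrite /sqball /= => h; apply: (le_trans h); exact: ltW.
  have := gauss_ball_le_sqrt c p0 pd; rewrite sqrtrM; last by lra.
  rewrite sqrtr_sqr gtr0_norm// -/m => h2.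
  have h3 : Num.sqrt p%:R * delta / Num.sqrt m <= delta.
    rewrite ler_pdivrMr// mulrC ler_wpM2l ?(ltW d0)// ler_wsqrtr// /m; lra.
  have := ler_wpM2l k0 h3.
  have : k * delta <= k * (L ^+ 2 * delta) by rewrite ler_wpM2l//; nra.
  by have := mulr_ge0 k0 (le_trans Ld LLd); lra.
have pd : 0 < p%:R * delta ^+ 2 by rewrite mulr_gt0 ?exprn_gt0//; lra.
have u20 : 0 < u2 by lra.
pose r := Num.sqrt u2; have r0 : 0 < r by rewrite sqrtr_gt0.
have r2 : r ^+ 2 = u2 by rewrite sqr_sqrtr// ltW.
have {}hu : u2 - u1 <= 2 * L * delta * r.
  apply: le_trans hu _.
  have : Num.sqrt (u2 + p%:R * delta ^+ 2) <= 2 * r.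
    rewrite -(@ler_pXn2r _ 2)// ?nnegrE ?sqrtr_ge0 ?mulr_ge0 ?(ltW r0)//.
    rewrite sqr_sqrtr; lra.
  by move=> /(ler_wpM2l Ld); lra.
have hP := gauss_ball_le_sqrt c p0 u20; rewrite -/r -/m in hP.
(* If the shell takes up most of the ball, the thickness condition forces [r <= 3 L delta], and
   again the whole ball is small. *)
have [u1s|u1s] := ltP u1 (u2 / 4).
  have rs : r <= 3 * L * delta.
    have : r * (3 / 4 * r) <= r * (2 * (L * delta)) by rewrite -r2 in u1s hu *; nra.
    by rewrite ler_pM2l//; lra.
  have : r / Num.sqrt m <= r by rewrite ler_pdivrMr// ler_peMr// ltW.
  move=> /(ler_wpM2l k0) h.
  have : k * r <= k * (3 * (L ^+ 2 * delta)) by rewrite ler_wpM2l//; lra.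
  by have := mulr_ge0 k0 (le_trans Ld LLd); lra.
have u10 : 0 < u1 by lra.
pose a := Num.sqrt (u1 / u2).
have a2 : a ^+ 2 = u1 / u2 by rewrite sqr_sqrtr// divr_ge0// ltW.
have a1 : a <= 1 by rewrite -[1]sqrtr1 ler_wsqrtr// ler_pdivrMr// mul1r.
have a12 : 1 / 2 <= a.
  have h : 1 / 4 <= a ^+ 2 by rewrite a2 ler_pdivlMr//; lra.
  by rewrite leNgt; apply/negP => ha; have : 0 <= a := sqrtr_ge0 _; nra.
have au : a ^+ 2 * u2 = u1 by rewrite a2 divfK// gt_eqF.
pose eta := 1 - a; have eta0 : 0 <= eta by rewrite /eta; lra.
have etar : eta * r <= 2 * (L * delta).
  have : r * (eta * r) <= r * (2 * (L * delta)).
    have : eta * u2 <= u2 - u1 by rewrite /eta; nra.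
    by rewrite -r2; nra.
  by rewrite ler_pM2l.
pose e2 := eta ^+ 2 * (2 * p%:R + u2 / 2).
have e20 : 0 <= e2 by rewrite mulr_ge0 ?sqr_ge0//; lra.
have e2P : e2 * prb gamma (sqball c u2) <= 10 * k * (L ^+ 2 * delta).
  rewrite /e2 -{1}r2; apply: (@shell_error _ _ _ _ _ m) => //; rewrite ?r2//.
    by apply: lt_le_trans pR.
  by rewrite /m lerDl.
have base : 0 <= k * (L ^+ 2 * delta) by rewrite mulr_ge0// mulr_ge0 ?sqr_ge0// ltW.
have [hpu|] := boolP ((2 <= p)%N || (1 <= u2)).
  have hl := gauss_ball_le_lin c p0 u20 hpu; rewrite -/m in hl.
  (* Since the ball has probability at most of order [r^2 / m] and the quadratic moment is of order
     [m], this choice makes both contributions of order [eta * r]. *)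
  pose kp := m / r; have kp0 : 0 < kp by rewrite divr_gt0.
  have := @gauss_shell_quadratic a u2 kp c; rewrite au a12 a1 -/m -/eta -/e2 -/P1.
  move=> /(_ isT (ltW u20) kp0) h.
  have t1 : eta / (2 * kp) * (128 * expR 1 * m) <= 64 * k * (L ^+ 2 * delta).
    have -> : eta / (2 * kp) * (128 * expR 1 * m) = 32 * k * (eta * r).
      by rewrite /kp /k; field; rewrite !gt_eqF.
    have : k * (eta * r) <= k * (2 * (L ^+ 2 * delta)).
      by rewrite ler_wpM2l//; have := k2; lra.
    lra.
  have t2 : eta * kp / 2 * prb gamma (sqball c u2) <= 4 * k * (L ^+ 2 * delta).
    apply: (@le_trans _ _ (eta * kp / 2 * (4 * k * (u2 / m)))).
      by rewrite ler_wpM2l// divr_ge0// mulr_ge0// ltW.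
    have -> : eta * kp / 2 * (4 * k * (u2 / m)) = 2 * k * (eta * r).
      by rewrite /kp -r2; field; rewrite !gt_eqF.
    have : k * (eta * r) <= k * (2 * (L ^+ 2 * delta)).
      by rewrite ler_wpM2l//; have := k2; lra.
    lra.
  by rewrite mulrDl in h; clear -h t1 t2 e2P base; lra.
rewrite negb_or -ltnNge -ltNge => /andP[p2 us1].
have p1n : p = 1%N by apply/eqP; rewrite eqn_leq p0 -ltnS p2.
have p1 : p%:R = 1 :> R by rewrite p1n.
have r1 : r <= 1 by rewrite -[1]sqrtr1 ler_wsqrtr// ltW.
pose n := enorm c; have n0 : 0 <= n := enorm_ge0 c.
have n2 : n ^+ 2 = sqn c := enorm_sqr c.
have := @gauss_shell_bounded a u2 c; rewrite au a12 a1 (ltW u20) (ltW us1).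
rewrite -/n -/eta -/P1 -/e2 p1 => /(_ isT isT) h.
have t1 : eta * (1 + n) * prb gamma (sqball c u2) <= 4 * k * (L ^+ 2 * delta).
  apply: (@le_trans _ _ (eta * (1 + n) * (k * (r / Num.sqrt m)))).
    by rewrite ler_wpM2l// mulr_ge0//; lra.
  have -> : eta * (1 + n) * (k * (r / Num.sqrt m)) = k * (eta * r) * ((1 + n) / Num.sqrt m).
    by field; rewrite gt_eqF.
  have h1 : (1 + n) / Num.sqrt m <= 2.
    rewrite ler_pdivrMr// -(@ler_pXn2r _ 2)// ?nnegrE ?mulr_ge0 ?sqrtr_ge0//; last lra.
    rewrite exprMn sqr_sqrtr ?(ltW m0)// /m p1 -n2; nra.
  apply: (@le_trans _ _ (k * (2 * (L * delta)) * 2)).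
    apply: ler_pM => //.
    - by rewrite mulr_ge0// mulr_ge0// ltW.
    - by rewrite divr_ge0 ?addr_ge0 ?(ltW sm).
    - exact: ler_wpM2l etar.
  have : k * (L * delta) <= k * (L ^+ 2 * delta) by rewrite ler_wpM2l//; have := k2; lra.
  lra.
by rewrite mulrDl in h; clear -h t1 e2P base; lra.
Qed.

End gauss_shell.

(** * Smoothed indicators of balls decrease with the distance to the center *)

Section radial_monotonicity.
Context {R : realType} {p : nat}.
Notation E := 'cV[R]_p.
Notation gamma := (@gauss R p).
Implicit Types (c g x z : E).

Definition reflmx (v : E) : 'M[R]_p := 1%:M - (2 / sqn v) *: (v *m v^T).

Lemma reflmxE v z : reflmx v *m z = z - (2 / sqn v * dotv v z) *: v.
Proof.
rewrite mulmxBl mul1mx -scalemxAl -mulmxA.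
have -> : v^T *m z = (dotv v z)%:M.
  by apply/matrixP => i j; rewrite !ord1 [RHS]mxE mulr1n dotv_trmx.
by rewrite mul_mx_scalar scalerA.
Qed.

Lemma reflmx_orthogonal v : v != 0 -> reflmx v *m (reflmx v)^T = 1%:M.
Proof.
move=> v0; have sv : sqn v != 0 by rewrite sqn_eq0.
have -> : (reflmx v)^T = reflmx v.
  by rewrite /reflmx linearB /= linearZ /= trmx_mul trmxK tr_scalar_mx.
apply/matrixP => i j.
have h z : reflmx v *m (reflmx v *m z) = z.
  rewrite !reflmxE dotvDr dotvNr dotvZr -/(sqn v).
  rewrite (_ : 2 / sqn v * (dotv v z - 2 / sqn v * dotv v z * sqn v) =
    - (2 / sqn v * dotv v z)); last by field.
  by rewrite scaleNr opprK subrK.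
have := h (delta_mx j 0); rewrite mulmxA -colE => /colP/(_ i).
by rewrite !mxE eqxx andbT.
Qed.

Lemma ge0_integral_gauss_orthogonal (A : 'M[R]_p) (f : E -> \bar R) :
  A *m A^T = 1%:M -> measurable_fun setT f -> (forall x, (0 <= f x)%E) ->
  (\int[gamma]_x f (A *m x) = \int[gamma]_x f x)%E.
Proof.
move=> A1 mf f0.
apply: etrans (@ge0_integral_gauss_lin _ _ A 0 f _ mf f0); last first.
  by rewrite A1 mul0mx addr0.
apply: eq_integral => x _; rewrite -[LHS](integral_cst_probability gamma).
by apply: eq_integral => y _; rewrite mul0mx addr0.
Qed.

(* [x] and [x'] are exchanged by the reflection [rho] in their bisecting
   hyperplane; the half space [S] containing [x] also contains the center of
   the ball. *)
Lemma gs_sqball_radial (eps th : R) c x x' : 0 < eps -> sqn (x - c) <= sqn (x' - c) ->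
  (gs eps (EFin \o \1_(sqball c th)) x' <= gs eps (EFin \o \1_(sqball c th)) x)%E.
Proof.
move=> eps0 xx'; have [->//|vn0] := eqVneq x x'.
pose v := x' - x; have v0 : v != 0 by rewrite subr_eq0 eq_sym.
have sv : 0 < sqn v by rewrite sqn_gt0.
pose m := 2^-1 *: (x + x'); pose B := sqball c th.
have mB : measurable B := measurable_sqball c th.
pose rho z := reflmx v *m (z - m) + m.
have mrho : measurable_fun setT rho.
  by apply: measurable_cVD => //; apply: measurable_cV_mulmx; exact: measurable_cVB.
have rhoE z : rho z = z - (2 / sqn v * dotv v (z - m)) *: v.
  by rewrite /rho reflmxE addrAC subrK.
have vrho z : dotv v (rho z - m) = - dotv v (z - m).
  have -> : rho z - m = reflmx v *m (z - m) by rewrite /rho addrK.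
  rewrite reflmxE dotvDr dotvNr dotvZr -/(sqn v); field; exact: lt0r_neq0.
have rhoK z : rho (rho z) = z.
  rewrite [LHS]rhoE vrho rhoE mulrN scaleNr opprK subrK//.
(* [F] is the part of the ball on the side of [x], and [G] the mirror image of the other part.
   Exchanging [x] and [x'] exchanges the contributions of [G] and of the complement of [F] in the
   ball, so only [F] minus [G] has to be compared. *)
pose G := [set z | B (rho z) /\ 0 < dotv v (rho z - m)].
pose F := [set z | B z /\ dotv v (z - m) <= 0].
have mS : measurable [set z : E | dotv v (z - m) <= 0].
  have mf : measurable_fun setT (fun z : E => dotv v (z - m)).
    by apply: measurable_dotv => //; exact: measurable_cVB.
  have := mf measurableT `]-oo, 0]%classic (measurable_itv _).
  by rewrite setTI (_ : _ @^-1` _ = [set z : E | dotv v (z - m) <= 0]).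
have mF : measurable F by exact: measurableI.
have mBF : measurable (B `\` F) by exact: measurableD.
have GE : G = rho @^-1` (B `\` F).
  apply/seteqP; split => z /= [h1 h2]; split => //.
    by move=> [_]; rewrite leNgt h2.
  by rewrite ltNge; apply/negP => h3; apply: h2.
have mG : measurable G.
  by rewrite GE -[X in measurable X]setTI; exact: mrho.
have vm : 0 <= dotv v (m - c).
  have -> : dotv v (m - c) = 2^-1 * (sqn (x' - c) - sqn (x - c)).
    by rewrite /v /m /sqn !dotvE (dotvC c x') (dotvC c x) (dotvC x x'); field.
  by rewrite mulr_ge0// subr_ge0.
have GF : G `<=` F.
  move=> z /= [h1 h2]; have h3 : dotv v (z - m) <= 0 by rewrite vrho in h2; lra.
  split => //; rewrite /B /sqball /= in h1 *; apply: le_trans h1.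
  rewrite rhoE (addrAC z) (sqnB (z - c)) sqnZ dotvZr -addrA lerDl (dotvC _ v).
  have -> : dotv v (z - c) = dotv v (z - m) + dotv v (m - c).
    by rewrite -dotvDr addrA subrK.
  set a := dotv v (z - m) in h3 *; set b := dotv v (m - c) in vm *.
  have -> : - (2 * (2 / sqn v * a * (a + b))) + (2 / sqn v * a) ^+ 2 * sqn v =
    (- a) * b * (4 / sqn v) by field; exact: lt0r_neq0.
  by rewrite !mulr_ge0 ?invr_ge0 ?(ltW sv)//; lra.
pose I A : E -> \bar R := EFin \o \1_A.
have mI A : measurable A -> measurable_fun setT (I A).
  by move=> mA; apply/measurable_EFinP; exact: measurable_indic.
have I0 A z : (0 <= I A z)%E by rewrite lee_fin.
have gsI A y : measurable A -> measurable_fun setT (fun g : E => I A (y + eps *: g)).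
  move=> mA; apply: measurableT_comp; first exact: mI.
  by apply: measurable_cVD => //; exact: measurable_cVZ.
have gsD A A' y : measurable A -> measurable A' -> A' `<=` A ->
    gs eps (I A) y = (gs eps (I A') y + gs eps (I (A `\` A')) y)%E.
  move=> mA mA' AA'; rewrite -ge0_integralD//; last 2 first.
  - exact: gsI.
  - by apply: gsI; exact: measurableD.
  apply: eq_integral => g _; rewrite /I /= -EFinD !indicE in_setD.
  have [h|h] := boolP (_ \in A'); last by rewrite add0r andbT.
  by rewrite andbF addr0 mem_set//; apply: AA'; rewrite inE in h.
have gsrho A y y' : measurable A -> rho y = y' ->
    gs eps (I (rho @^-1` A)) y' = gs eps (I A) y.
  move=> mA yy'; rewrite /gs.
  apply: etrans _ (@ge0_integral_gauss_orthogonal (reflmx v) (fun g => I A (y + eps *: g))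
    (reflmx_orthogonal v0) (gsI _ _ mA) (fun g => I0 _ _)).
  apply: eq_integral => g _; rewrite /I /= !indicE; congr (_%:R%:E).
  have -> : y + eps *: (reflmx v *m g) = rho (y' + eps *: g).
    rewrite -(rhoK y) yy' /rho [in RHS]addrAC [in RHS]mulmxDr -scalemxAr.
    by rewrite addrAC.
  by congr nat_of_bool; apply/idP/idP; rewrite !inE.
have rx : rho x = x'.
  rewrite rhoE; have -> : dotv v (x - m) = - (sqn v / 2).
    by rewrite /v /m /sqn !dotvE (dotvC x x'); field.
  have -> : 2 / sqn v * - (sqn v / 2) = -1 by field; exact: lt0r_neq0.
  by rewrite scaleN1r opprK /v addrC subrK.
have rx' : rho x' = x by rewrite -rx rhoK.
have E1 y : gs eps (I B) y = (gs eps (I F) y + gs eps (I (B `\` F)) y)%E.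
  by apply: gsD => // z [].
have E2 y : gs eps (I F) y = (gs eps (I G) y + gs eps (I (F `\` G)) y)%E.
  exact: gsD.
have E3 : gs eps (I (B `\` F)) x' = gs eps (I G) x by rewrite GE (gsrho _ _ _ mBF rx').
have E4 : gs eps (I (B `\` F)) x = gs eps (I G) x' by rewrite GE (gsrho _ _ _ mBF rx).
(* Seen from [x'], the integral is the one seen from [x] weighted by the Cameron-Martin density of
   the shift [v / eps], whose exponent is nonpositive on the half space of [x]. *)
have H : (gs eps (I (F `\` G)) x' <= gs eps (I (F `\` G)) x)%E.
  pose FG := F `\` G; rewrite -/FG.
  have mFG : measurable FG by exact: measurableD.
  pose b := eps^-1 *: v.
  have -> : gs eps (I FG) x' =
      (\int[gamma]_g (I FG (x + eps *: g)%R * (cmd b g)%:E))%E.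
    apply: etrans _ (@ge0_integral_gauss_shift R p b (fun g => I FG (x + eps *: g))
      (gsI _ _ mFG) (fun g => I0 _ _)).
    apply: eq_integral => g _; congr (I _ _).
    rewrite scalerDr scalerA divff ?gt_eqF// scale1r addrCA addrC.
    by rewrite /v [x + _]addrC subrK.
  apply: ge0_le_integralT.
  - apply: emeasurable_funM; first exact: gsI.
    by apply/measurable_EFinP; exact: measurable_cmd.
  - exact: gsI.
  - by move=> g; rewrite mule_ge0// lee_fin cmd_ge0.
  - move=> g; rewrite /I /= indicE.
    have [h|h] := boolP (_ \in _); last by rewrite mul0e.
    rewrite mul1e lee_fin -[leRHS]expR0 ler_expR.
    move: h; rewrite inE => -[[_ h] _].
    have hx : dotv v (x - m) = - (sqn v / 2).
      by rewrite /v /m /sqn !dotvE (dotvC x x'); field.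
    rewrite addrAC dotvDr hx dotvZr in h.
    rewrite /b dotvZl sqnZ.
    have -> : eps^-1 * dotv v g - eps^-1 ^+ 2 * sqn v / 2 =
       eps^-1 ^+ 2 * (- (sqn v / 2) + eps * dotv v g) by field; exact: lt0r_neq0.
    by rewrite mulr_ge0_le0// sqr_ge0.
rewrite -/B -/(I B) !E1 !E2 E3 E4.
move: (gs eps (I G) x') (gs eps (I G) x) (gs eps (I (F `\` G)) x')
  (gs eps (I (F `\` G)) x) H => a b d e H.
by rewrite (addeAC a) (addeAC b) (addeC b a); exact: leeD2l.
Qed.


Lemma nnmeas_indic (A : set E) : measurable A -> nnmeas (EFin \o \1_A : E -> \bar R).
Proof.
by move=> mA; split; [apply/measurable_EFinP; exact: measurable_indic|move=> x; rewrite lee_fin].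
Qed.

Lemma gs_le1 s (A : set E) x : measurable A -> (gs s (EFin \o \1_A) x <= 1)%E.
Proof.
move=> mA; rewrite -[leRHS](integral_cst_probability gamma).
apply: ge0_le_integralT => //.
- apply: (measurableT_comp (proj1 (nnmeas_indic mA))).
  by apply: measurable_cVD => //; exact: measurable_cVZ.
- by move=> g; rewrite lee_fin.
- by move=> g; rewrite lee_fin /= indicE lern1 leq_b1.
Qed.

End radial_monotonicity.

(** * Radial functions and the ball discrepancy *)

Section layer_cake.
Context {R : realType} {p : nat}.
Notation E := 'cV[R]_p.
Notation mu := (@lebesgue_measure R).
Implicit Types (lam nu : probability E R) (c x : E).
Local Open Scope ereal_scope.

(** A set that contains, with a point, everything nearer to [c] is empty, the whole space, a closed
    ball or an open ball; the last is an increasing union of closed balls. *)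
Lemma ball_discrepancy_lower_set lam nu (D : R) c (L : set E) : measurable L ->
  (forall u, `|prb lam (sqball c u) - prb nu (sqball c u)| <= D)%R ->
  (forall x x', L x -> sqn (x' - c) <= sqn (x - c) -> L x')%R ->
  (prb lam L <= prb nu L + D)%R.
Proof.
move=> mL hD lowL.
have D0 : (0 <= D)%R by apply: le_trans (hD 0%R); exact: normr_ge0.
have hb u : (prb lam (sqball c u) <= prb nu (sqball c u) + D)%R.
  by have := le_trans (ler_norm _) (hD u); rewrite lerBlDl addrC.
have [->|/set0P[x0 Lx0]] := eqVneq L set0; first by rewrite /prb !measure0 add0r.
pose S := [set sqn (x - c)%R | x in L].
have S0 : S !=set0 by exists (sqn (x0 - c)%R), x0.
have [ubS|nubS] := pselect (has_ubound S); last first.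
  suff -> : L = setT by rewrite /prb !probability_setT lerDl.
  apply/seteqP; split => // y _.
  apply: contra_notP nubS => nLy; exists (sqn (y - c)%R) => _ [x Lx <-].
  by rewrite leNgt; apply/negP => /ltW h; apply: nLy; exact: (lowL x).
have [[x Lx mx]|nmax] := pselect (exists2 x, L x & forall y, L y -> (sqn (y - c) <= sqn (x - c))%R).
  suff -> : L = sqball c (sqn (x - c)) by exact: hb.
  apply/seteqP; split => y /=; first exact: mx.
  exact: lowL.
have supS : has_sup S by split.
pose F n : set E := sqball c (sup S - n.+1%:R^-1)%R.
have FL n : F n `<=` L.
  move=> y; rewrite /F /sqball /= => hy.
  have [_ [x Lx <-] hx] := @sup_adherent _ S n.+1%:R^-1 (ltac:(by rewrite invr_gt0)) supS.
  by apply: (lowL x) => //; apply: ltW; exact: le_lt_trans hx.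
have LF : L = \bigcup_n F n.
  apply/seteqP; split => [y Ly|y [n _]]; last exact: FL.
  have ys : (sqn (y - c) < sup S)%R.
    rewrite lt_neqAle ub_le_sup ?andbT//; last by exists y.
    apply/eqP => h; apply: nmax; exists y => // z Lz.
    by rewrite h; apply: ub_le_sup => //; exists z.
  have e0 : (0 < sup S - sqn (y - c))%R by rewrite subr_gt0.
  have [n _ hn] := near_infty_natSinv_lt (PosNum e0).
  exists n => //; rewrite /F /sqball /=.
  have : (n.+1%:R^-1 < sup S - sqn (y - c))%R := hn n (leqnn n).
  by rewrite ltrBrDr lerBrDr addrC => /ltW.
have mF n : measurable (F n) by exact: measurable_sqball.
have ndF : {homo F : n m / (n <= m)%N >-> (n <= m)%O}.
  move=> n m nm; apply/subsetPset => y; rewrite /F /sqball /= => h; apply: (le_trans h).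
  by rewrite lerD2l lerN2 lef_pV2 ?posrE// ler_nat.
have cF : lam \o F @ \oo --> lam L.
  by rewrite LF; apply: nondecreasing_cvg_mu => //; rewrite -LF.
rewrite -lee_fin prbE// -(cvg_lim _ cF)//; apply: lime_le; first by apply/cvg_ex; exists (lam L).
near=> n; rewrite /= -prbE// lee_fin; apply: le_trans (hb _) _; rewrite lerD2r.
exact: le_prb (mF n) mL (@FL n).
Unshelve. all: by end_near.
Qed.

(** Layer cake: [v] is the integral over [s] in []0, M]] of the indicators of its superlevel sets,
    and each of these is a lower set for the distance to [c], costing at most [D]. *)
Lemma radial_discrepancy lam nu (D M : R) c (v : E -> R) : measurable_fun setT v ->
  (0 <= M)%R ->
  (forall u, `|prb lam (sqball c u) - prb nu (sqball c u)| <= D)%R ->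
  (forall x, 0 <= v x <= M)%R ->
  (forall x x', sqn (x - c) <= sqn (x' - c) -> v x' <= v x)%R ->
  \int[lam]_x (v x)%:E <= \int[nu]_x (v x)%:E + (D * M)%:E.
Proof.
move=> mv M0 hD v0M vmono.
have D0 : (0 <= D)%R by apply: le_trans (hD 0%R); exact: normr_ge0.
pose A := [set z : E * R | (0 < z.2 <= v z.1)%R].
have mA : measurable (A : set (E * measurableTypeR R)).
  have m1 : measurable_fun setT (fun z : E * measurableTypeR R => v z.1 - z.2)%R.
    by apply: measurable_funB => //; exact: measurableT_comp.
  have := m1 measurableT `[0%R, +oo[%classic (measurable_itv _).
  have m2 : measurable_fun setT (fun z : E * measurableTypeR R => z.2).
    exact: measurable_snd.
  have := m2 measurableT `]0%R, +oo[%classic (measurable_itv _).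
  rewrite !setTI => h1 h2; have := measurableI _ _ h1 h2.
  congr measurable; apply/seteqP; split => z; rewrite /A /= !in_itv/= !andbT subr_ge0.
    by move=> [-> ->].
  by move=> /andP[].
pose F (s : R) (x : E) : \bar R := (\1_A (x, s) : R)%:E.
have mF : measurable_fun setT (fun z : measurableTypeR R * E => F z.1 z.2).
  have mi : measurable_fun setT (\1_A : E * measurableTypeR R -> R) by exact: measurable_indic.
  apply/measurable_EFinP; apply: (measurableT_comp mi).
  exact: measurable_fun_pair measurable_snd measurable_fst.
have F0 s x : 0 <= F s x by rewrite lee_fin.
have mL s : measurable [set x | s <= v x]%R.
  have := mv measurableT `[s, +oo[%classic (measurable_itv _); rewrite setTI.
  by congr measurable; apply/seteqP; split => x; rewrite /= in_itv/= andbT.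
pose h (m : probability E R) s := \int[m]_x F s x.
have layer (m : probability E R) : \int[m]_x (v x)%:E = \int[mu]_s h m s.
  rewrite (@ge0_integral_swap _ _ _ _ _ mu m F mF F0).
  apply: eq_integral => x _; rewrite /F.
  transitivity (\int[mu]_s (\1_(`]0%R, v x]%classic) s : R)%:E).
    rewrite integral_indic// setIT.
    have /andP[v0 _] := v0M x.
    apply/esym; apply: etrans (lebesgue_measure_itv `]0%R, v x]) _.
    rewrite /= lte_fin; case: ltP => [_|v1].
      by rewrite oppr0 adde0.
    by congr (_%:E); apply/eqP; rewrite eq_le v0 v1.
  apply: eq_integral => s _; rewrite !indicE; congr (_%:R%:E); congr nat_of_bool.
have mh m : measurable_fun setT (h m : measurableTypeR R -> \bar R).
  exact: (@measurable_integral2 _ _ _ _ _ m F mF F0).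
have h0 m s : 0 <= h m s by exact: integral_ge0.
rewrite !layer.
have -> : (D * M)%:E = \int[mu]_s (D * \1_(`]0%R, M]%classic) s)%:E.
  under eq_integral do rewrite EFinM.
  rewrite ge0_integralZl//; last first.
    by apply/measurable_EFinP; exact: measurable_indic.
  rewrite integral_indic// setIT EFinM; congr *%E.
  apply/esym; apply: etrans (lebesgue_measure_itv `]0%R, M]) _.
  rewrite /= lte_fin; case: ltP => [_|M1]; first by rewrite oppr0 adde0.
  by congr (_%:E); apply/eqP; rewrite eq_le M0 M1.
rewrite -ge0_integralD//; last 2 first.
- by move=> s _; rewrite lee_fin mulr_ge0.
- by apply/measurable_EFinP; apply: measurable_funM => //; exact: measurable_indic.
apply: ge0_le_integralT => //.
  apply: emeasurable_funD => //; apply/measurable_EFinP.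
  by apply: measurable_funM => //; exact: measurable_indic.
move=> s; rewrite indicE.
have -> : (s \in `]0%R, M]%classic) = (0 < s <= M)%R.
  by apply/idP/idP => [/set_mem|hs]; [rewrite /= in_itv|apply/mem_set; rewrite /= in_itv].
have [/andP[s0 sM]|sN] := boolP (0 < s <= M)%R.
  have hE (m : probability E R) : h m s = (prb m [set x | s <= v x]%R)%:E.
    rewrite prb_indic//; apply: eq_integral => x _; rewrite /F !indicE.
    congr (_%:R%:E); congr nat_of_bool.
    by apply/idP/idP => /set_mem hs; apply/mem_set; move: hs; rewrite /A /= s0.
  rewrite !hE mulr1 -EFinD lee_fin; apply: (ball_discrepancy_lower_set (mL s) hD).
  by move=> x x' /= sx xx'; apply: (le_trans sx); exact: vmono.
rewrite mulr0 adde0 [X in X <= _](_ : _ = 0)//.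
apply: integral0_eq => x _; rewrite /F indicE.
have [|//] := boolP ((x, s) \in A); rewrite inE => /andP[/= s0 sv]; exfalso.
have /andP[_ vM] := v0M x.
by move: sN; rewrite s0 (le_trans sv vM).
Qed.

End layer_cake.


(** * The smoothing inequality *)

Section smoothing.
Context {R : realType} {p : nat}.
Notation E := 'cV[R]_p.
Notation gamma := (@gauss R p).
Implicit Types (lam nu : probability E R) (c x g : E).
Variable eps : R.
Hypotheses (eps0 : 0 < eps) (p0 : (0 < p)%N).

(** Chosen so that Chebyshev's inequality leaves probability at most [1 / 8]: its square [4096 e] is
    [8] times [128 e * 4], where [128 e] comes from the quadratic moment and [4] from the cross term
    [2 eps (x - c).g]. *)
Definition chebA : R := 64 * expR (1 / 2).

Let A0 : 0 < chebA. Proof. by rewrite mulr_gt0// expR_gt0. Qed.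

Let A2 : chebA ^+ 2 = 4096 * expR 1.
Proof.
rewrite /chebA exprMn -expRM_natl; congr (_ * expR _); first by ring.
by field.
Qed.

Definition gsw c u x : R := fine (gs eps (EFin \o \1_(sqball c u)) x).

Lemma gswE c u x : (gsw c u x)%:E = gs eps (EFin \o \1_(sqball c u)) x.
Proof.
have mB := @measurable_sqball R p c u.
rewrite /gsw fineK// ge0_fin_numE; last by have [_] := nnmeas_gs eps (nnmeas_indic mB).
by apply: le_lt_trans (gs_le1 eps x mB) _; rewrite ltry.
Qed.

Lemma gsw01 c u x : 0 <= gsw c u x <= 1.
Proof.
have mB := @measurable_sqball R p c u.
rewrite -!lee_fin gswE (gs_le1 eps x mB) andbT.
by have [_] := nnmeas_gs eps (nnmeas_indic mB).
Qed.

Lemma measurable_gsw c u : measurable_fun setT (gsw c u).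
Proof.
apply/measurable_EFinP.
have [+ _] := nnmeas_gs eps (nnmeas_indic (@measurable_sqball R p c u)).
by congr measurable_fun; apply/funext => x; rewrite /= gswE.
Qed.

Let N c x g : R := eps ^+ 2 * (sqn g - p%:R) + dotv ((2 * eps) *: (x - c)) g.

Let NE c x g : sqn (x + eps *: g - c) = sqn (x - c) + p%:R * eps ^+ 2 + N c x g.
Proof. by rewrite addrAC (sqnD (x - c)) sqnZ dotvZr /N dotvZl; ring. Qed.

Let mN c x : measurable_fun setT (fun g => N c x g ^+ 2).
Proof.
apply: measurable_funX; apply: measurable_funD; last exact: measurable_dotv.
by apply: measurable_funM => //; apply: measurable_funB => //; exact: measurable_sqn.
Qed.

(** The mean of [|x + eps g - c|^2]. The fluctuation around it is [N], with second moment of order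
    [eps^2 * var c x]. *)
Let var c x : R := sqn (x - c) + p%:R * eps ^+ 2.

Let var0 c x : 0 < var c x.
Proof. by rewrite /var ltr_wpDl ?sqn_ge0// mulr_gt0 ?ltr0n// exprn_gt0. Qed.

Let cheb c x : (\int[gamma]_g ((chebA * eps) ^- 2 / var c x * N c x g ^+ 2)%:E <= (1 / 8)%:E)%E.
Proof.
have v0 := var0 c x.
have k0 : 0 < (chebA * eps) ^- 2 / var c x.
  by rewrite divr_gt0// invr_gt0 exprn_gt0// mulr_gt0.
under eq_integral do rewrite EFinM.
rewrite ge0_integralZl//; last 3 first.
- exact/measurable_EFinP.
- by move=> g _; rewrite lee_fin sqr_ge0.
- by rewrite lee_fin ltW.
apply: le_trans (lee_wpmul2l _ (gauss_quadratic_moment _ _)) _; first by rewrite lee_fin ltW.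
rewrite -EFinM lee_fin exprMn sqnZ -invfM.
have s0 := sqn_ge0 (x - c).
have ee : 0 < eps ^+ 2 by rewrite exprn_gt0.
have p1 : 0 <= p%:R * eps ^+ 4 by rewrite mulr_ge0// exprn_ge0// ltW.
have D0 : 0 < chebA ^+ 2 * eps ^+ 2 * var c x by rewrite !mulr_gt0.
set M := 128 * _ * _; suff : M <= chebA ^+ 2 * eps ^+ 2 * var c x / 8.
  move: D0; move: (_ * var c x) M => D M D0 h.
  by rewrite mulrC ler_pdivrMr// mulrC mul1r.
rewrite A2 /M; have -> : 4096 * expR 1 * eps ^+ 2 * var c x / 8 =
    expR 1 * (512 * (eps ^+ 2 * sqn (x - c) + p%:R * eps ^+ 4)).
  by rewrite /var; field.
have -> : 128 * expR 1 * ((eps ^+ 2) ^+ 2 * p%:R + (2 * eps) ^+ 2 * sqn (x - c)) =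
    expR 1 * (128 * (p%:R * eps ^+ 4) + 512 * (eps ^+ 2 * sqn (x - c))) by ring.
rewrite ler_pM2l ?expR_gt0//; move: p1; move: (p%:R * _) (eps ^+ 2 * _) => y z; lra.
Qed.

Let cheb_ge1 c x g (r : R) : var c x = r ^+ 2 -> 0 <= r ->
  chebA * eps * r <= `|N c x g| -> 1 <= (chebA * eps) ^- 2 / var c x * N c x g ^+ 2.
Proof.
move=> vr r0 h; have v0 := var0 c x; have r1 : 0 < r.
  by rewrite lt0r r0 andbT; apply: contraTneq v0 => r00; rewrite vr r00 expr0n ltxx.
have T0 : 0 < chebA * eps * r by rewrite !mulr_gt0.
have -> : (chebA * eps) ^- 2 / var c x = (chebA * eps * r) ^- 2.
  by rewrite vr -invfM -exprMn.
rewrite mulrC ler_pdivlMr ?exprn_gt0// mul1r -(real_normK (num_real (N c x g))).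
by rewrite lerXn2r ?nnegrE ?normr_ge0// ltW.
Qed.

(** A point of mean squared distance [s^2 <= r^2] leaves the ball only if the fluctuation exceeds
    [chebA * eps * s], which has probability at most [1 / 8]. *)
Lemma gsw_ge c x (r th : R) : 0 <= r -> var c x <= r ^+ 2 -> r * (r + chebA * eps) <= th ->
  7 / 8 <= gsw c th x.
Proof.
move=> r0 vr hth; have v0 := var0 c x.
pose s := Num.sqrt (var c x); have s0 : 0 <= s := sqrtr_ge0 _.
have s2 : var c x = s ^+ 2 by rewrite sqr_sqrtr// ltW.
have sr : s <= r by rewrite -(@ler_pXn2r _ 2)// -s2.
have Ae : 0 < chebA * eps by rewrite mulr_gt0.
have sth : s ^+ 2 + chebA * eps * s <= th by apply: le_trans hth; nra.
have mB := @measurable_sqball R p c th.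
have [mI I0] := nnmeas_indic mB.
have mIg : measurable_fun setT (fun g : E => \1_(sqball c th) (x + eps *: g) : R).
  apply: (measurableT_comp (measurable_indic mB)).
  by apply: measurable_cVD => //; exact: measurable_cVZ.
have k0 : 0 <= (chebA * eps) ^- 2 / var c x.
  by rewrite divr_ge0 ?(ltW v0)// invr_ge0 sqr_ge0.
suff : 1 <= gsw c th x + 1 / 8 by lra.
rewrite -lee_fin -[leLHS](integral_cst_probability gamma).
apply: (@le_trans _ _ (\int[gamma]_g (\1_(sqball c th) (x + eps *: g) +
    (chebA * eps) ^- 2 / var c x * N c x g ^+ 2)%:E)%E).
  apply: ge0_le_integralT => //.
  - apply/measurable_EFinP; apply: measurable_funD => //; apply: measurable_funM => //.
  - move=> g; rewrite lee_fin indicE; have [gB|gB] := boolP (_ \in _).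
      by rewrite lerDl mulr_ge0// sqr_ge0.
    rewrite add0r; apply: (cheb_ge1 s2 s0).
    move: gB => /negP; rewrite inE /sqball /= NE -/(var c x) s2 => /negP; rewrite -ltNge => h.
    by apply: le_trans (ler_norm _); lra.
apply: integral_leD => //.
- by apply: measurable_funM.
- by move=> g; rewrite mulr_ge0// sqr_ge0.
- by rewrite gswE.
Qed.

Lemma gsw_le c x (r th : R) : chebA * eps <= r -> r ^+ 2 <= var c x ->
  th <= r * (r - chebA * eps) -> gsw c th x <= 1 / 8.
Proof.
move=> r0 vr hth; have v0 := var0 c x.
have Ae : 0 < chebA * eps by rewrite mulr_gt0.
pose s := Num.sqrt (var c x); have s0 : 0 <= s := sqrtr_ge0 _.
have s2 : var c x = s ^+ 2 by rewrite sqr_sqrtr// ltW.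
have rr0 : 0 <= r by lra.
have sr : r <= s by rewrite -(@ler_pXn2r _ 2)// -s2.
have sth : th <= s ^+ 2 - chebA * eps * s by apply: (le_trans hth); nra.
have mB := @measurable_sqball R p c th.
have mIg : measurable_fun setT (fun g : E => \1_(sqball c th) (x + eps *: g) : R).
  apply: (measurableT_comp (measurable_indic mB)).
  by apply: measurable_cVD => //; exact: measurable_cVZ.
have k0 : 0 <= (chebA * eps) ^- 2 / var c x.
  by rewrite divr_ge0 ?(ltW v0)// invr_ge0 sqr_ge0.
rewrite -lee_fin gswE; apply: le_trans (cheb c x); apply: ge0_le_integralT => //.
- exact/measurable_EFinP.
- by apply/measurable_EFinP; apply: measurable_funM.
- by move=> g; rewrite lee_fin.
- move=> g; rewrite lee_fin /= indicE; have [gB|gB] := boolP (_ \in _); last first.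
    by rewrite mulr_ge0// sqr_ge0.
  apply: (cheb_ge1 s2 s0); move: gB; rewrite inE /sqball /= NE -/(var c x) s2 => h.
  by rewrite -normrN; apply: le_trans (ler_norm _); lra.
Qed.

Definition smprb lam c u : R := fine (\int[lam]_x gs eps (EFin \o \1_(sqball c u)) x)%E.

Lemma smprbE lam c u : (smprb lam c u)%:E = (\int[lam]_x (gsw c u x)%:E)%E.
Proof.
rewrite /smprb; under eq_integral do rewrite -gswE.
rewrite fineK// ge0_fin_numE; last first.
  by apply: integral_ge0 => x _; rewrite lee_fin; have /andP[] := gsw01 c u x.
apply: (@le_lt_trans _ _ 1%E); last exact: ltry.
rewrite -[leRHS](integral_cst_probability lam); apply: ge0_le_integralT => //.
- by apply/measurable_EFinP; exact: measurable_gsw.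
- by move=> x; rewrite lee_fin; have /andP[] := gsw01 c u x.
- by move=> x; rewrite lee_fin; have /andP[] := gsw01 c u x.
Qed.

(** The pieces [w1] and [w3] are radial, nonincreasing and at most [1 / 8], so each costs
    [Delta / 8]. The middle piece [w2] has height [3 / 4], and dividing by it turns [Delta / 4] into
    one third of [Delta]. *)
Let smoothing_half lam nu c (r1 Delta : R) : 0 <= r1 ->
  (forall u, `|prb lam (sqball c u) - prb nu (sqball c u)| <= Delta) ->
  3 / 4 * (prb lam (sqball c (r1 ^+ 2 - p%:R * eps ^+ 2)) -
           prb nu (sqball c ((r1 + chebA * eps) ^+ 2 - p%:R * eps ^+ 2))) <=
  smprb lam c (r1 * (r1 + chebA * eps)) - smprb nu c (r1 * (r1 + chebA * eps)) +
    Delta / 4.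
Proof.
(* The level [th] equals both [r1 (r1 + chebA eps)] and [r2 (r2 - chebA eps)], so the lower estimate
   applies at radius [r1] and the upper one at radius [r2]. *)
move=> r10 hD; set r2 := r1 + chebA * eps; set th := r1 * r2.
set u1 := r1 ^+ 2 - _; set u2 := r2 ^+ 2 - _.
pose w := gsw c th; have w01 x : 0 <= w x <= 1 := gsw01 c th x.
have mw : measurable_fun setT w := measurable_gsw c th.
have wmono x x' : sqn (x - c) <= sqn (x' - c) -> w x' <= w x.
  by move=> h; rewrite -lee_fin gswE gswE; exact: (gs_sqball_radial _ eps0 h).
have hD' u : `|prb nu (sqball c u) - prb lam (sqball c u)| <= Delta by rewrite distrC.
pose w1 x := Num.min (w x) (1 / 8).
pose w3 x := Num.max (w x - 7 / 8) 0.
pose w2 x := w x - w1 x - w3 x.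
have mw1 : measurable_fun setT w1 by exact: measurable_minr.
have mw3 : measurable_fun setT w3.
  by apply: measurable_maxr => //; exact: measurable_funB.
have mw2 : measurable_fun setT w2 by apply: measurable_funB => //; exact: measurable_funB.
have w1b x : 0 <= w1 x <= 1 / 8.
  have /andP[h1 h2] := w01 x; rewrite /w1 le_min h1 ge_min lexx orbT /=; lra.
have w3b x : 0 <= w3 x <= 1 / 8.
  have /andP[h1 h2] := w01 x; rewrite /w3 le_max lexx orbT ge_max /=.
  by apply/andP; split; lra.
have w2b x : 0 <= w2 x <= 3 / 4.
  have /andP[h1 h2] := w01 x; rewrite /w2 /w1 /w3.
  case: (leP (w x) (1 / 8)) => h3; case: (leP (w x - 7 / 8) 0) => h4; lra.
have wE x : w x = w1 x + (w2 x + w3 x) by rewrite /w2; ring.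
have mI u : measurable_fun setT (\1_(sqball c u) : E -> R).
  by apply: measurable_indic; exact: measurable_sqball.
have w2lo x : 3 / 4 * \1_(sqball c u1) x <= w2 x.
  rewrite indicE; have [xB|xB] := boolP (_ \in _); last first.
    by rewrite mulr0; have /andP[] := w2b x.
  have h7 : 7 / 8 <= w x.
    apply: (@gsw_ge c x r1) => //.
    by move: xB; rewrite inE /sqball /= /u1 /var; lra.
  have /andP[h1 h2] := w01 x; rewrite mulr1 /w2 /w1 /w3.
  case: (leP (w x) (1 / 8)) => h3; case: (leP (w x - 7 / 8) 0) => h4; lra.
have w2hi x : w2 x <= 3 / 4 * \1_(sqball c u2) x.
  rewrite indicE; have [xB|xB] := boolP (_ \in _).
    by rewrite mulr1; have /andP[] := w2b x.
  have h1 : w x <= 1 / 8.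
    apply: (@gsw_le c x r2).
    - by rewrite /r2 lerDr.
    - move: xB => /negP; rewrite inE /sqball /= => /negP; rewrite -ltNge /u2 /var; lra.
    - by rewrite /th /r2 mulrC addrK.
  rewrite mulr0 /w2 /w1 /w3.
  case: (leP (w x) (1 / 8)) => h3; case: (leP (w x - 7 / 8) 0) => h4; lra.
pose Int (m : probability E R) (f : E -> R) : R := fine (\int[m]_x (f x)%:E)%E.
have IntE (m : probability E R) (f : E -> R) (k : R) :
    measurable_fun setT f -> (forall x, 0 <= f x <= k) ->
    (Int m f)%:E = (\int[m]_x (f x)%:E)%E.
  move=> mf f0k; rewrite /Int fineK// ge0_fin_numE; last first.
    by apply: integral_ge0 => x _; rewrite lee_fin; have /andP[] := f0k x.
  apply: (@le_lt_trans _ _ k%:E); last exact: ltry.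
  rewrite -[leRHS](integral_cst_probability m); apply: ge0_le_integralT => //.
  - exact/measurable_EFinP.
  - by move=> x; rewrite lee_fin; have /andP[] := f0k x.
  - by move=> x; rewrite lee_fin; have /andP[] := f0k x.
have sumE (m : probability E R) : smprb m c th = Int m w1 + (Int m w2 + Int m w3).
  apply: EFin_inj; rewrite smprbE !EFinD.
  rewrite !(IntE m _ _ _ w1b) ?(IntE m _ _ _ w2b) ?(IntE m _ _ _ w3b)//.
  rewrite -!ge0_integralD//.
  - by apply: eq_integral => x _; rewrite -!EFinD -wE.
  - by move=> x _; rewrite lee_fin; have /andP[] := w1b x.
  - exact/measurable_EFinP.
  - by move=> x _; rewrite adde_ge0 ?lee_fin//; [have /andP[] := w2b x|have /andP[] := w3b x].
  - by apply: emeasurable_funD; exact/measurable_EFinP.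
  - by move=> x _; rewrite lee_fin; have /andP[] := w2b x.
  - exact/measurable_EFinP.
  - by move=> x _; rewrite lee_fin; have /andP[] := w3b x.
  - exact/measurable_EFinP.
have d1 : Int nu w1 <= Int lam w1 + Delta * (1 / 8).
  rewrite -lee_fin EFinD !(IntE _ _ _ _ w1b)//.
  apply: (@radial_discrepancy R p nu lam Delta (1 / 8) c w1 mw1 _ hD' w1b) => [|x x' h].
    exact: divr_ge0.
  by rewrite /w1 le_min !ge_min (wmono _ _ h) lexx /= orbT.
have d3 : Int nu w3 <= Int lam w3 + Delta * (1 / 8).
  rewrite -lee_fin EFinD !(IntE _ _ _ _ w3b)//.
  apply: (@radial_discrepancy R p nu lam Delta (1 / 8) c w3 mw3 _ hD' w3b) => [|x x' h].
    exact: divr_ge0.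
  by rewrite /w3 ge_max !le_max lexx orbT andbT lerD2r (wmono _ _ h).
have e1 : 3 / 4 * prb lam (sqball c u1) <= Int lam w2.
  rewrite -lee_fin (IntE _ _ _ _ w2b)// EFinM prb_indic; last exact: measurable_sqball.
  rewrite -ge0_integralZl//; last exact/measurable_EFinP.
  apply: ge0_le_integralT.
  - by apply/measurable_EFinP; apply: measurable_funM.
  - exact/measurable_EFinP.
  - by move=> x; rewrite lee_fin mulr_ge0.
  - by move=> x; rewrite lee_fin.
have e2 : Int nu w2 <= 3 / 4 * prb nu (sqball c u2).
  rewrite -lee_fin (IntE _ _ _ _ w2b)// EFinM prb_indic; last exact: measurable_sqball.
  apply: integral_le_scaled => // x; by have /andP[] := w2b x.
rewrite !sumE; lra.
Qed.

Lemma smoothing lam nu (Delta M q : R) : 0 <= M ->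
  (forall c u, `|prb lam (sqball c u) - prb nu (sqball c u)| <= Delta) ->
  (forall c u, `|smprb lam c u - smprb nu c u| <= M) ->
  (forall c u1 u2, u1 <= u2 ->
    u2 - u1 <= 2 * chebA * eps * Num.sqrt (u2 + p%:R * eps ^+ 2) ->
    prb nu (sqball c u2) - prb nu (sqball c u1) <= q) ->
  forall c u, `|prb lam (sqball c u) - prb nu (sqball c u)| <= q + 4 / 3 * M + Delta / 3.
Proof.
move=> M0 hD hM hq c u.
have Ae : 0 < chebA * eps by rewrite mulr_gt0.
have pe : 0 < p%:R * eps ^+ 2 by rewrite mulr_gt0 ?ltr0n// exprn_gt0.
have D0 : 0 <= Delta by apply: le_trans (hD c u); exact: normr_ge0.
have q0 : 0 <= q.
  have := hq c u u (lexx _); rewrite !subrr; apply.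
  by rewrite !mulr_ge0 ?sqrtr_ge0// ltW.
have neg (m : probability E R) u' : u' < 0 -> prb m (sqball c u') = 0.
  move=> u'0; rewrite /prb (_ : sqball c u' = set0) ?measure0//.
  apply/seteqP; split => x //=; rewrite /sqball /= => h.
  by have := sqn_ge0 (x - c); lra.
have [u0|u0] := ltP u 0.
  by rewrite !neg// subrr normr0; lra.
pose r := Num.sqrt (u + p%:R * eps ^+ 2).
have r0 : 0 <= r := sqrtr_ge0 _.
have r2 : r ^+ 2 = u + p%:R * eps ^+ 2 by rewrite sqr_sqrtr//; lra.
rewrite ler_norml; apply/andP; split.
  have hD' c' u' : `|prb nu (sqball c' u') - prb lam (sqball c' u')| <= Delta by rewrite distrC.
  suff : prb nu (sqball c u) - prb lam (sqball c u) <= q + 4 / 3 * M + Delta / 3 by lra.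
  have [rA|rA] := leP (chebA * eps) r.
    pose r1 := r - chebA * eps; have r10 : 0 <= r1 by rewrite subr_ge0.
    have := @smoothing_half nu lam c r1 Delta r10 (hD' c).
    rewrite /r1 subrK r2 addrK -/r1.
    have := hq c (r1 ^+ 2 - p%:R * eps ^+ 2) u.
    rewrite -/r -mulrA (_ : u - _ = r ^+ 2 - r1 ^+ 2); last by rewrite r2; lra.
    have h1 : r1 ^+ 2 - p%:R * eps ^+ 2 <= u by rewrite /r1; nra.
    have h2 : r ^+ 2 - r1 ^+ 2 <= 2 * chebA * (eps * r) by rewrite /r1; nra.
    move=> /(_ h1 h2) h3.
    have := hM c (r1 * r); rewrite ler_norml => /andP[h5 _].
    lra.
  (* Here [r < chebA * eps] and there is no inner ball to compare with; since [u < r^2], the lower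
     level is negative and the shell is the whole ball. *)
  have := hq c (u - 2 * chebA * eps * r) u.
  rewrite -/r opprB addrCA subrr addr0 (neg _ (u - _)) ?subr0; last first.
    have : u < r ^+ 2 by rewrite r2; lra.
    by nra.
  have h1 : u - 2 * chebA * eps * r <= u by nra.
  move=> /(_ h1 (lexx _)) h2.
  have := prb_ge0 lam (sqball c u); lra.
have := @smoothing_half lam nu c r Delta r0 (hD c).
set r' := r + chebA * eps; rewrite r2 addrK.
have := hq c u (r' ^+ 2 - p%:R * eps ^+ 2).
rewrite subrK sqrtr_sqr ger0_norm; last by rewrite /r'; lra.
have h1 : u <= r' ^+ 2 - p%:R * eps ^+ 2 by rewrite /r'; nra.
have h2 : r' ^+ 2 - p%:R * eps ^+ 2 - u <= 2 * chebA * eps * r'.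
  rewrite (_ : _ - _ = r' ^+ 2 - r ^+ 2); last by rewrite r2; lra.
  by rewrite /r'; nra.
move=> /(_ h1 h2) h3.
have := hM c (r * r'); rewrite ler_norml => /andP[_ h5].
lra.
Qed.

End smoothing.

(** * Taylor remainder of the Cameron-Martin density, pointwise *)

Section exp_remainder.
Context {R : realType}.
Implicit Types a c u z kap : R.
Local Notation S := (fun a K => series (exp_coeff a) K).

Lemma exp_coeff_le_expR a i : 0 <= a -> exp_coeff a i <= expR a.
Proof.
move=> a0; apply: le_trans (_ : S a i.+1 <= _).
  rewrite seriesEnat /= big_nat_recr//= lerDr sumr_ge0// => j _; exact: exp_coeff_ge0.
apply: nondecreasing_cvgn_le; last exact: is_cvg_series_exp_coeff.
apply/nondecreasing_seqP => n; rewrite !seriesEnat /= big_nat_recr//= lerDl.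
exact: exp_coeff_ge0.
Qed.

Lemma series_exp_coeff_le a n : 0 <= a -> S a n <= expR a.
Proof.
move=> a0; apply: nondecreasing_cvgn_le; last exact: is_cvg_series_exp_coeff.
apply/nondecreasing_seqP => m; rewrite !seriesEnat /= big_nat_recr//= lerDl.
exact: exp_coeff_ge0.
Qed.

Lemma normr_exp_coeff a i : `|exp_coeff a i| = exp_coeff `|a| i.
Proof. by rewrite /exp_coeff /= normrM normrX; congr (_ * _); rewrite ger0_norm// invr_ge0. Qed.

Lemma expR_taylor_le a K : `|expR a - S a K| <= `|a| ^+ K * expR `|a|.
Proof.
have h : (fun n => `|S a (K + n)%N - S a K|) @ \oo --> `|expR a - S a K|.
  apply: cvg_norm; apply: cvgB; last exact: cvg_cst.
  have : series (exp_coeff a) @ \oo --> expR a := is_cvg_series_exp_coeff a.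
  by rewrite -(cvg_shiftn K); under [in X in X -> _]eq_fun do rewrite addnC.
apply: (cvgr_to_le h); apply: nearW => n.
rewrite !seriesEnat /= (@big_cat_nat _ _ _ K 0 (K + n))//= ?leq_addr// addrAC subrr add0r.
rewrite -{1}[K]add0n big_addn addKn.
apply: le_trans (ler_norm_sum _ _ _) _.
apply: (@le_trans _ _ (\sum_(0 <= i < n) `|a| ^+ K * exp_coeff `|a| i)).
  apply: ler_sum => i _; rewrite normr_exp_coeff /exp_coeff /= exprD mulrC mulrA [in leRHS]mulrA.
  rewrite [leLHS](_ : _ = `|a| ^+ K * `|a| ^+ i / ((i + K)`!)%:R); last by ring.
  apply: ler_wpM2l; first by rewrite mulr_ge0// exprn_ge0.
  by rewrite lef_pV2 ?posrE ?ltr0n ?fact_gt0// ler_nat leq_fact// leq_addr.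
rewrite -mulr_sumr ler_wpM2l ?exprn_ge0//.
by have := @series_exp_coeff_le `|a| n (normr_ge0 a); rewrite seriesEnat.
Qed.

(** Truncation of [exp a * exp (- c)] where [a] has degree one and [c] degree two. For [a = k.w] and
    [c = |k|^2 / 2] this keeps the degrees below [K] in [k]: it is a partial sum of the generating
    series of Hermite polynomials. *)
Definition hermtrunc K a c : R :=
  \sum_(0 <= i < K) \sum_(0 <= l < K | (i + 2 * l < K)%N) exp_coeff a i * exp_coeff (- c) l.

Let term_le kap u z i l m : 0 <= kap -> 0 <= z <= 1 -> kap ^+ (i + 2 * l) <= kap ^+ m ->
  `|exp_coeff (kap * u) i * exp_coeff (- (kap ^+ 2 * z / 2)) l| <= kap ^+ m * expR `|u|.
Proof.
move=> k0 /andP[z0 z1] hk.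
have -> : exp_coeff (kap * u) i * exp_coeff (- (kap ^+ 2 * z / 2)) l =
    kap ^+ (i + 2 * l) * (exp_coeff u i * exp_coeff (- (z / 2)) l).
  have -> : - (kap ^+ 2 * z / 2) = kap ^+ 2 * - (z / 2) by ring.
  rewrite /exp_coeff /= !(exprMn _ kap) (exprMn _ (kap ^+ 2)) exprD exprM; ring.
rewrite normrM (ger0_norm (exprn_ge0 _ k0)).
apply: ler_pM => //; first exact: exprn_ge0.
rewrite normrM !normr_exp_coeff -[leRHS]mulr1; apply: ler_pM.
- exact: exp_coeff_ge0.
- exact: exp_coeff_ge0.
- exact: exp_coeff_le_expR.
- rewrite normrN ger0_norm ?divr_ge0// /exp_coeff /=.
  rewrite ler_pdivrMr ?ltr0n ?fact_gt0// mul1r.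
  apply: (@le_trans _ _ 1); first by rewrite exprn_ile1 ?divr_ge0//; lra.
  by rewrite ler1n fact_gt0.
Qed.

Let sum_le K (Q : nat -> nat -> bool) (F : nat -> nat -> R) (b : R) : 0 <= b ->
  (forall i l, Q i l -> `|F i l| <= b) ->
  `|\sum_(0 <= i < K) \sum_(0 <= l < K | Q i l) F i l| <= K%:R ^+ 2 * b.
Proof.
move=> b0 hF; rewrite expr2 -mulrA; apply: le_trans (ler_norm_sum _ _ _) _.
apply: (@le_trans _ _ (\sum_(0 <= i < K) K%:R * b)); last first.
  by rewrite sumr_const_nat subn0 [leRHS]mulr_natl lexx.
apply: ler_sum => i _; apply: le_trans (ler_norm_sum _ _ _) _.
apply: (@le_trans _ _ (\sum_(0 <= l < K) b)); last first.
  by rewrite sumr_const_nat subn0 [leRHS]mulr_natl lexx.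
rewrite big_mkcond; apply: ler_sum => l _; case: ifPn => // h; exact: hF.
Qed.

(** The three terms account for [|u|^K <= K! exp |u|], for the remainder of [exp (- c)] with
    [c <= 1], and for the at most [K^2] terms of a truncated double sum. *)
Definition hermC (K : nat) : R := K`!%:R + expR 1 + K%:R ^+ 2.

Lemma hermC_ge0 K : 0 <= hermC K.
Proof. by rewrite /hermC !addr_ge0 ?expR_ge0 ?exprn_ge0. Qed.

(** The exponential itself is kept on the right: for large [kap] it is not controlled by
    [exp (2 |u|)], but its Gaussian integral equals one. *)
Lemma hermrem_le K kap u z : (0 < K)%N -> 0 <= kap -> 0 <= z <= 1 ->
  `|expR (kap * u - kap ^+ 2 * z / 2) - hermtrunc K (kap * u) (kap ^+ 2 * z / 2)| <=
  kap ^+ K * (expR (kap * u - kap ^+ 2 * z / 2) + hermC K * expR (2 * `|u|)).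
Proof.
move=> K0 k0 /andP[z0 z1]; set a := kap * u; set c := kap ^+ 2 * z / 2.
have kK0 : 0 <= kap ^+ K := exprn_ge0 _ k0.
have e1 : 1 <= expR `|u| by rewrite -expR0 ler_expR.
have e2 : expR `|u| <= expR (2 * `|u|) by rewrite ler_expR ler_peMl//; lra.
have c0 : 0 <= c by rewrite /c !mulr_ge0// exprn_ge0.
have H0 : K%:R ^+ 2 * (kap ^+ K * expR `|u|) <= kap ^+ K * (K%:R ^+ 2 * expR (2 * `|u|)).
  by rewrite mulrCA !ler_wpM2l// exprn_ge0.
have C0 : 0 <= K`!%:R + expR 1 :> R by rewrite addr_ge0 ?expR_ge0.
have ee0 : 0 <= expR (2 * `|u|) := expR_ge0 _.
have eac : 0 <= expR (a - c) := expR_ge0 _.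
have [kap1|kap1] := leP kap 1; last first.
  apply: (le_trans (ler_normB _ _)); rewrite (ger0_norm (expR_ge0 _)) mulrDr; apply: lerD.
    by rewrite ler_peMl// exprn_ege1// ltW.
  apply: (@le_trans _ _ (K%:R ^+ 2 * (kap ^+ K * expR `|u|))).
    apply: sum_le; first by rewrite mulr_ge0// expR_ge0.
    move=> i l il; apply: term_le => //; first by rewrite z0.
    by apply: ler_weXn2l; [exact: ltW|exact: ltnW].
  apply: le_trans H0 _; rewrite ler_wpM2l// ler_wpM2r// /hermC; lra.
have a1 : `|a| <= `|u| by rewrite normrM (ger0_norm k0) ler_piMl.
have c1 : c <= 1.
  rewrite /c -mulrA; apply: (@le_trans _ _ (1 * 1)); last by rewrite mulr1.
  by apply: ler_pM; rewrite ?exprn_ge0 ?divr_ge0 ?exprn_ile1//; lra.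
have cK : `|- c| ^+ K <= kap ^+ K.
  rewrite normrN (ger0_norm c0) lerXn2r ?nnegrE// /c expr2 -!mulrA ler_piMr// mulrCA.
  rewrite mulr_ile1 ?divr_ge0//; lra.
have Sa : `|S a K| <= expR `|u|.
  rewrite seriesEnat /=; apply: le_trans (ler_norm_sum _ _ _) _.
  under eq_bigr do rewrite normr_exp_coeff.
  have := @series_exp_coeff_le `|a| K (normr_ge0 _); rewrite seriesEnat /= => h.
  by apply: le_trans h _; rewrite ler_expR.
(* For [kap <= 1] the truncation is the product of two Taylor polynomials minus the terms of degree
   at least [K], each of which carries a factor at most [kap^K]. *)
have hprod : hermtrunc K a c = S a K * S (- c) K -
    \sum_(0 <= i < K) \sum_(0 <= l < K | ~~ (i + 2 * l < K)%N) exp_coeff a i * exp_coeff (- c) l.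
  rewrite !seriesEnat /= mulr_suml; apply/eqP; rewrite eq_sym subr_eq; apply/eqP.
  rewrite /hermtrunc -big_split /=; apply: eq_bigr => i _.
  by rewrite mulr_sumr (bigID (fun l => (i + 2 * l < K)%N)).
have h1 : `|expR a - S a K| <= kap ^+ K * (K`!%:R * expR (2 * `|u|)).
  apply: le_trans (expR_taylor_le a K) _.
  rewrite {1}/a normrM exprMn (ger0_norm k0) -mulrA ler_wpM2l//.
  rewrite mulr2n mulrDl mul1r expRD mulrA; apply: ler_pM => //.
  - have := @exp_coeff_le_expR `|u| K (normr_ge0 _).
    by rewrite /exp_coeff /= ler_pdivrMr ?ltr0n ?fact_gt0// mulrC.
  - by rewrite ler_expR ler_piMl.
have h2 : `|expR (- c) - S (- c) K| <= kap ^+ K * expR 1.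
  apply: le_trans (expR_taylor_le _ K) _; apply: ler_pM => //.
  - by rewrite ler_expR normrN ger0_norm.
have h3 : `|\sum_(0 <= i < K) \sum_(0 <= l < K | ~~ (i + 2 * l < K)%N)
    exp_coeff a i * exp_coeff (- c) l| <= K%:R ^+ 2 * (kap ^+ K * expR `|u|).
  apply: sum_le; first by rewrite mulr_ge0// expR_ge0.
  move=> i l; rewrite -leqNgt => il; apply: term_le => //; first by rewrite z0.
  exact: ler_wiXn2l.
have ec1 : expR (- c) <= 1 by rewrite -expR0 ler_expR oppr_le0.
set s3 := \sum_(0 <= i < K) _ in hprod h3.
have -> : expR (a - c) - hermtrunc K a c =
   (expR a - S a K) * expR (- c) + S a K * (expR (- c) - S (- c) K) + s3.
  by rewrite hprod expRD; ring.
apply: (le_trans (ler_normD _ _)); apply: (@le_trans _ _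
  (kap ^+ K * (K`!%:R * expR (2 * `|u|)) + expR (2 * `|u|) * (kap ^+ K * expR 1) +
   kap ^+ K * (K%:R ^+ 2 * expR (2 * `|u|)))).
  apply: lerD; last exact: le_trans h3 H0.
  apply: (le_trans (ler_normD _ _)); rewrite !normrM; apply: lerD.
    rewrite -[leRHS]mulr1; apply: ler_pM => //.
    by rewrite (ger0_norm (expR_ge0 _)).
  by apply: ler_pM => //; exact: le_trans Sa e2.
have -> : kap ^+ K * (K`!%:R * expR (2 * `|u|)) + expR (2 * `|u|) * (kap ^+ K * expR 1) +
   kap ^+ K * (K%:R ^+ 2 * expR (2 * `|u|)) = kap ^+ K * (hermC K * expR (2 * `|u|)).
  by rewrite /hermC; ring.
by rewrite ler_wpM2l// lerDr.
Qed.

End exp_remainder.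

(** * Gaussian norm of the remainder *)

Section gauss_remainder.
Context {R : realType} {p : nat}.
Notation E := 'cV[R]_p.
Notation gamma := (@gauss R p).
Implicit Types k w : E.

Definition cmrem K k w : R := cmd k w - hermtrunc K (dotv k w) (sqn k / 2).

Lemma measurable_hermtrunc d (T : measurableType d) K (f g : T -> R) :
  measurable_fun setT f -> measurable_fun setT g ->
  measurable_fun setT (fun t => hermtrunc K (f t) (g t)).
Proof.
move=> mf mg; apply: measurable_sum => i.
under eq_fun do rewrite big_mkcond.
apply: measurable_sum => l; case: (i + 2 * l < K)%N => //.
apply: measurable_funM; apply: measurable_funM => //; apply: measurable_funX => //.
exact: measurableT_comp.
Qed.

Lemma measurable_cmrem d (T : measurableType d) K (f g : T -> E) :
  measurable_fun setT f -> measurable_fun setT g ->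
  measurable_fun setT (fun t => cmrem K (f t) (g t)).
Proof.
move=> mf mg; apply: measurable_funB; first exact: measurable_cmd.
apply: measurable_hermtrunc; first exact: measurable_dotv.
by apply: measurable_funM => //; exact: measurable_sqn.
Qed.

Definition cmremC (K : nat) : R := 1 + 2 * hermC K * expR 2.

Lemma cmremC_ge1 K : 1 <= cmremC K.
Proof. by rewrite /cmremC lerDl !mulr_ge0 ?expR_ge0// hermC_ge0. Qed.

(** With [k = kap b] and [|b| <= 1], only the linear form [b.w] enters, so the dimension disappears:
    the density integrates to one and [exp (2 |b.w|)] to at most [2 exp 2]. *)
Lemma integral_cmrem_le K k : (0 < K)%N ->
  (\int[gamma]_w (`|cmrem K k w|)%:E <= (cmremC K * enorm k ^+ K)%:E)%E.
Proof.
move=> K0; set kap := enorm k; have k0 : 0 <= kap := enorm_ge0 _.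
pose b : E := kap^-1 *: k.
have kb : k = kap *: b.
  rewrite /b scalerA; have [k00|k00] := eqVneq kap 0; last by rewrite divff// scale1r.
  have : sqn k = 0 by rewrite -enorm_sqr -/kap k00 expr0n.
  by move/eqP; rewrite sqn_eq0 k00 mul0r scale0r => /eqP.
have b1 : 0 <= sqn b <= 1.
  rewrite sqn_ge0 /b sqnZ -enorm_sqr -/kap -exprMn.
  have [->|k00] := eqVneq kap 0; first by rewrite mulr0 expr0n/=.
  by rewrite mulVf// expr1n lexx.
have mdb : measurable_fun setT (fun w : E => dotv b w) by exact: measurable_dotv.
have mE s : measurable_fun setT (fun w : E => expR (s * dotv b w)).
  by apply: measurableT_comp => //; exact: measurable_funM.
have mcmd : measurable_fun setT (fun w : E => cmd k w) by exact: measurable_cmd.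
apply: (@le_trans _ _ (\int[gamma]_w (kap ^+ K * (cmd k w +
    hermC K * (expR (2 * dotv b w) + expR (- 2 * dotv b w))))%:E)%E).
  apply: ge0_le_integralT => //.
  - by apply/measurable_EFinP; apply: measurableT_comp => //; exact: measurable_cmrem.
  - apply/measurable_EFinP; apply: measurable_funM => //; apply: measurable_funD => //.
    by apply: measurable_funM => //; exact: measurable_funD.
  - move=> w; rewrite lee_fin /cmrem /cmd.
    have -> : dotv k w = kap * dotv b w by rewrite [in LHS]kb dotvZl.
    have -> : sqn k / 2 = kap ^+ 2 * sqn b / 2 by rewrite [in LHS]kb sqnZ.
    apply: le_trans (hermrem_le _ K0 k0 b1) _.
    rewrite ler_wpM2l ?exprn_ge0// lerD2l ler_wpM2l ?hermC_ge0//.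
    case: (ger0P (dotv b w)) => _.
      by rewrite lerDl expR_ge0.
    by rewrite mulrN -mulNr lerDr expR_ge0.
have eb s : s ^+ 2 = 4 -> (\int[gamma]_w (expR (s * dotv b w))%:E <= (expR 2)%:E)%E.
  move=> s4; have := integral_expR_dotv (s *: b).
  under eq_integral do rewrite dotvZl.
  move=> h; apply: le_trans h _; rewrite lee_fin ler_expR sqnZ s4; lra.
under eq_integral do rewrite EFinM.
rewrite ge0_integralZl//; last 3 first.
- apply/measurable_EFinP; apply: measurable_funD => //.
  by apply: measurable_funM => //; exact: measurable_funD.
- move=> w _; rewrite lee_fin addr_ge0 ?cmd_ge0// mulr_ge0 ?hermC_ge0// addr_ge0 ?expR_ge0//.
- by rewrite lee_fin exprn_ge0.
rewrite mulrC EFinM lee_wpmul2l ?lee_fin ?exprn_ge0//.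
rewrite /cmremC EFinD; apply: integral_leD => //.
- by apply: measurable_funM => //; exact: measurable_funD.
- by move=> w; exact: cmd_ge0.
- by move=> w; rewrite mulr_ge0 ?hermC_ge0// addr_ge0 ?expR_ge0.
- by rewrite integral_cmd.
under eq_integral do rewrite EFinM.
rewrite ge0_integralZl//; last 2 first.
- by apply/measurable_EFinP; exact: measurable_funD.
- by rewrite lee_fin hermC_ge0.
rewrite [2 * _]mulrC -mulrA EFinM lee_wpmul2l ?lee_fin ?hermC_ge0//.
have -> : 2 * expR 2 = expR 2 + expR 2 :> R by ring.
rewrite EFinD.
apply: integral_leD => //; by [move=> w; exact: expR_ge0|apply: eb; ring].
Qed.

End gauss_remainder.

(** * Polynomials with the same integral under [mu] and [nu] *)

Section moments.
Context {R : realType} {p : nat}.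
Notation E := 'cV[R]_p.
Notation gamma := (@gauss R p).
Variables (mu nu : probability E R) (K : nat).
Implicit Types (f g : E -> R) (w : E).

Definition monomial k (idx : 'I_k -> 'I_p) (x : E) : R := \prod_(l < k) x (idx l) 0.

Definition same_integral f := [/\ mu.-integrable setT (EFin \o f),
  nu.-integrable setT (EFin \o f) & (\int[mu]_x (f x)%:E = \int[nu]_x (f x)%:E)%E].

Hypothesis same_moments : forall k (idx : 'I_k -> 'I_p), (k < K)%N ->
  same_integral (monomial idx).

Lemma same_integralD f g : same_integral f -> same_integral g ->
  same_integral (fun x => f x + g x).
Proof.
move=> [f1 f2 fe] [g1 g2 ge]; split.
- exact: integrableD f1 g1.
- exact: integrableD f2 g2.
- under eq_integral do rewrite EFinD.
  rewrite (integralD _ f1 g1)//; under [RHS]eq_integral do rewrite EFinD.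
  rewrite (integralD _ f2 g2)//; by congr (_ + _)%E.
Qed.

Lemma same_integralZ c f : same_integral f -> same_integral (fun x => c * f x).
Proof.
move=> [f1 f2 fe]; split.
- exact: integrableZl f1.
- exact: integrableZl f2.
- under eq_integral do rewrite EFinM.
  rewrite (integralZl _ f1)//; under [RHS]eq_integral do rewrite EFinM.
  rewrite (integralZl _ f2)//; by congr (_ * _)%E.
Qed.

Lemma same_integral0 : same_integral (fun=> 0).
Proof. by split; [exact: integrable0|exact: integrable0|rewrite !integral0]. Qed.

Lemma same_integral_sum I (s : seq I) (Q : pred I) (F : I -> E -> R) :
  (forall i, Q i -> same_integral (F i)) -> same_integral (fun x => \sum_(i <- s | Q i) F i x).
Proof.
move=> hF; elim: s => [|i s IH].
  by under eq_fun do rewrite big_nil; exact: same_integral0.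
under eq_fun do rewrite big_cons.
by case Qi: (Q i) => //; apply: same_integralD => //; exact: hF.
Qed.

(* [f] behaves as a homogeneous polynomial of degree [k]. *)
Definition polydeg k f := forall d (idx : 'I_d -> 'I_p), (k + d < K)%N ->
  same_integral (fun x => f x * monomial idx x).

Lemma polydeg_cst c : polydeg 0 (fun=> c).
Proof. by move=> d idx dK; apply: same_integralZ; exact: same_moments. Qed.

Lemma polydegZ k c f : polydeg k f -> polydeg k (fun x => c * f x).
Proof.
move=> hf d idx dK; under eq_fun do rewrite -mulrA.
by apply: same_integralZ; exact: hf.
Qed.

Lemma polydeg_sum k I (s : seq I) (F : I -> E -> R) :
  (forall i, polydeg k (F i)) -> polydeg k (fun x => \sum_(i <- s) F i x).
Proof.
move=> hF d idx dK; under eq_fun do rewrite mulr_suml.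
by apply: same_integral_sum => i _; exact: hF.
Qed.

(** The extra coordinate is absorbed into the test monomial as one more index; this is why [polydeg]
    quantifies over all monomials of complementary degree. *)
Lemma polydeg_coord k f j : polydeg k f -> polydeg k.+1 (fun x => x j 0 * f x).
Proof.
move=> hf d idx dK; pose idx' (l : 'I_d.+1) := oapp idx j (unlift ord0 l).
have := hf d.+1 idx'; rewrite addnS -addSn => /(_ dK).
congr same_integral; apply/funext => x.
rewrite /monomial big_ord_recl /idx' unlift_none /= mulrCA mulrA; congr (_ * _).
by apply: eq_bigr => l _; rewrite liftK.
Qed.

Lemma polydeg_dotv k f w i : polydeg k f -> polydeg (k + i) (fun x => dotv x w ^+ i * f x).
Proof.
move=> hf; elim: i => [|i IH].
  by rewrite addn0; under eq_fun do rewrite expr0 mul1r.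
rewrite addnS; under eq_fun do rewrite exprS -mulrA /dotv mulr_suml.
apply: polydeg_sum => j; under eq_fun do rewrite mulrAC mulrC.
by apply: polydegZ; apply: polydeg_coord.
Qed.

Lemma polydeg_sqn k f l : polydeg k f -> polydeg (k + 2 * l) (fun x => sqn x ^+ l * f x).
Proof.
move=> hf; elim: l => [|l IH].
  by rewrite muln0 addn0; under eq_fun do rewrite expr0 mul1r.
rewrite mulnS addnCA; under eq_fun do rewrite exprS -mulrA /sqn /dotv mulr_suml.
apply: polydeg_sum => j; under eq_fun do rewrite -mulrA.
by do 2 apply: polydeg_coord.
Qed.

Lemma same_integral_polydeg k f : (k < K)%N -> polydeg k f -> same_integral f.
Proof.
move=> kK hf; have := hf 0 (fun i => False_rect _ (notF (ltn_ord i))).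
rewrite addn0 => /(_ kK); congr same_integral; apply/funext => x.
by rewrite /monomial big_ord0 mulr1.
Qed.

(** As a function of [x], the term of indices [i], [l] is homogeneous of degree [i + 2 l < K], a
    degree in which the moments agree. *)
Lemma same_integral_hermtrunc s w :
  same_integral (fun x => hermtrunc K (dotv (s *: x) w) (sqn (s *: x) / 2)).
Proof.
apply: same_integral_sum => i _; apply: same_integral_sum => l il.
apply: (same_integral_polydeg il).
have := polydeg_cst (s ^+ i / i`!%:R * ((- (s ^+ 2 / 2)) ^+ l / l`!%:R)).
move=> /(polydeg_dotv w (i := i)) /(polydeg_sqn (l := l)); rewrite add0n.
congr polydeg; apply/funext => x; rewrite /exp_coeff /= dotvZl sqnZ.
have -> : - (s ^+ 2 * sqn x / 2) = - (s ^+ 2 / 2) * sqn x by ring.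
by rewrite (exprMn _ s) (exprMn _ (- _)); ring.
Qed.

End moments.

(** * Exchanging one summand under Gaussian smoothing *)

Section one_step.
Context {R : realType} {p : nat}.
Notation E := 'cV[R]_p.
Notation gamma := (@gauss R p).
Variables (mu nu : probability E R) (K : nat) (s : R).
Implicit Types (f g : E -> R) (w : E) (lam : probability E R).
Hypotheses (s0 : 0 < s) (K0 : (0 < K)%N).
Hypothesis same_moments : forall k (idx : 'I_k -> 'I_p), (k < K)%N ->
  same_integral mu nu (monomial idx).

(** Once the Cameron-Martin formula has removed [x] from the argument of the test function, the law
    [lam] enters only through this averaged density. *)
Let J lam w : \bar R := (\int[lam]_x (cmd (s^-1 *: x) w)%:E)%E.

Let r lam w : \bar R := (\int[lam]_x (`|cmrem K (s^-1 *: x) w|)%:E)%E.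

Let mcmd : measurable_fun setT (fun z : E * E => (cmd (s^-1 *: z.2) z.1)%:E).
Proof.
by apply/measurable_EFinP; apply: measurable_cmd => //; exact: measurable_cVZ.
Qed.

Let mrem : measurable_fun setT (fun z : E * E => (`|cmrem K (s^-1 *: z.2) z.1|)%:E).
Proof.
apply/measurable_EFinP; apply: measurableT_comp => //.
by apply: measurable_cmrem => //; exact: measurable_cVZ.
Qed.

Let J_ge0 lam w : (0 <= J lam w)%E.
Proof. by apply: integral_ge0 => x _; rewrite lee_fin cmd_ge0. Qed.

Let r_ge0 lam w : (0 <= r lam w)%E.
Proof. by apply: integral_ge0 => x _; rewrite lee_fin. Qed.

Let mJ lam : measurable_fun setT (J lam).
Proof.
apply: (@measurable_integral2 _ _ _ _ _ lam (fun w x => (cmd (s^-1 *: x) w)%:E)) => //.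
by move=> w x; rewrite lee_fin cmd_ge0.
Qed.

Let mr lam : measurable_fun setT (r lam).
Proof.
by apply: (@measurable_integral2 _ _ _ _ _ lam (fun w x => (`|cmrem K (s^-1 *: x) w|)%:E)).
Qed.

Let mr2 (Q : probability E R) :
  measurable_fun setT (fun x : E => \int[Q]_w (`|cmrem K (s^-1 *: x) w|)%:E)%E.
Proof.
apply: (@measurable_integral2 _ _ _ _ _ Q (fun (x : E) w => (`|cmrem K (s^-1 *: x) w|)%:E)) => //.
apply/measurable_EFinP; apply: measurableT_comp => //.
by apply: measurable_cmrem => //; exact: measurable_cVZ.
Qed.

Let integral_gs lam (F : E -> \bar R) : nnmeas F ->
  (\int[lam]_x gs s F x = \int[gamma]_w (F (s *: w) * J lam w))%E.
Proof.
move=> [mF F0].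
transitivity (\int[lam]_x \int[gamma]_w (F (s *: w) * (cmd (s^-1 *: x) w)%:E))%E.
  apply: eq_integral => x _.
  apply: etrans (ge0_integral_gauss_shift (s^-1 *: x) (f := fun w => F (s *: w)) _ _).
  - apply: eq_integral => w _; by rewrite scalerDr scalerA divff ?gt_eqF// scale1r addrC.
  - apply: (measurableT_comp mF); exact: measurable_cVZ.
  - by move=> w; exact: F0.
apply: etrans (@integral_swap_probability _ _ lam gamma
  (fun x w => F (s *: w) * (cmd (s^-1 *: x) w)%:E)%E _ _) _.
- apply: emeasurable_funM.
    by apply: (measurableT_comp mF); exact: measurable_cVZ.
  by apply/measurable_EFinP; apply: measurable_cmd => //; exact: measurable_cVZ.
- by move=> x w; rewrite mule_ge0// lee_fin cmd_ge0.
- apply: eq_integral => w _; apply: ge0_integralZl => //.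
  + by apply/measurable_EFinP; apply: measurable_cmd => //; exact: measurable_cVZ.
  + by move=> x _; rewrite lee_fin cmd_ge0.
Qed.

Let integral_r lam (M : R) : (\int[lam]_x (enorm x ^+ K)%:E <= M%:E)%E ->
  (\int[gamma]_w r lam w <= (cmremC K * s ^- K * M)%:E)%E.
Proof.
move=> hM; have C1 := @cmremC_ge1 R K.
rewrite -(@integral_swap_probability _ _ lam gamma
  (fun x w => (`|cmrem K (s^-1 *: x) w|)%:E)); last 2 first.
- apply/measurable_EFinP; apply: measurableT_comp => //.
  by apply: measurable_cmrem => //; exact: measurable_cVZ.
- by move=> x w; rewrite lee_fin.
apply: (@le_trans _ _ (\int[lam]_x ((cmremC K * s ^- K)%:E * (enorm x ^+ K)%:E))%E).
  apply: ge0_le_integralT.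
  - exact: mr2.
  - apply: emeasurable_funM => //; apply/measurable_EFinP; apply: measurable_funX.
    exact: measurable_enorm.
  - by move=> x; apply: integral_ge0 => w _; rewrite lee_fin.
  - move=> x; apply: le_trans (integral_cmrem_le _ K0) _.
    rewrite -EFinM lee_fin enormZ exprMn gtr0_norm ?invr_gt0// exprVn mulrA.
    exact: lexx.
have c0 : 0 <= cmremC K * s ^- K.
  by rewrite mulr_ge0 ?invr_ge0 ?exprn_ge0 ?(ltW s0)//; lra.
rewrite ge0_integralZl//; last 2 first.
- by apply/measurable_EFinP; apply: measurable_funX; exact: measurable_enorm.
- by move=> x _; rewrite lee_fin exprn_ge0// enorm_ge0.
by rewrite [leRHS]EFinM lee_wpmul2l// lee_fin.
Qed.

(** The polynomial parts of the two averaged densities coincide, so they differ by at most the two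
    remainders. The infinite alternative makes the statement hold at every [w], not merely almost
    everywhere. *)
Let JrP w : r mu w + r nu w = +oo%E \/ exists a b c : R,
  [/\ J mu w = a%:E, J nu w = b%:E, (r mu w + r nu w)%E = c%:E & `|a - b| <= c].
Proof.
have [rN|] := boolP (r mu w + r nu w < +oo)%E; last by rewrite -leNgt leye_eq => /eqP; left.
right.
have [Tmu Tnu Te] := same_integral_hermtrunc same_moments s^-1 w.
have mR : measurable_fun setT (fun x : E => cmrem K (s^-1 *: x) w).
  by apply: measurable_cmrem => //; exact: measurable_cVZ.
have rf lam : (r lam w < +oo)%E -> lam.-integrable setT (EFin \o (fun x => cmrem K (s^-1 *: x) w)).
  by move=> h; apply/integrableP; split => //; exact/measurable_EFinP.
have rmu : (r mu w < +oo)%E by apply: le_lt_trans rN; rewrite leeDl.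
have rnu : (r nu w < +oo)%E by apply: le_lt_trans rN; rewrite leeDr.
pose H x := hermtrunc K (dotv (s^-1 *: x) w) (sqn (s^-1 *: x) / 2).
have Jd lam : lam.-integrable setT (EFin \o H) ->
  (r lam w < +oo)%E -> exists t u v : R,
  [/\ J lam w = (t + u)%:E, (\int[lam]_x (H x)%:E)%E = t%:E,
  r lam w = v%:E & `|u| <= v].
  move=> hT hr.
  have fT := integrable_fin_num measurableT hT.
  have fR := integrable_fin_num measurableT (rf lam hr).
  exists (fine (\int[lam]_x (H x)%:E)%E).
  exists (fine (\int[lam]_x (cmrem K (s^-1 *: x) w)%:E)%E), (fine (r lam w)).
  have fr : r lam w \is a fin_num by rewrite ge0_fin_numE.
  split; rewrite ?fineK//.
    rewrite EFinD !fineK// -(integralD measurableT hT (rf lam hr)); apply: eq_integral => x _.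
    by rewrite /= -EFinD /cmrem addrC subrK.
  rewrite -lee_fin fineK// -abse_EFin fineK//.
  apply: le_trans (le_abse_integral _ _ _) _ => //; exact/measurable_EFinP.
have [t [u [v [J1 T1 r1 u1]]]] := Jd mu Tmu rmu.
have [t' [u' [v' [J2 T2 r2 u2]]]] := Jd nu Tnu rnu.
exists (t + u), (t' + u'), (v + v'); split => //; first by rewrite r1 r2.
have -> : t' = t by apply: EFin_inj; rewrite -T1 -T2.
have -> : t + u - (t + u') = u - u' by ring.
by apply: le_trans (ler_normB _ _) _; exact: lerD.
Qed.

(** Equivalent to bounding the integral of [(F - G) (J mu - J nu)]; the terms are distributed over
    both sides so that nothing is subtracted in the extended reals. *)
Lemma one_step_le (F G : E -> R) (D Mmu Mnu : R) :
  measurable_fun setT F -> measurable_fun setT G -> (forall x, 0 <= F x) -> (forall x, 0 <= G x) ->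
  (forall x, `|F x - G x| <= D) ->
  (\int[mu]_x (enorm x ^+ K)%:E <= Mmu%:E)%E -> (\int[nu]_x (enorm x ^+ K)%:E <= Mnu%:E)%E ->
  (\int[mu]_x gs s (EFin \o F) x + \int[nu]_x gs s (EFin \o G) x <=
   \int[nu]_x gs s (EFin \o F) x + \int[mu]_x gs s (EFin \o G) x +
   (D * (cmremC K * s ^- K * (Mmu + Mnu)))%:E)%E.
Proof.
move=> mF mG F0 G0 FG hmu hnu.
have D0 : 0 <= D by apply: le_trans (FG 0); exact: normr_ge0.
have nF : nnmeas (EFin \o F).
  by split; [exact/measurable_EFinP|move=> x; rewrite lee_fin].
have nG : nnmeas (EFin \o G).
  by split; [exact/measurable_EFinP|move=> x; rewrite lee_fin].
rewrite !integral_gs//.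
have mFs (H : E -> R) lam : measurable_fun setT H ->
    measurable_fun setT (fun w => (H (s *: w))%:E * J lam w)%E.
  move=> mH; apply: emeasurable_funM => //; apply/measurable_EFinP.
  by apply: (measurableT_comp mH); exact: measurable_cVZ.
have pFs (H : E -> R) lam w : (forall x, 0 <= H x) -> (0 <= (H (s *: w))%:E * J lam w)%E.
  by move=> H0; rewrite mule_ge0 ?lee_fin.
rewrite -!ge0_integralD//; try (by move=> w _; exact: pFs); try exact: mFs.
have mrr : measurable_fun setT (fun w => r mu w + r nu w)%E by exact: emeasurable_funD.
have rr0 w : (0 <= r mu w + r nu w)%E by rewrite adde_ge0.
apply: (@le_trans _ _ (\int[gamma]_w (((F (s *: w))%:E * J nu w + (G (s *: w))%:E * J mu w) +
   D%:E * (r mu w + r nu w)))%E).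
  apply: ge0_le_integralT.
  - by apply: emeasurable_funD; exact: mFs.
  - apply: emeasurable_funD; first by apply: emeasurable_funD; exact: mFs.
    exact: emeasurable_funM.
  - by move=> w; rewrite adde_ge0 ?pFs.
  - move=> w; case: (JrP w) => [->|[a [b [c [-> -> -> ab]]]]].
      (* Where the remainder is infinite the right side is infinite too, except when [D = 0]; in
         that case [F = G] and the two sides agree. *)
      move: D0; rewrite le_eqVlt => /predU1P[D00|Dp].
        have -> : F = G.
          by apply/funext => x; apply/eqP; rewrite -subr_eq0 -normr_le0 (le_trans (FG x))// -D00.
        by rewrite -D00 mul0e adde0 addeC.
      rewrite gt0_muley ?lte_fin// addey ?leey//.
      by rewrite -ltNye; apply: lt_le_trans (adde_ge0 (pFs _ _ _ F0) (pFs _ _ _ G0)); exact: ltNyr.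
    rewrite -!EFinM -!EFinD lee_fin.
    have := FG (s *: w); move: (F _) (G _) => f g fg.
    have h : (f - g) * (a - b) <= D * c.
      by apply: le_trans (ler_norm _) _; rewrite normrM; apply: ler_pM.
    rewrite -subr_ge0 (_ : _ - _ = D * c - (f - g) * (a - b)); last by ring.
    by rewrite subr_ge0.
rewrite [leLHS]ge0_integralD//; last 4 first.
- by move=> w _; rewrite adde_ge0 ?pFs.
- by apply: emeasurable_funD; exact: mFs.
- by move=> w _; rewrite mule_ge0 ?lee_fin.
- exact: emeasurable_funM.
apply: leeD => //; rewrite ge0_integralZl//.
rewrite EFinM lee_wpmul2l ?lee_fin// ge0_integralD// mulrDr EFinD.
by apply: leeD; exact: integral_r.
Qed.

End one_step.

(** * Convolution powers *)

Section convolution_power.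
Context {R : realType} {p : nat}.
Notation E := 'cV[R]_p.
Implicit Types (mu : probability E R) (f : E -> \bar R).
Local Open Scope ereal_scope.

Definition addv_pair (z : E * E) : E := (z.1 + z.2)%R.

Let measurable_addv_pair : measurable_fun setT addv_pair.
Proof. exact: measurable_cVD. Qed.

HB.instance Definition _ := isMeasurableFun.Build _ _ _ _ _ measurable_addv_pair.

Fixpoint lawn mu (m : nat) : probability E R :=
  match m with
  | 0 => \d_(0%R : E)
  | m.+1 => distribution (mu \x lawn mu m) addv_pair
  end.

Lemma cv_lawn0 mu f : nnmeas f -> cv (lawn mu 0) f = f.
Proof.
move=> hf; have [mf f0] := hf; apply/funext => x; rewrite /cv.
have [mfx _] := nnmeas_shift x hf.
rewrite integral_dirac//= ?diracT ?mul1e ?addr0//.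
by under eq_fun do rewrite addrC.
Qed.

Lemma ge0_integral_addv mu (Q : probability E R) f : nnmeas f ->
  \int[distribution (mu \x Q) addv_pair]_x f x = \int[mu]_x \int[Q]_y f (x + y)%R.
Proof.
move=> [mf f0]; rewrite ge0_integral_distribution// fubini_tonelli1//=.
by apply: measurableT_comp => //; exact: measurable_addv_pair.
Qed.

Lemma cv_lawnS mu m f : nnmeas f -> cv (lawn mu m.+1) f = cv mu (cv (lawn mu m) f).
Proof.
move=> [mf f0]; apply/funext => x; rewrite /cv.
have nfx : nnmeas (fun y => f (x + y)%R).
  by split => [|y]; [apply: (measurableT_comp mf); exact: measurable_cVD|exact: f0].
apply: etrans (ge0_integral_addv mu (lawn mu m) nfx) _.
by apply: eq_integral => y _; apply: eq_integral => z _; rewrite addrA.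
Qed.

Lemma cv_leD mu f g (D : R) x : nnmeas f -> nnmeas g -> (0 <= D)%R ->
  (forall y, f y <= g y + D%:E) -> cv mu f x <= cv mu g x + D%:E.
Proof.
move=> [mf f0] [mg g0] D0 fg.
have mx (h : E -> \bar R) : measurable_fun setT h -> measurable_fun setT (fun y : E => h (x + y)%R).
  by move=> mh; apply: (measurableT_comp mh); exact: measurable_cVD.
rewrite -[X in _ + X](integral_cst_probability mu) /cv.
rewrite -ge0_integralD//; [|exact: mx].
apply: ge0_le_integralT => //; first exact: mx.
by apply: emeasurable_funD => //; exact: mx.
Qed.

Lemma cv_origin mu f : cv mu f 0%R = \int[mu]_x f x.
Proof. by apply: eq_integral => x _; rewrite add0r. Qed.

Lemma gs_indic_sqball (s : R) c u y : (0 < s)%R -> gs s (EFin \o \1_(sqball c u)) y =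
  (prb (gauss p) (sqball (s^-1 *: (c - y)) (u / s ^+ 2)))%:E.
Proof.
move=> s0; rewrite prb_indic; last exact: measurable_sqball.
apply: eq_integral => g _; congr (_%:E); rewrite /= !indicE; congr (nat_of_bool _)%:R.
have e : (y + s *: g - c = s *: (g - s^-1 *: (c - y)))%R.
  by rewrite scalerBr scalerA divff ?gt_eqF// scale1r opprB addrCA addrA.
by apply/idP/idP; rewrite !inE /sqball /= e sqnZ ler_pdivlMr ?exprn_gt0// mulrC.
Qed.

End convolution_power.

(** * Lindeberg telescoping *)

Section lindeberg.
Context {R : realType} {p : nat}.
Notation E := 'cV[R]_p.
Notation gamma := (@gauss R p).
Variables (mu nu rho : probability E R) (K : nat) (sigma Mmu Mnu : R).
Implicit Types (f : E -> \bar R) (lam : probability E R) (c : E).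
Hypotheses (sigma0 : 0 < sigma) (K0 : (0 < K)%N).
Hypothesis same_moments : forall k (idx : 'I_k -> 'I_p), (k < K)%N ->
  same_integral mu nu (monomial idx).
Hypothesis nuE : forall f, nnmeas f -> cv nu f = gs sigma (cv rho f).
Hypotheses (hmu : (\int[mu]_x (enorm x ^+ K)%:E <= Mmu%:E)%E)
  (hnu : (\int[nu]_x (enorm x ^+ K)%:E <= Mnu%:E)%E).

(** Scale of the Gaussian noise available when the smoothing [eps] is joined by the Gaussian
    components of [k] summands of law [nu]. *)
Definition gscale (eps : R) (k : nat) : R := Num.sqrt (eps ^+ 2 + k%:R * sigma ^+ 2).

Lemma gscale_gt0 eps k : 0 < eps -> 0 < gscale eps k.
Proof.
move=> e0; rewrite sqrtr_gt0 ltr_wpDr ?exprn_gt0//.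
by rewrite mulr_ge0// sqr_ge0.
Qed.

Lemma gscale_sqr eps k : gscale eps k ^+ 2 = eps ^+ 2 + k%:R * sigma ^+ 2.
Proof. rewrite /gscale sqr_sqrtr//; apply: addr_ge0; first exact: sqr_ge0.
by apply: mulr_ge0 => //; exact: sqr_ge0. Qed.

Lemma cv_lawn_gs eps k f : 0 < eps -> nnmeas f ->
  cv (lawn nu k) (gs eps f) = gs (gscale eps k) (cv (lawn rho k) f).
Proof.
move=> e0 hf; elim: k => [|k IH].
  rewrite !cv_lawn0//; last exact: nnmeas_gs.
  by rewrite /gscale mul0r addr0 sqrtr_sqr gtr0_norm.
have hk := nnmeas_cv (lawn rho k) hf.
rewrite cv_lawnS; last exact: nnmeas_gs.
rewrite IH nuE; last exact: nnmeas_gs.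
rewrite (cv_gs rho _ hk) -(cv_lawnS rho k hf) (gs_gs _ sigma0 (nnmeas_cv _ hf)).
apply: (congr1 (fun r => gs r _)); rewrite gscale_sqr /gscale; congr Num.sqrt; rewrite mulrSr; ring.
Qed.

Lemma nnmeas_le1_fine f : nnmeas f -> (forall x, f x <= 1)%E -> exists F : E -> R,
  [/\ f = EFin \o F, measurable_fun setT F & forall x, 0 <= F x <= 1].
Proof.
move=> [mf f0] f1; have fE x : (fine (f x))%:E = f x.
  by rewrite fineK// ge0_fin_numE// (le_lt_trans (f1 x))// ltry.
exists (fine \o f); split; first by apply/funext => x; rewrite /= fE.
  by apply/measurable_EFinP; congr measurable_fun: mf; apply/funext => x; rewrite /= fE.
by move=> x; rewrite -!lee_fin fE f0 f1.
Qed.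

Lemma gs_fin_num lam (s : R) (F : E -> R) : measurable_fun setT F -> (forall x, 0 <= F x <= 1) ->
  (\int[lam]_x gs s (EFin \o F) x)%E \is a fin_num.
Proof.
move=> mF F01.
have nF : nnmeas (EFin \o F).
  by split; [exact/measurable_EFinP|move=> x; rewrite lee_fin; have /andP[] := F01 x].
have [mg g0] := nnmeas_gs s nF.
rewrite ge0_fin_numE; last exact: integral_ge0.
apply: (@le_lt_trans _ _ 1%E); last exact: ltry.
rewrite -[leRHS](integral_cst_probability lam); apply: ge0_le_integralT => // x.
rewrite -[leRHS](integral_cst_probability gamma); apply: ge0_le_integralT => //.
- apply/measurable_EFinP; apply: (measurableT_comp mF).
  by apply: measurable_cVD => //; exact: measurable_cVZ.
- by move=> y; rewrite lee_fin; have /andP[] := F01 (x + s *: y).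
- by move=> y; rewrite lee_fin; have /andP[] := F01 (x + s *: y).
Qed.

Let I lam s (F : E -> R) : R := fine (\int[lam]_x gs s (EFin \o F) x)%E.

Let cost (s : R) : R := cmremC K * s ^- K * (Mmu + Mnu).

Let ler_norm4 (a b c' d e : R) : a + d <= b + c' + e -> c' + b <= d + a + e ->
  `|(a - b) - (c' - d)| <= e.
Proof. by move=> h1 h2; rewrite ler_norml; apply/andP; split; lra. Qed.

Let one_step_norm s (F G : E -> R) (D : R) : 0 < s ->
  measurable_fun setT F -> measurable_fun setT G ->
  (forall x, 0 <= F x <= 1) -> (forall x, 0 <= G x <= 1) -> (forall x, `|F x - G x| <= D) ->
  `|(I mu s F - I nu s F) - (I mu s G - I nu s G)| <= D * cost s.
Proof.
move=> s0 mF mG F01 G01 FG.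
have F0 x : 0 <= F x by have /andP[] := F01 x.
have G0 x : 0 <= G x by have /andP[] := G01 x.
have GF x : `|G x - F x| <= D by rewrite distrC.
have := one_step_le s0 K0 same_moments mG mF G0 F0 GF hmu hnu.
have := one_step_le s0 K0 same_moments mF mG F0 G0 FG hmu hnu.
have IE lam (H : E -> R) : measurable_fun setT H -> (forall x, 0 <= H x <= 1) ->
    (\int[lam]_x gs s (EFin \o H) x)%E = (I lam s H)%:E.
  by move=> mH H01; rewrite fineK//; exact: gs_fin_num.
rewrite (IE mu F mF F01) (IE nu F mF F01) (IE mu G mG G01) (IE nu G mG G01).
move: (I mu s F) (I nu s F) (I mu s G) (I nu s G) => a b c' d.
rewrite -/(cost s); move: (cost s) => e; rewrite -!EFinD !lee_fin => h1 h2; exact: ler_norm4.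
Qed.

Let mixed eps (B : set E) j k : R :=
  fine (cv (lawn mu j) (cv (lawn nu k) (gs eps (EFin \o \1_B))) 0).

(** Swapping inside [F], which contains [j] summands of law [mu], is compared with swapping inside
    [G], where they have law [nu]. The functions differ by at most the discrepancy [D], at noise
    level [k]. For [G] itself the [j] summands add their own Gaussian parts, so the swap is made at
    noise level [j + k]. *)
Let mixed_step eps c u j k (D : R) : 0 < eps ->
  (forall c u, `|prb (lawn mu j) (sqball c u) - prb (lawn nu j) (sqball c u)| <= D) ->
  `|mixed eps (sqball c u) j.+1 k - mixed eps (sqball c u) j k.+1| <=
    D * cost (gscale eps k) + cost (gscale eps (j + k)).
Proof.
move=> e0 hD; set B := sqball c u; have mB : measurable B := measurable_sqball c u.
have nB := nnmeas_indic mB; set b := EFin \o \1_B in nB *.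
have b1 x : (b x <= 1)%E by rewrite lee_fin indicE; case: (_ \in _).
pose s := gscale eps k; have s0 : 0 < s := gscale_gt0 k e0.
pose Q := cv (lawn rho k) b; have nQ : nnmeas Q by exact: nnmeas_cv.
have Q1 := @cv_le1 R p (lawn rho k) b nB b1; rewrite -/Q in Q1.
have [F [FE mF F01]] :=
  nnmeas_le1_fine (nnmeas_cv (lawn mu j) nQ) (@cv_le1 R p (lawn mu j) Q nQ Q1).
have [G [GE mG G01]] :=
  nnmeas_le1_fine (nnmeas_cv (lawn nu j) nQ) (@cv_le1 R p (lawn nu j) Q nQ Q1).
have [H [HE mH H01]] :=
  nnmeas_le1_fine (nnmeas_cv (lawn rho j) nQ) (@cv_le1 R p (lawn rho j) Q nQ Q1).
have e1 : mixed eps B j.+1 k = I mu s F.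
  rewrite /mixed (cv_lawn_gs k e0 nB) -/Q -/s (cv_lawnS mu j (nnmeas_gs s nQ)).
  by rewrite (cv_gs _ s nQ) FE cv_origin.
have e2 : mixed eps B j k.+1 = I nu s F.
  rewrite /mixed (cv_lawnS nu k (nnmeas_gs eps nB)) (cv_lawn_gs k e0 nB) -/Q -/s.
  by rewrite (cv_comm _ nu (nnmeas_gs s nQ)) (cv_gs _ s nQ) FE cv_origin.
have e3 lam : I lam s G = I lam (gscale s j) H.
  by rewrite /I -GE -HE -(cv_gs _ s nQ) (cv_lawn_gs j s0 nQ).
have es : gscale s j = gscale eps (j + k).
  by rewrite /gscale gscale_sqr natrD; congr Num.sqrt; ring.
have FG x : `|F x - G x| <= D.
  have := cv_comm (lawn mu j) (lawn rho k) nB; rewrite -/Q FE => /(congr1 (fun h => h x)) /= FxE.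
  have := cv_comm (lawn nu j) (lawn rho k) nB; rewrite -/Q GE => /(congr1 (fun h => h x)) /= GxE.
  have bE lam y : cv lam b y = (prb lam (sqball (c - y) u))%:E.
    rewrite prb_indic; last exact: measurable_sqball.
    apply: eq_integral => z _; congr (_%:E); rewrite /= !indicE; congr (nat_of_bool _)%:R.
    by apply/idP/idP; rewrite !inE /B /sqball /= opprB addrA [z + y]addrC.
  have le (l1 l2 : probability E R) :
      (forall c u, `|prb l1 (sqball c u) - prb l2 (sqball c u)| <= D) ->
      (cv (lawn rho k) (cv l1 b) x <= cv (lawn rho k) (cv l2 b) x + D%:E)%E.
    move=> h; have D0 : 0 <= D by apply: le_trans (h 0 0); exact: normr_ge0.
    apply: (cv_leD _ _ (nnmeas_cv l1 nB) (nnmeas_cv l2 nB) D0) => y.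
    by rewrite !bE -EFinD lee_fin; have := h (c - y) u; rewrite ler_norml => /andP[_]; lra.
  have hD' c' u' : `|prb (lawn nu j) (sqball c' u') - prb (lawn mu j) (sqball c' u')| <= D.
    by rewrite distrC.
  have := le _ _ hD; have := le _ _ hD'; rewrite -FxE -GxE -!EFinD !lee_fin => h1 h2.
  rewrite ler_norml; apply/andP; split; lra.
have h1 := one_step_norm s0 mF mG F01 G01 FG.
have s1 : 0 < gscale s j := gscale_gt0 j s0.
have z01 (x : E) : 0 <= (0 : R) <= 1 by rewrite lexx ler01.
have H1 x : `|H x - 0| <= 1 by rewrite subr0; have /andP[h0 h] := H01 x; rewrite ger0_norm.
have m0 : measurable_fun setT (fun _ : E => 0 : R) by exact: measurable_cst.
(* The comparison with the zero function, with [D = 1], bounds the swap error of a single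
   function. *)
have h2 := one_step_norm s1 mH m0 H01 z01 H1.
have I0 lam s' : I lam s' (fun=> 0) = 0.
  rewrite /I (_ : (\int[lam]_x _)%E = 0%E)//.
  apply: etrans (integral0 lam setT); apply: eq_integral => x _; exact: integral0.
move: h2; rewrite !I0 subrr subr0 mul1r es => h2.
rewrite e1 e2 -[X in `|X| <= _](subrK (I mu s G - I nu s G)).
by apply: le_trans (ler_normD _ _) (lerD h1 _); rewrite !e3 es.
Qed.

Lemma lindeberg eps c u m (D : nat -> R) : 0 < eps ->
  (forall j, (j < m)%N -> forall c u,
    `|prb (lawn mu j) (sqball c u) - prb (lawn nu j) (sqball c u)| <= D j) ->
  `|smprb eps (lawn mu m) c u - smprb eps (lawn nu m) c u| <=
  cmremC K * (Mmu + Mnu) * (\sum_(0 <= j < m) (D j * gscale eps (m.-1 - j) ^- K) +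
    m%:R * gscale eps m.-1 ^- K).
Proof.
move=> e0 hD; have nB := nnmeas_gs eps (nnmeas_indic (measurable_sqball c u)).
have -> : smprb eps (lawn mu m) c u = mixed eps (sqball c u) m (m - m).
  by rewrite /mixed subnn (cv_lawn0 nu nB) cv_origin.
have -> : smprb eps (lawn nu m) c u = mixed eps (sqball c u) 0 (m - 0).
  by rewrite /mixed subn0 (cv_lawn0 mu (nnmeas_cv _ nB)) cv_origin.
have -> : mixed eps (sqball c u) m (m - m) - mixed eps (sqball c u) 0 (m - 0) =
    \sum_(0 <= j < m) (mixed eps (sqball c u) j.+1 (m - j.+1) - mixed eps (sqball c u) j (m - j)).
  by rewrite (telescope_sumr (fun j => mixed eps (sqball c u) j (m - j))).
apply: le_trans (ler_norm_sum _ _ _) _.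
apply: (@le_trans _ _ (\sum_(0 <= j < m)
    (D j * cost (gscale eps (m.-1 - j)) + cost (gscale eps m.-1)))).
  rewrite big_seq [leRHS]big_seq; apply: ler_sum => j; rewrite mem_index_iota => /andP[_ jm].
  have -> : (m - j = (m.-1 - j).+1)%N by lia.
  have -> : (m - j.+1 = m.-1 - j)%N by lia.
  have := mixed_step c u (m.-1 - j) e0 (hD j jm).
  by rewrite (_ : (j + (m.-1 - j) = m.-1)%N)//; lia.
rewrite big_split /= sumr_const_nat subn0 mulrDr lerD//.
  rewrite mulr_sumr; apply: ler_sum => j _; rewrite /cost le_eqVlt; apply/predU1P; left; ring.
rewrite /cost -mulr_natl le_eqVlt; apply/predU1P; left; ring.
Qed.

(** Conditionally on the other parts, the sum is Gaussian of scale [s]. After rescaling by [s] the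
    shell has the thickness allowed by [gauss_shell] with [delta = eps / s]. *)
Lemma lawn_shell eps L u1 u2 c m : (0 < p)%N -> 0 < eps -> 1 <= L ->
  eps <= gscale sigma m -> u1 <= u2 -> u2 - u1 <= L * eps * Num.sqrt (u2 + p%:R * eps ^+ 2) ->
  prb (lawn nu m.+1) (sqball c u2) - prb (lawn nu m.+1) (sqball c u1) <=
  200 * expR 1 * L ^+ 2 * (eps / gscale sigma m).
Proof.
move=> p0 e0 L1; set s := gscale sigma m => es u12 hu.
have s0 : 0 < s := gscale_gt0 m sigma0.
have lawE A : measurable A -> (prb (lawn nu m.+1) A)%:E =
    (\int[lawn rho m.+1]_y gs s (EFin \o \1_A) y)%E.
  move=> mA; have nA := nnmeas_indic mA; rewrite prb_indic// -cv_origin -[RHS]cv_origin.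
  rewrite -/(EFin \o \1_A) (cv_lawnS nu m nA) (cv_comm nu _ nA) (nuE nA).
  (* The Gaussian part of one summand, of scale [sigma], takes the place of the smoothing; this is
     why [m.+1] summands give [gscale sigma m]. *)
  rewrite (cv_lawn_gs m sigma0 (nnmeas_cv rho nA)) (cv_comm _ rho nA) -(cv_lawnS rho m nA).
  by rewrite (cv_gs _ _ nA).
have gsE u y := gs_indic_sqball c u y s0.
rewrite lerBlDr -lee_fin EFinD !lawE; try exact: measurable_sqball.
set q := 200 * _ * _ * _; have q0 : 0 <= q.
  apply: mulr_ge0; last by rewrite divr_ge0// ltW.
  by rewrite mulr_ge0 ?sqr_ge0// mulr_ge0// expR_ge0.
have [m1 g1] := nnmeas_gs s (nnmeas_indic (measurable_sqball c u1)).
have [m2 g2] := nnmeas_gs s (nnmeas_indic (measurable_sqball c u2)).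
rewrite -[X in (_ <= X + _)%E](integral_cst_probability (lawn rho m.+1)) -ge0_integralD//.
apply: ge0_le_integralT => //; first exact: emeasurable_funD.
move=> y; rewrite !gsE -EFinD lee_fin -lerBlDr.
apply: gauss_shell => //.
- by rewrite divr_gt0//= ler_pdivrMr// mul1r.
- by rewrite ler_pM2r// invr_gt0 exprn_gt0.
- rewrite -mulrBl ler_pdivrMr ?exprn_gt0//; apply: (le_trans hu).
  have -> : u2 / s ^+ 2 + p%:R * (eps / s) ^+ 2 = s^-1 ^+ 2 * (u2 + p%:R * eps ^+ 2).
    by rewrite exprMn mulrC exprVn; ring.
  rewrite sqrtrM ?sqr_ge0// sqrtr_sqr gtr0_norm ?invr_gt0//.
  by rewrite le_eqVlt; apply/predU1P; left; field; exact: lt0r_neq0.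
Qed.

End lindeberg.

(** * Numerical inequalities *)

Section numerics.
Context {R : realType}.

(** Discrete version of the antiderivative [(2 / N) sqrt (x / (N - x))] of
    [x^(-1/2) (N - x)^(-3/2)]. The factor [4] instead of [2] pays for the discretization, through
    [N - m <= 2 (N - m - 1)]. *)
Lemma sum_sqrt_le (N : R) (m : nat) : m%:R + 1 <= N ->
  \sum_(0 <= j < m) (Num.sqrt j.+1%:R)^-1 * Num.sqrt (N - j.+1%:R) ^- 3 <=
  4 / N * (Num.sqrt m%:R / Num.sqrt (N - m%:R)).
Proof.
elim: m => [|m IH] hN.
  by rewrite big_geq// sqrtr0 mul0r mulr0.
rewrite big_nat_recr//=; move: hN; rewrite -natr1 => hN.
have m0 : 0 <= m%:R :> R by [].
have hN' : m%:R + 1 <= N by lra.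
apply: le_trans (lerD (IH hN') (lexx _)) _.
rewrite -lerBrDl -mulrBr.
set a := Num.sqrt (m%:R + 1); set a' := Num.sqrt m%:R.
set d := Num.sqrt (N - (m%:R + 1)); set d' := Num.sqrt (N - m%:R).
have a2 : a ^+ 2 = m%:R + 1 by rewrite sqr_sqrtr//; lra.
have a'2 : a' ^+ 2 = m%:R by rewrite sqr_sqrtr//; lra.
have d2 : d ^+ 2 = N - (m%:R + 1) by rewrite sqr_sqrtr//; lra.
have d'2 : d' ^+ 2 = N - m%:R by rewrite sqr_sqrtr//; lra.
have a0 : 0 < a by rewrite sqrtr_gt0; lra.
have a'0 : 0 <= a' by exact: sqrtr_ge0.
have d0 : 0 < d by rewrite sqrtr_gt0; lra.
have d'0 : 0 < d' by rewrite sqrtr_gt0; lra.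
have N0 : 0 < N by lra.
have NE : N = a ^+ 2 + d ^+ 2 by rewrite a2 d2; ring.
have dd : d' ^+ 2 <= 2 * d ^+ 2 by rewrite d2 d'2; lra.
have aa : a' <= a by rewrite ler_sqrt; lra.
have d'E : d' ^+ 2 = d ^+ 2 + 1 by rewrite d2 d'2; ring.
have dd' : d <= d' by rewrite -(@ler_pXn2r _ 2)// ?nnegrE ?ltW//; lra.
have a'E : a' ^+ 2 = a ^+ 2 - 1 by rewrite a2 a'2; ring.
clear a2 a'2 d2 d'2 IH hN hN' m0; move: a a' d d' a0 a'0 d0 d'0 NE dd aa d'E dd' a'E.
clear m => a a' d d' a0 a'0 d0 d'0 NE dd aa d'E dd' a'E.
have xy : a' / d' <= a / d.
  by apply: ler_pM => //; [rewrite invr_ge0 ltW|rewrite lef_pV2].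
have y0 : 0 <= a' / d' by rewrite divr_ge0// ltW.
(* The increment of [sqrt (x / (N - x))] is reached through that of [x / (N - x)], a difference of
   squares that simplifies to [N / (d^2 (d^2 + 1))]. *)
have key : N / (2 * d ^+ 4) <= (a / d - a' / d') * (2 * (a / d)).
  apply: (@le_trans _ _ ((a / d - a' / d') * (a / d + a' / d'))); last first.
    by rewrite ler_wpM2l ?subr_ge0//; lra.
  rewrite -subr_sqr !exprMn !exprVn d'E a'E.
  have -> : a ^+ 2 / d ^+ 2 - (a ^+ 2 - 1) / (d ^+ 2 + 1) = N / (d ^+ 2 * (d ^+ 2 + 1)).
    have d1n : d ^+ 2 + 1 != 0 by rewrite -d'E lt0r_neq0// exprn_gt0.
    by rewrite NE; field; rewrite d1n lt0r_neq0.
  rewrite ler_wpM2l ?(ltW N0)// lef_pV2 ?posrE; last 2 first.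
  - by rewrite mulr_gt0// exprn_gt0.
  - by rewrite -d'E mulr_gt0// exprn_gt0.
  rewrite -d'E (_ : 2 * d ^+ 4 = d ^+ 2 * (2 * d ^+ 2)); last by ring.
  by rewrite ler_pM2l// exprn_gt0.
have -> : a^-1 / d ^+ 3 = 4 / N * ((N / (2 * d ^+ 4)) * (d / (2 * a))).
  by field; rewrite !lt0r_neq0.
rewrite ler_pM2l ?divr_gt0//.
have -> : a / d - a' / d' = (a / d - a' / d') * (2 * (a / d)) * (d / (2 * a)).
  by field; rewrite !lt0r_neq0.
by rewrite ler_wpM2r// divr_ge0 ?mulr_ge0// ltW.
Qed.

(** Apply the hypothesis with [D] the supremum of [f], which is finite because [f <= 1], and absorb
    the third. It is used for the discrepancy as a function of center and squared radius. *)
Lemma sup_contraction (T : Type) (f : T -> R) (a : R) : (forall x, 0 <= f x <= 1) ->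
  (forall D, (forall x, f x <= D) -> forall x, f x <= a + D / 3) ->
  forall x, f x <= 3 / 2 * a.
Proof.
move=> f01 hf x; pose S := range f.
have ubS : has_ubound S by exists 1 => _ [y _ <-]; have /andP[] := f01 y.
have fS y : f y <= sup S by apply: ub_le_sup => //; exists y.
have : sup S <= a + sup S / 3.
  by apply: ge_sup; [exists (f x), x|move=> _ [y _ <-]; exact: hf].
by have := fS x; lra.
Qed.

(** The left side is [(th / r)^(K-3)] times the right side; this reduces every [K] to the decay of
    the third moment case. *)
Lemma exprn_ratio_le (th r : R) (K : nat) : (2 < K)%N -> 0 < th -> th <= r ->
  th ^+ (K - 2) * r ^- K <= th * r ^- 3.
Proof.
move=> K3 th0 thr; have r0 : 0 < r := lt_le_trans th0 thr.
have [k ->] : exists k, K = k.+3 by exists (K - 3)%N; lia.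
rewrite (_ : (k.+3 - 2 = k.+1)%N); last by lia.
rewrite exprS -mulrA ler_pM2l// (_ : k.+3 = (k + 3)%N); last by lia.
rewrite exprD invfM mulrA ler_piMl ?invr_ge0 ?exprn_ge0 ?(ltW r0)//.
by rewrite ler_pdivrMr ?exprn_gt0// mul1r lerXn2r// nnegrE ltW.
Qed.

End numerics.

(** * The constants of the recursion *)

Section constants.
Context {R : realType}.
Variables (K : nat) (th0 : R).
Hypothesis th0_gt0 : 0 < th0.

Definition shellC : R := 200 * expR 1 * (2 * chebA) ^+ 2.

(** Smoothing width in units of [sigma * theta]. The first term makes the recursion contract, the
    second ensures [tau >= 1] as soon as [theta >= th0]. *)
Definition smoothM : R := 16 * cmremC K + th0^-1.

(** Fixed point of the recursion: half of it is the returning induction constant, the other half is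
    [3/2] times the shell term plus [2 * cmremC K]. *)
Definition beC : R := 3 * shellC * smoothM + 4 * cmremC K.

Let CK1 : 1 <= cmremC K :> R := @cmremC_ge1 R K.

Lemma chebA_ge1 : 1 <= chebA :> R.
Proof.
have : 1 <= expR (1 / 2) :> R by rewrite -[leLHS]expR0 ler_expR; lra.
by rewrite /chebA; lra.
Qed.

Lemma shellC_ge1 : 1 <= shellC.
Proof.
have e1 : 1 <= expR 1 :> R by rewrite -expR0 ler_expR.
have h : 1 <= (2 * chebA) ^+ 2 :> R by rewrite exprn_ege1//; move: chebA_ge1; lra.
rewrite /shellC; apply: (@le_trans _ _ (1 * 1)); first by rewrite mulr1.
by apply: ler_pM => //; move: e1; lra.
Qed.

Lemma smoothM_ge : 16 * cmremC K <= smoothM.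
Proof. by rewrite /smoothM lerDl invr_ge0 ltW. Qed.

Let smoothM_gt0 : 0 < smoothM.
Proof. by move: CK1 smoothM_ge; lra. Qed.

Lemma beC_gt0 : 0 < beC.
Proof.
rewrite /beC ltr_wpDl//; last by move: CK1; lra.
apply: mulr_ge0 (ltW smoothM_gt0); apply: mulr_ge0 => //.
exact: le_trans ler01 shellC_ge1.
Qed.

End constants.

(** * The recursion on the number of summands *)

Section berry_esseen_recursion.
Context {R : realType} {p : nat}.
Notation E := 'cV[R]_p.
Variables (mu nu rho : probability E R) (K : nat) (sigma Mmu Mnu theta th0 : R).
Implicit Types (f : E -> \bar R) (c : E).
Hypotheses (sigma0 : 0 < sigma) (K3 : (2 < K)%N) (p0 : (0 < p)%N).
Hypothesis same_moments : forall k (idx : 'I_k -> 'I_p), (k < K)%N ->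
  same_integral mu nu (monomial idx).
Hypothesis nuE : forall f, nnmeas f -> cv nu f = gs sigma (cv rho f).
Hypotheses (hmu : (\int[mu]_x (enorm x ^+ K)%:E <= Mmu%:E)%E)
  (hnu : (\int[nu]_x (enorm x ^+ K)%:E <= Mnu%:E)%E).
Hypotheses (th0_gt0 : 0 < th0) (th0_le : th0 <= theta).
Hypothesis theta_ge : sigma ^- K * (Mmu + Mnu) <= theta ^+ (K - 2).

Notation shellC := (@shellC R).
Notation smoothM := (smoothM K th0).
Notation beC := (beC K th0).

Let CK1 : 1 <= cmremC K :> R := @cmremC_ge1 R K.

Let chebA1 : 1 <= chebA :> R := chebA_ge1.

Let shellC1 : 1 <= shellC := shellC_ge1.

Let smoothM1 : 16 * cmremC K <= smoothM := smoothM_ge K th0_gt0.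

Let theta_gt0 : 0 < theta := lt_le_trans th0_gt0 th0_le.

Let tau : R := smoothM * theta.

Let tau1 : 1 <= tau.
Proof.
rewrite /tau /smoothM mulrDl; apply: (@le_trans _ _ (th0^-1 * theta)).
  by rewrite mulrC ler_pdivlMr// mul1r.
by rewrite lerDr !mulr_ge0 ?(ltW theta_gt0)//; move: CK1; lra.
Qed.

Let tau_theta : theta <= tau.
Proof.
rewrite /tau ler_peMl ?(ltW theta_gt0)//; apply: le_trans smoothM1; move: CK1; lra.
Qed.

Let eps : R := sigma * tau.

Let eps0 : 0 < eps.
Proof. by rewrite mulr_gt0// (lt_le_trans ltr01). Qed.

Let rk (k : nat) : R := Num.sqrt (tau ^+ 2 + k%:R).

Let rk_ge k : tau <= rk k.
Proof.
have t0 : 0 <= tau by apply: le_trans tau1.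
by rewrite -[leLHS](ger0_norm t0) -sqrtr_sqr ler_sqrt ?lerDl// addr_ge0 ?sqr_ge0.
Qed.

Let cost_le k : (Mmu + Mnu) * gscale sigma eps k ^- K <= theta * rk k ^- 3.
Proof.
have r0 : 0 < rk k by apply: lt_le_trans (rk_ge k); apply: lt_le_trans tau1.
have -> : gscale sigma eps k = sigma * rk k.
  rewrite /gscale /eps exprMn [k%:R * _]mulrC -mulrDr sqrtrM ?sqr_ge0//.
  by rewrite sqrtr_sqr gtr0_norm.
rewrite exprMn invfM mulrA [(Mmu + Mnu) * _]mulrC.
apply: le_trans (exprn_ratio_le K3 theta_gt0 (le_trans tau_theta (rk_ge k))).
by rewrite ler_wpM2r ?invr_ge0 ?exprn_ge0// ltW.
Qed.

Theorem prb_lawn_le m c u : (0 < m)%N ->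
  `|prb (lawn mu m) (sqball c u) - prb (lawn nu m) (sqball c u)| <=
  beC * (theta / Num.sqrt m%:R).
Proof.
elim/ltn_ind: m c u => -[//|m] IH c u _.
set s := Num.sqrt m.+1%:R; have s0 : 0 < s by rewrite sqrtr_gt0 ltr0n.
have A1 := shellC1; have M1 := smoothM1; have C1 := CK1.
have beC_ge0 : 0 <= beC := ltW (beC_gt0 K th0_gt0).
have d01 (cu : E * R) : 0 <= `|prb (lawn mu m.+1) (sqball cu.1 cu.2) -
     prb (lawn nu m.+1) (sqball cu.1 cu.2)| <= 1.
  rewrite normr_ge0 /= ler_norml.
  have h1 := prb_ge0 (lawn mu m.+1) (sqball cu.1 cu.2).
  have h2 := prb_ge0 (lawn nu m.+1) (sqball cu.1 cu.2).
  have h3 := prb_le1 (lawn mu m.+1) (measurable_sqball cu.1 cu.2).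
  have h4 := prb_le1 (lawn nu m.+1) (measurable_sqball cu.1 cu.2).
  move: h1 h2 h3 h4; move: (prb _ _) (prb _ _) => x y h1 h2 h3 h4.
  apply/andP; split; lra.
(* With few summands the claimed bound exceeds one, because [beC >= smoothM]. Otherwise [eps] is at
   most the scale [sigma * s] of the Gaussian part, as the shell estimate requires. *)
have [ts|ts] := leP tau s; last first.
  have /andP[_ h] := d01 (c, u); apply: (le_trans h).
  rewrite mulrA ler_pdivlMr// mul1r; apply: (le_trans (ltW ts)).
  rewrite /tau ler_pM2r// /beC.
  have : smoothM <= shellC * smoothM by rewrite ler_peMl//; move: M1 C1; lra.
  by move: C1 M1; lra.
pose q := shellC * (tau / s).
pose M := cmremC K * (4 * beC * theta / (smoothM * s) + theta / s).
have q0 : 0 <= q.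
  by rewrite mulr_ge0 ?divr_ge0 ?(ltW s0)//; [move: A1|move: tau1]; lra.
have hq c' u1 u2 : u1 <= u2 -> u2 - u1 <= 2 * chebA * eps * Num.sqrt (u2 + p%:R * eps ^+ 2) ->
    prb (lawn nu m.+1) (sqball c' u2) - prb (lawn nu m.+1) (sqball c' u1) <= q.
  move=> u12 hu; have gE : gscale sigma sigma m = sigma * s.
    rewrite /gscale -{1}[sigma ^+ 2]mul1r -mulrDl nat1r sqrtrM// sqrtr_sqr gtr0_norm//.
    by rewrite mulrC.
  have := @lawn_shell R p nu rho sigma sigma0 nuE eps (2 * chebA) u1 u2 c' m p0 eps0.
  rewrite gE (_ : eps / (sigma * s) = tau / s); last first.
    by rewrite /eps; field; rewrite !lt0r_neq0.
  apply => //; first by move: chebA1; lra.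
  by rewrite /eps ler_pM2l.
have M0 : 0 <= M.
  have t0 := theta_gt0; rewrite /M mulr_ge0 ?addr_ge0 ?divr_ge0 ?mulr_ge0 ?(ltW s0) ?(ltW t0)//.
  - exact: hermC_ge0.
  - by move: M1 C1; lra.
have hM c' u' : `|smprb eps (lawn mu m.+1) c' u' - smprb eps (lawn nu m.+1) c' u'| <= M.
  (* With no summand both laws are the Dirac mass at the origin; the value [0] replaces the
     meaningless [theta / sqrt 0]. *)
  pose D j : R := if j is k.+1 then beC * (theta / Num.sqrt j%:R) else 0.
  have hD j : (j < m.+1)%N -> forall c u,
      `|prb (lawn mu j) (sqball c u) - prb (lawn nu j) (sqball c u)| <= D j.
    by case: j => [|j] jm c1 u1; [rewrite /D subrr normr0|exact: IH].
  have K0 : (0 < K)%N := ltn_trans (isT : (0 < 2)%N) K3.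
  apply: le_trans (lindeberg sigma0 K0 same_moments nuE hmu hnu c' u' eps0 hD) _.
  rewrite -mulrA /M ler_pM2l ?(lt_le_trans ltr01)// mulrDr succnK.
  set N := tau ^+ 2 + m%:R.
  have t2 : 1 <= tau ^+ 2 by rewrite exprn_ege1.
  have hN : m%:R + 1 <= N by rewrite /N; lra.
  have mN : m.+1%:R <= N by rewrite -natr1.
  have m0 : 0 <= m%:R :> R by [].
  have s2 : s ^+ 2 = m.+1%:R by rewrite sqr_sqrtr.
  have N0 : 0 < N by lra.
  have rkm : rk m = Num.sqrt N by [].
  apply: lerD.
    rewrite big_nat_recl//= mul0r add0r mulr_sumr.
    apply: (@le_trans _ _ (beC * theta ^+ 2 * \sum_(0 <= j < m)
        ((Num.sqrt j.+1%:R)^-1 * Num.sqrt (N - j.+1%:R) ^- 3))).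
      rewrite mulr_sumr big_seq [leRHS]big_seq; apply: ler_sum => j.
      rewrite mem_index_iota => /andP[_ jm].
      have -> : Num.sqrt (N - j.+1%:R) = rk (m - j.+1).
        by rewrite /rk natrB// /N addrA.
      rewrite mulrCA [leRHS](_ : _ =
        beC * (theta / Num.sqrt j.+1%:R) * (theta * rk (m - j.+1) ^- 3)).
        apply: ler_wpM2l; last exact: cost_le.
        by rewrite mulr_ge0// divr_ge0 ?sqrtr_ge0// ltW.
      by ring.
    apply: (@le_trans _ _ (beC * theta ^+ 2 * (4 / N * (s / tau)))).
      rewrite ler_wpM2l ?(mulr_ge0 beC_ge0) ?sqr_ge0//.
      apply: le_trans (sum_sqrt_le hN) _.
      have -> : Num.sqrt (N - m%:R) = tau.
        by rewrite /N addrK sqrtr_sqr ger0_norm// (le_trans ler01).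
      rewrite ler_wpM2l ?divr_ge0 ?(ltW N0)// ler_wpM2r//.
        by rewrite invr_ge0 (le_trans ler01).
      by rewrite /s ler_sqrt ?ler_nat.
    have t0 : 0 < tau := lt_le_trans ltr01 tau1.
    have sm0 : 0 < smoothM by move: M1 C1; lra.
    (* One factor [theta] cancels against [tau = smoothM * theta], which produces the small factor
       [1 / smoothM]; the rest is at most one since [s^2 = m + 1 <= N]. *)
    have -> : beC * theta ^+ 2 * (4 / N * (s / tau)) =
        4 * beC * theta / (smoothM * s) * (s ^+ 2 / N).
      by rewrite /tau; field; rewrite !lt0r_neq0.
    rewrite ler_piMr//.
      by rewrite divr_ge0 ?mulr_ge0// ?ltW.
    by rewrite ler_pdivrMr// mul1r s2.
  rewrite mulrCA; apply: (@le_trans _ _ (m.+1%:R * (theta * rk m ^- 3))).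
    by rewrite ler_wpM2l//; exact: cost_le.
  rewrite mulrCA ler_pM2l// -s2 rkm.
  have sr : s <= Num.sqrt N by rewrite ler_sqrt// ltW.
  have r0 : 0 < Num.sqrt N := lt_le_trans s0 sr.
  rewrite ler_pdivrMr ?exprn_gt0//.
  rewrite -[X in X <= _](_ : s^-1 * s ^+ 3 = _); last by field; exact: lt0r_neq0.
  by rewrite ler_pM2l ?invr_gt0// lerXn2r// nnegrE ltW.
have := @sup_contraction R (E * R) _ (q + 4 / 3 * M) d01 _ (c, u).
move=> /= h; apply: le_trans (h _) _.
  move=> Delta hDelta [c' u'] /=; apply: (smoothing eps0 p0 M0) => // c1 u1.
  exact: (hDelta (c1, u1)).
rewrite /q /M /tau.
have sm0 : 0 < smoothM by move: M1 C1; lra.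
pose y := theta / s; have y0 : 0 < y by rewrite divr_gt0.
have -> : 4 * beC * theta / (smoothM * s) = 4 * (beC / smoothM) * y.
  by rewrite /y; field; rewrite !lt0r_neq0.
have -> : shellC * (smoothM * theta / s) = shellC * smoothM * y by rewrite /y; ring.
(* After the contraction the induction constant appears as [8 * cmremC K * (beC / smoothM)], and
   [smoothM >= 16 * cmremC K] makes this at most [beC / 2]. *)
rewrite -/y; have h1 : cmremC K * (beC / smoothM) <= beC / 16.
  rewrite mulrCA ler_wpM2l// ler_pdivrMr//; move: M1; lra.
have : cmremC K * (beC / smoothM) * y <= beC / 16 * y by rewrite ler_pM2r.
have -> : beC * y = beC / 2 * y + (3 * shellC * smoothM + 4 * cmremC K) / 2 * y.
  by rewrite -/beC; field.
lra.
Qed.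

End berry_esseen_recursion.

(** * Polynomial calculus of symmetric matrices *)

Section symmetric_calculus.
Import complex.
Context {R : realType}.

Lemma poly_interpolation (l : seq R) (f : R -> R) :
  exists q : {poly R}, forall x, x \in l -> q.[x] = f x.
Proof.
elim: l => [|x l [q hq]]; first by exists 0.
have [xl|xl] := boolP (x \in l).
  by exists q => y; rewrite inE => /predU1P[->|]; exact: hq.
pose w := \prod_(y <- l) ('X - y%:P); have wx : w.[x] != 0 by rewrite -rootE root_prod_XsubC.
exists (q + ((f x - q.[x]) / w.[x])%:P * w) => y; rewrite inE !hornerE => /predU1P[->|yl].
  by rewrite divfK// addrC subrK.
have /rootP -> : root w y by rewrite root_prod_XsubC.
by rewrite mulr0 addr0 hq.
Qed.

Lemma horner_mx_tr n (M : 'M[R]_n.+1) (q : {poly R}) : (horner_mx M q)^T = horner_mx M^T q.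
Proof.
elim/poly_ind: q => [|q c IH]; first by rewrite !rmorph0 trmx0.
rewrite !rmorphD !rmorphM /= !horner_mx_X !horner_mx_C linearD /= tr_scalar_mx.
rewrite trmx_mul IH; congr (_ + _).
by have := @comm_horner_mx2 _ _ M^T 'X q; rewrite /GRing.comm horner_mx_X.
Qed.

(* The eigenvalues of the complexified matrix are real, and it is diagonalizable. *)
Lemma symmetric_spectrum n (M : 'M[R]_n.+1) : M^T = M -> exists l : seq R,
  (forall f : {poly R}, (forall x, x \in l -> f.[x] = 0) -> horner_mx M f = 0) /\
  (forall x, x \in l -> eigenvalue M x).
Proof.
move=> MT; pose toC : {rmorphism R -> R[i]%C} := real_complex R.
pose Mc := map_mx toC M; pose P := spectralmx Mc; pose d := spectral_diag Mc.
have Mreal : Mc \is a realmx.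
  by apply/mxOverP => i j; rewrite mxE complex_real.
have Mh : Mc \is hermsymmx.
  apply: realsym_hermsym => //; apply/is_hermitianmxP.
  by rewrite expr0 scale1r map_mx_id// /Mc map_trmx MT.
have /hermitian_normalmx /orthomx_spectralP : Mc \is hermsymmx by [].
rewrite -/P -/d => ME.
have dreal : d \is a realmx := hermitian_spectral_diag_real Mh.
have Pu : P \in unitmx := spectral_unit Mc.
clearbody P d.
have dE j : toC (complex.Re (d 0 j)) = d 0 j.
  by apply: RRe_real; exact: (mxOverP dreal).
exists [seq complex.Re (d 0 j) | j : 'I_n.+1]; split => [f hf|x /mapP[j _ ->]].
  apply: (map_mx_inj (f := toC)); rewrite map_mx0 map_horner_mx -/Mc.
  rewrite [X in horner_mx X]ME (horner_mx_uconjC _ _ Pu) horner_mx_diag.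
  have -> : map_mx (horner (map_poly toC f)) d = 0.
    apply/rowP => j; rewrite !mxE -dE horner_map hf ?rmorph0//.
    by apply/mapP; exists j => //; rewrite mem_enum.
  by rewrite (_ : diag_mx 0 = 0) ?mulmx0 ?mul0mx//; apply/matrixP => i j; rewrite !mxE mul0rn.
rewrite eigenvalue_root_char -(fmorph_root toC) map_char_poly dE -eigenvalue_root_char.
apply/eigenvalueP; exists (row j P).
  rewrite -row_mul -/Mc ME !mulmxA mulmxV// mul1mx.
  by rewrite row_mul row_diag_mx -scalemxAl rowE.
apply: contraTneq Pu => Pj; rewrite unitmxE unitfE negbK.
by rewrite (expand_det_row _ j) big1// => k _; have := congr1 (fun r : 'rV_ _ => r 0 k) Pj;
  rewrite !mxE => ->; rewrite mul0r.
Qed.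

End symmetric_calculus.

(** * Square roots, operator norm and splitting of a Gaussian vector *)

Section square_roots.
Context {R : realType} {p : nat}.
Notation E := 'cV[R]_p.
Implicit Types (A S M : 'M[R]_p) (v x : E).

(** [C] is the polynomial in [M] that interpolates the fourth root on the spectrum. A fourth root is
    taken because [C *m C] is then a square root that is visibly positive semidefinite, [C] being
    symmetric. *)
Lemma psd_fourth_root M : M^T = M -> (forall v, 0 <= dotv v (M *m v)) ->
  exists C : 'M[R]_p, C^T = C /\ (C *m C) *m (C *m C) = M.
Proof.
case: p M => [|n] M MT M0.
  by exists 0; split; apply/matrixP => -[].
have [l [hl eig]] := symmetric_spectrum MT.
have l0 (x : R) : x \in l -> 0 <= x.
  move=> /eig /eigenvalueP[v vM v0]; have := M0 v^T.
  have -> : M *m v^T = x *: v^T by rewrite -[in LHS]MT -trmx_mul vM linearZ.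
  rewrite dotvZr pmulr_lge0// sqn_gt0; apply: contra_neq v0 => /(congr1 trmx).
  by rewrite trmxK trmx0.
have [q hq] := poly_interpolation l (fun x : R => Num.sqrt (Num.sqrt x)).
exists (horner_mx M q); split; first by rewrite horner_mx_tr MT.
have /hl : forall x : R, x \in l -> (q * q * (q * q) - 'X).[x] = 0.
  move=> x xl; rewrite hornerD hornerN hornerX !hornerM hq//; set r := Num.sqrt _.
  have r4 : r ^+ 4 = x by rewrite (exprM r 2 2) !sqr_sqrtr ?sqrtr_ge0// l0.
  by rewrite -[X in _ - X]r4; ring.
by rewrite rmorphB !rmorphM /= horner_mx_X => /eqP; rewrite subr_eq0 => /eqP.
Qed.

Lemma inj_unitmx A : (forall v, A *m v = 0 -> v = 0) -> A \in unitmx.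
Proof.
move=> inj; rewrite -unitmx_tr -row_free_unit -kermx_eq0; apply/rowV0P => v /sub_kermxP vA.
have /inj /(congr1 trmx) : A *m v^T = 0 by rewrite -[A]trmxK -trmx_mul vA trmx0.
by rewrite trmxK trmx0.
Qed.

Lemma sym_posdef_unit A : sym_posdef A -> A \in unitmx.
Proof.
move=> [_ hA]; apply: inj_unitmx => v Av; apply/eqP; rewrite -[_ == _]negbK; apply/negP => /hA.
by rewrite -mulmxA Av mulmx0 mxE ltxx.
Qed.

Lemma sym_posdef_sqrt A : sym_posdef A -> exists S, sym_posdef S /\ S *m S = A.
Proof.
move=> [AT hA]; have [|C [CT CA]] := psd_fourth_root AT.
  move=> v; have [->|v0] := eqVneq v 0; first by rewrite dotv0l.
  by rewrite dotv_trmx mulmxA ltW// hA.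
exists (C *m C); split => //; split; first by rewrite trmx_mul CT.
move=> v v0; rewrite -mulmxA -dotv_trmx -mulmxA.
have -> : dotv v (C *m (C *m v)) = sqn (C *m v) by rewrite /sqn dotv_mulmx CT.
rewrite sqn_gt0; apply: contraTneq (hA v v0) => Cv.
by rewrite -mulmxA -CA -!mulmxA Cv !mulmx0 mxE ltxx.
Qed.

Lemma sym_posdef_inv A : sym_posdef A -> sym_posdef (invmx A).
Proof.
move=> hA; have uA := sym_posdef_unit hA; have [AT A0] := hA.
split=> [|v v0]; first by rewrite trmx_inv AT.
have : invmx A *m v != 0.
  by apply: contra_neq v0 => h; rewrite -(mulKVmx uA v) h mulmx0.
move=> /A0; by rewrite trmx_mul trmx_inv AT -!mulmxA (mulKVmx uA).
Qed.

Lemma invsqrtmxP A : sym_posdef A ->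
  sym_posdef (invsqrtmx A) /\ invsqrtmx A *m invsqrtmx A = invmx A.
Proof.
by move=> /sym_posdef_inv /sym_posdef_sqrt; exact: xgetPex.
Qed.

Lemma enorm_le_opnorm A x : enorm (A *m x) <= opnorm A * enorm x.
Proof.
have [->|x0] := eqVneq x 0.
  by rewrite mulmx0 !enormE sqn0 sqrtr0 mulr0.
have e0 : 0 < enorm x by rewrite enormE sqrtr_gt0 sqn_gt0.
(* The Frobenius norm bounds the set whose supremum defines [opnorm], so that this supremum is a
   genuine one. *)
have bd (y : E) : sqn (A *m y) <= (\sum_j sqn (row j A)^T) * sqn y.
  rewrite {1}/sqn /dotv mulr_suml; apply: ler_sum => j _; rewrite -expr2.
  apply: le_trans (dotv_sqr_le _ _); rewrite dotv_trmx trmxK -row_mul.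
  by rewrite [in leRHS]mxE.
rewrite -ler_pdivrMr//.
have -> : enorm (A *m x) / enorm x = enorm (A *m ((enorm x)^-1 *: x)).
  by rewrite -scalemxAr enormZ gtr0_norm ?invr_gt0// mulrC.
apply: ub_le_sup; last first.
  exists ((enorm x)^-1 *: x) => //=.
  by rewrite enormZ gtr0_norm ?invr_gt0// mulVf// gt_eqF.
exists (Num.sqrt (\sum_j sqn (row j A)^T)) => _ [y /= y1 <-].
rewrite enormE ler_sqrt; last by apply: sumr_ge0 => j _; exact: sqn_ge0.
apply: le_trans (bd y) _; rewrite ler_piMr//; first by apply: sumr_ge0 => j _; exact: sqn_ge0.
by rewrite -enorm_sqr exprn_ile1 ?enorm_ge0.
Qed.

Lemma opnorm_gt0 A : (0 < p)%N -> sym_posdef A -> 0 < opnorm A.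
Proof.
move=> p0 hA; pose v : E := const_mx 1.
have v0 : v != 0.
  by apply/eqP => /matrixP /(_ (Ordinal p0) 0); rewrite !mxE => /eqP; rewrite oner_eq0.
have e0 : 0 < enorm v by rewrite enormE sqrtr_gt0 sqn_gt0.
have Av : 0 < enorm (A *m v).
  rewrite enormE sqrtr_gt0 sqn_gt0; apply: contraTneq ((proj2 hA) v v0) => Av.
  by rewrite -mulmxA Av mulmx0 mxE ltxx.
by have := lt_le_trans Av (enorm_le_opnorm A v); rewrite pmulr_lgt0.
Qed.

(** With [S = Sigma^(-1/2)], [T = S^-1] and [sigma = 1 / |S|], the inequality [|v| <= |S| |T v|]
    makes [T^2 - sigma^2] positive semidefinite, and [B] is its square root. Both [A w] and
    [sigma x + B y] are images under [T] of standard Gaussian vectors, namely [S A w] and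
    [sigma S x + S B y]. *)
Lemma gaussian_split Sigma A : (0 < p)%N -> sym_posdef Sigma -> A *m A^T = Sigma ->
  exists B : 'M[R]_p, forall f, nnmeas f ->
  (\int[gauss p]_w f (A *m w) =
   \int[gauss p]_x \int[gauss p]_y f ((opnorm (invsqrtmx Sigma))^-1 *: x + B *m y)%R)%E.
Proof.
move=> p0 hSig AA; have [hS SS] := invsqrtmxP hSig.
set S := invsqrtmx Sigma in hS SS *; have a0 := opnorm_gt0 p0 hS.
set sigma := (opnorm S)^-1; have s0 : 0 < sigma by rewrite invr_gt0.
have uS := sym_posdef_unit hS; have [ST _] := hS; have uSig := sym_posdef_unit hSig.
pose T := invmx S; have TT : T^T = T by rewrite trmx_inv ST.
have SigE : T *m T = Sigma.
  rewrite -[LHS](mulmxKV uSig) -SS -(mulmxA T T) (mulmxA T S).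
  by rewrite mulVmx// mul1mx mulVmx// mul1mx.
pose M := T *m T - (sigma ^+ 2)%:M.
have MT : M^T = M by rewrite linearB /= trmx_mul TT tr_scalar_mx.
have [|C [CT CC]] := psd_fourth_root MT.
  move=> v; rewrite mulmxBl mul_scalar_mx dotvDr dotvNr dotvZr -mulmxA.
  rewrite -[X in dotv v (X *m _)]TT -dotv_mulmx -/(sqn _) -/(sqn _) subr_ge0.
  rewrite -!enorm_sqr -exprMn lerXn2r ?nnegrE ?mulr_ge0 ?enorm_ge0// ?(ltW s0)//.
  rewrite mulrC ler_pdivrMr// mulrC.
  by have := enorm_le_opnorm S (T *m v); rewrite mulKVmx.
pose B := C *m C; have BT : B^T = B by rewrite trmx_mul CT.
exists B => f [mf f0].
have mfT : measurable_fun setT (fun w : E => f (T *m w)).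
  by apply: (measurableT_comp mf); exact: measurable_cV_mulmx.
have e1 : (S *m A) *m (S *m A)^T + (0 : 'M[R]_p) *m (0 : 'M[R]_p)^T = 1%:M.
  rewrite mul0mx addr0 trmx_mul ST mulmxA -(mulmxA S) AA -SigE.
  by rewrite mulmxA mulmxV// mul1mx mulVmx.
have e2 : (sigma *: S) *m (sigma *: S)^T + (S *m B) *m (S *m B)^T = 1%:M.
  rewrite linearZ /= -scalemxAl -scalemxAr scalerA ST trmx_mul ST BT.
  rewrite mulmxA -(mulmxA S) CC /M mulmxBr mulmxBl mul_mx_scalar -scalemxAl expr2.
  by rewrite addrC subrK mulmxA mulmxV// mul1mx mulVmx.
have := ge0_integral_gauss_lin e1 mfT (fun w => f0 _).
rewrite -(ge0_integral_gauss_lin e2 mfT (fun w => f0 _)) => h.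
transitivity (\int[gauss p]_x \int[gauss p]_y f (T *m (S *m A *m x + 0 *m y))%R)%E.
  apply: eq_integral => x _; rewrite -[LHS](integral_cst_probability (gauss p)).
  by apply: eq_integral => y _; congr f; rewrite mul0mx addr0 -mulmxA /T mulKmx.
rewrite h; apply: eq_integral => x _; apply: eq_integral => y _; congr f.
by rewrite mulmxDr -scalemxAl -scalemxAr -mulmxA /T !mulKmx.
Qed.

End square_roots.

(** * Laws of sums of independent vectors *)

Section laws.
Local Open Scope ereal_scope.

Lemma prod_law_unique d d1 d2 (T : measurableType d) (T1 : measurableType d1)
    (T2 : measurableType d2) (R : realType) (m : {measure set T -> \bar R})
    (m2 : {measure set (T1 * T2) -> \bar R}) (Z : T -> T1 * T2) :
  measurable_fun setT Z -> m setT < +oo ->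
  (forall A B, measurable A -> measurable B -> m (Z @^-1` (A `*` B)) = m2 (A `*` B)) ->
  forall D, measurable D -> m (Z @^-1` D) = m2 D.
Proof.
move=> mZ mT rect D mD.
pose Zp : {mfun T >-> (T1 * T2)%type} := HB.pack Z (isMeasurableFun.Build _ _ _ _ Z mZ).
apply: (measure_unique [set A `*` B | A in measurable & B in measurable] (fun=> setT) _ _ _ _
  (pushforward m Zp)) => //.
- by rewrite measurable_prod_measurableType.
- move=> _ _ [A mA [B mB <-]] [A' mA' [B' mB' <-]]; rewrite -setXI.
  by exists (A `&` A'); [exact: measurableI|exists (B `&` B') => //; exact: measurableI].
- by move=> _; exists setT => //; exists setT => //; rewrite setXTT.
- by rewrite bigcup_const.
- by move=> _ [A mA [B mB <-]]; exact: rect.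
Qed.

Context {R : realType} {p : nat}.
Notation E := 'cV[R]_p.

(** Independence is given on rectangles of events only, so the induction carries, along with the
    partial sum [S k], arbitrary events on the summands not yet added. One of them is released at
    each step. *)
Lemma law_sum d (T : measurableType d) (P : probability T R) n (X : 'I_n -> {RV P >-> E})
    (mu : probability E R) : mutually_independent P X ->
  (forall i A, measurable A -> P (X i @^-1` A) = mu A) ->
  forall A, measurable A -> P ((fun t => \sum_(i < n) X i t)%R @^-1` A) = lawn mu n A.
Proof.
move=> indX lawX.
pose S k t := (\sum_(i < n | (i < k)%N) X i t)%R.
pose J k := [set i : 'I_n | (k <= i)%N]%SET.
have mS k : measurable_fun setT (S k).
  rewrite /S; under eq_fun do rewrite -big_filter.
  exact: measurable_cV_sum.
have mX i B : measurable B -> measurable (X i @^-1` B).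
  by move=> mB; rewrite -[X in measurable X]setTI; exact: measurable_funP.
have mF k B : (forall i, measurable (B i)) -> measurable (\bigcap_(i in [set` J k]) X i @^-1` B i).
  by move=> mB; apply: fin_bigcap_measurable => // i _; exact: mX.
have key k : (k <= n)%N -> forall A B, measurable A -> (forall i, measurable (B i)) ->
    P (S k @^-1` A `&` \bigcap_(i in [set` J k]) X i @^-1` B i) =
    lawn mu k A * \prod_(i in J k) mu (B i).
  elim: k => [|k IH] kn A B mA mB.
    have S0 t : S 0%N t = 0%R by rewrite /S big_pred0.
    rewrite /= diracE; have [A0|A0] := boolP (0%R \in A).
      rewrite mul1e (_ : S 0%N @^-1` A = setT) ?setTI.
        by rewrite indX//; apply: eq_bigr => i _; exact: lawX.
      by apply/seteqP; split => t //= _; rewrite S0; exact: set_mem.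
    rewrite mul0e (_ : S 0%N @^-1` A = set0) ?set0I ?measure0//.
    apply/seteqP; split => t //=; rewrite S0 => h.
    by move/negP: A0; apply; exact: mem_set.
  pose i0 := Ordinal kn.
  have JE i : (i \in J k) = (i == i0) || (i \in J k.+1).
    by rewrite !inE leq_eqVlt eq_sym.
  have i0J : i0 \notin J k.+1 by rewrite inE ltnn.
  pose F := \bigcap_(i in [set` J k.+1]) X i @^-1` B i.
  have mFk : measurable F by exact: mF.
  set c := \prod_(i in J k.+1) _.
  have cE : c = P F by rewrite /F indX//; apply: eq_bigr => i _; rewrite lawX.
  have c0 : (0 <= fine c)%R by rewrite fine_ge0// cE measure_ge0.
  have cf : (fine c)%:E = c by rewrite fineK// cE fin_num_measure.
  have mZ : measurable_fun setT (fun t => (X i0 t, S k t)).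
    by apply: measurable_fun_pair => //; exact: measurable_funP.
  have mD : measurable (addv_pair (p := p) @^-1` A).
    by rewrite -[X in measurable X]setTI; exact: measurable_funP.
  (* The event on the later summands is built into the measure: [P] restricted to it is compared,
     for the pair of [X i0] and [S k], with the product law scaled by its probability [c]. *)
  have h := @prod_law_unique _ _ _ T E E R (mrestr P mFk)
    (mscale (NngNum c0) (mu \x lawn mu k)) _ mZ _ _ _ mD.
  have eM D : mscale (NngNum c0) (mu \x lawn mu k) D = c * (mu \x lawn mu k) D.
    by transitivity ((fine c)%:E * (mu \x lawn mu k) D) => //; rewrite cf.
  have -> : lawn mu k.+1 A * c = mscale (NngNum c0) (mu \x lawn mu k) (addv_pair (p := p) @^-1` A).
    by rewrite eM muleC.
  rewrite -h.
  - rewrite /mrestr; congr (P (_ `&` _)); apply: eq_set => t /=.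
    congr A; rewrite /addv_pair /= /S (bigD1 i0) ?ltnSn//=; congr (_ + _)%R.
    by apply: eq_bigl => i; rewrite ltnS ltn_neqAle andbC.
  - exact: le_lt_trans (probability_le1 P (measurableI _ _ measurableT mFk)) (ltry _).
  - move=> A1 A2 mA1 mA2; apply: (@etrans _ _ (c * (mu A1 * lawn mu k A2))); last first.
      by rewrite -(@product_measure1E _ _ E E R mu (lawn mu k) _ _ mA1 mA2); exact: esym (eM _).
    pose B' i := if i == i0 then A1 else B i.
    have mB' i : measurable (B' i) by rewrite /B'; case: ifP.
    have := IH (ltnW kn) A2 B' mA2 mB'.
    rewrite (bigD1 i0)/=; last by rewrite JE eqxx.
    have -> : B' i0 = A1 by rewrite /B' eqxx.
    have -> : \prod_(i in J k | i != i0) mu (B' i) = c.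
      apply: eq_big => [i|i /andP[_ ii0]]; last by rewrite /B' (negbTE ii0).
      rewrite JE; have [->|_] := eqVneq i i0; first by rewrite (negbTE i0J).
      by rewrite andbT.
    have -> : c * (mu A1 * lawn mu k A2) = lawn mu k A2 * (mu A1 * c).
      by rewrite muleC [X in X * c]muleC muleA.
    move=> <-; rewrite /mrestr; congr (P _); apply/seteqP; split => t /=.
      move=> [[h1 h2] h3]; split => // i; rewrite /= JE => /predU1P[->|iJ].
        by rewrite /B' eqxx.
      by rewrite /B'; case: eqP => [ii0|_]; [move: i0J; rewrite -ii0 iJ|exact: h3].
    move=> [h1 h2]; split; [split => //|].
      by have := h2 i0; rewrite /= JE eqxx /B' eqxx; exact.
    move=> i iJ; have := h2 i; rewrite /= JE iJ orbT /B' => /(_ isT).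
    by case: eqP => // ii0; move: i0J; rewrite -ii0 iJ.
move=> A mA; have := key n (leqnn n) A (fun=> setT) mA (fun=> measurableT).
rewrite [in RHS]big1 ?mule1 => [<-|i _]; last exact: probability_setT.
have Sn t : S n t = (\sum_(i < n) X i t)%R by apply: eq_bigl => i; rewrite ltn_ord.
by congr (P _); apply/seteqP; split => t /=; rewrite Sn; [split|case].
Qed.

Lemma law_add d (T : measurableType d) (P : probability T R) (Z U : {RV P >-> E}) f :
  independent2 P Z U -> nnmeas f ->
  \int[P]_t f (Z t + U t)%R = \int[distribution P Z]_z \int[distribution P U]_u f (z + u)%R.
Proof.
move=> indZU nf; have [mf f0] := nf; rewrite -(ge0_integral_addv _ _ nf).
have mZU : measurable_fun setT (fun t => (Z t, U t)).
  by apply: measurable_fun_pair; exact: measurable_funP.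
have mS : measurable_fun setT (fun t => Z t + U t)%R.
  by apply: measurable_cVD; exact: measurable_funP.
pose V : {RV P >-> E} := HB.pack (fun t => Z t + U t)%R
  (isMeasurableFun.Build _ _ _ _ (fun t => Z t + U t)%R mS).
rewrite -(ge0_integral_distribution V mf f0).
apply: eq_measure_integral => A mA _.
have mD : measurable (addv_pair (p := p) @^-1` A).
  by rewrite -[X in measurable X]setTI; exact: measurable_funP.
apply: (@prod_law_unique _ _ _ T E E R P (distribution P Z \x distribution P U) _ mZU _ _ _ mD).
- exact: le_lt_trans (probability_le1 P measurableT) (ltry _).
- by move=> A1 A2 mA1 mA2; 
  exact: etrans (indZU _ _ mA1 mA2)
    (esym (@product_measure1E _ _ E E R (distribution P Z) (distribution P U) _ _ mA1 mA2)).
Qed.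

End laws.

(** * A lower bound on the moments of [nu] *)

Section moment_lower_bound.
Context {R : realType} {p : nat}.
Notation E := 'cV[R]_p.
Variables (nu rho : probability E R) (K : nat) (sigma M : R).
Hypotheses (sigma0 : 0 < sigma) (p0 : (0 < p)%N).
Hypothesis nuE : forall f, nnmeas f -> cv nu f = gs sigma (cv rho f).
Hypothesis hM : (\int[nu]_x (enorm x ^+ K)%:E <= M%:E)%E.

(** A radius for which every ball has Gaussian probability at most [1 / 2], in any dimension: the
    squared probability is at most [2 e * smallr^2 = 1 / 4]. *)
Definition smallr : R := Num.sqrt (8 * expR 1)^-1.

Let e0 : 0 < expR 1 :> R := expR_gt0 1.

Lemma smallr_gt0 : 0 < smallr.
Proof. by rewrite sqrtr_gt0 invr_gt0 mulr_gt0. Qed.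

Let smallr_sqr : smallr ^+ 2 = (8 * expR 1)^-1.
Proof. by rewrite sqr_sqrtr// invr_ge0 mulr_ge0// ltW. Qed.

Lemma smallr_le1 : smallr <= 1.
Proof.
rewrite -(@ler_pXn2r _ 2)// ?nnegrE ?(ltW smallr_gt0)// smallr_sqr expr1n.
have : 1 <= expR 1 :> R by rewrite -[leLHS]expR0 ler_expR.
by move=> e1; rewrite invf_le1 ?mulr_gt0//; lra.
Qed.

Let gauss_small_ball (c : E) : prb (gauss p) (sqball c (smallr ^+ 2)) <= 1 / 2.
Proof.
rewrite -(@ler_pXn2r _ 2)// ?nnegrE ?prb_ge0 ?divr_ge0//.
apply: le_trans (gauss_ball_sqrt c _ p0) _; first by rewrite exprn_gt0// smallr_gt0.
have m1 : 1 <= p%:R + sqn c.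
  have := sqn_ge0 c; have : 1 <= p%:R :> R by rewrite ler1n.
  lra.
apply: (@le_trans _ _ (2 * expR 1 * smallr ^+ 2)).
  rewrite ler_pM2l ?mulr_gt0// ler_pdivrMr ?(lt_le_trans ltr01)//.
  by rewrite ler_peMr// sqr_ge0.
by rewrite smallr_sqr le_eqVlt; apply/predU1P; left; field; exact: lt0r_neq0.
Qed.

(** Convolving with [rho] cannot raise the probability of small balls, so [nu] puts at most half of
    its mass within distance [sigma * smallr] of the origin, and Markov's inequality applies to the
    rest. *)
Lemma moment_ge_smallr : (sigma * smallr) ^+ K / 2 <= M.
Proof.
set r := sigma * smallr; have r0 : 0 < r by rewrite mulr_gt0// smallr_gt0.
set c := r ^+ K; have c0 : 0 < c by rewrite exprn_gt0.
pose B : set E := sqball 0 (r ^+ 2); have mB : measurable B by exact: measurable_sqball.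
have nB := nnmeas_indic mB.
have hB : (\int[nu]_x (\1_B x)%:E <= (1 / 2)%:E)%E.
  rewrite -/(EFin \o \1_B) -cv_origin (nuE nB) -(cv_gs _ _ nB).
  have n0 : nnmeas (fun _ : E => 0%E : \bar R).
    by split => //; exact: measurable_cst.
  apply: le_trans (cv_leD rho (D := 1 / 2) 0 (nnmeas_gs sigma nB) n0 _ _) _.
  - by rewrite divr_ge0.
  - move=> y; rewrite add0e (gs_indic_sqball _ _ _ sigma0) lee_fin.
    have -> : r ^+ 2 / sigma ^+ 2 = smallr ^+ 2.
      by rewrite /r; field; exact: lt0r_neq0.
    exact: gauss_small_ball.
  - by rewrite /cv integral0 add0e.
have mI : measurable_fun setT (\1_B : E -> R) by exact: measurable_indic.
have mK : measurable_fun setT (fun x : E => enorm x ^+ K).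
  by apply: measurable_funX; exact: measurable_enorm.
suff : c <= M + c * (1 / 2) by lra.
rewrite -lee_fin -[leLHS](integral_cst_probability nu).
apply: (@le_trans _ _ (\int[nu]_x (enorm x ^+ K + c * \1_B x)%:E)%E).
  apply: ge0_le_integralT => //.
  - by apply/measurable_EFinP; apply: measurable_funD => //; exact: measurable_funM.
  - by move=> x; rewrite lee_fin ltW.
  - move=> x; rewrite lee_fin indicE; have [xB|xB] := boolP (x \in B).
      by rewrite mulr1 lerDr exprn_ge0// enorm_ge0.
    rewrite mulr0 addr0 lerXn2r ?nnegrE ?enorm_ge0 ?(ltW r0)//.
    rewrite -(@ler_pXn2r _ 2)// ?nnegrE ?enorm_ge0 ?(ltW r0)// enorm_sqr ltW//.
    by rewrite ltNge; apply: contra xB => h; rewrite inE /B /sqball /= subr0.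
apply: integral_leD => //.
- exact: measurable_funM.
- by move=> x; rewrite exprn_ge0// enorm_ge0.
- by move=> x; rewrite mulr_ge0// ltW.
under eq_integral do rewrite EFinM.
rewrite ge0_integralZl//; last 2 first.
- exact/measurable_EFinP.
- by rewrite lee_fin ltW.
by rewrite [leRHS]EFinM lee_wpmul2l// lee_fin ltW.
Qed.

End moment_lower_bound.

(** * From random vectors to laws *)

Section transfer.
Context {R : realType} {p : nat}.
Notation E := 'cV[R]_p.

Lemma integrable_monomial d (T : measurableType d) (P : probability T R) (V : {RV P >-> E})
    K k (idx : 'I_k -> 'I_p) : (k <= K)%N -> (\int[P]_t (enorm (V t) ^+ K)%:E < +oo)%E ->
  P.-integrable setT (EFin \o (monomial idx \o V)).
Proof.
move=> kK hK; have mV : measurable_fun setT V by exact: measurable_funP.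
have mK : measurable_fun setT (fun t => enorm (V t) ^+ K).
  by apply: measurable_funX; exact: measurable_enorm.
have mM : measurable_fun setT (monomial idx \o V).
  rewrite /monomial /comp; apply: measurable_prod => l _; exact: measurable_cV_entry.
apply: (@le_integrable _ _ _ _ _ measurableT _ (EFin \o (fun t => 1 + enorm (V t) ^+ K))).
- exact/measurable_EFinP.
- move=> t _; rewrite /= lee_fin [leRHS]ger0_norm; last first.
    by rewrite addr_ge0// exprn_ge0// enorm_ge0.
  apply: (@le_trans _ _ (enorm (V t) ^+ k)).
    rewrite /monomial normr_prod -[X in _ ^+ X]card_ord -prodr_const.
    by apply: ler_prod => l _; rewrite normr_ge0 normr_entry_le.
  have e0 := enorm_ge0 (V t); have [e1|e1] := leP (enorm (V t)) 1.
    by apply: (@le_trans _ _ 1); [exact: exprn_ile1|rewrite lerDl exprn_ge0].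
  by rewrite -[leLHS]add0r lerD// ler_weXn2l// ltW.
- apply: (@integrableD _ _ _ _ _ measurableT (cst 1%E) (fun t => (enorm (V t) ^+ K)%:E)).
    exact: finite_measure_integrable_cst.
  apply/integrableP; split; first exact/measurable_EFinP.
  under eq_integral do rewrite gee0_abs ?lee_fin ?exprn_ge0 ?enorm_ge0//.
  exact: hK.
Qed.

Lemma integral_enorm_distribution d (T : measurableType d) (P : probability T R)
    (V : {RV P >-> E}) K :
  (\int[distribution P V]_x (enorm x ^+ K)%:E = normmoment P K V)%E.
Proof.
rewrite /normmoment unlock ge0_integral_distribution//.
- by apply/measurable_EFinP; apply: measurable_funX; exact: measurable_enorm.
- by move=> x; rewrite lee_fin exprn_ge0// enorm_ge0.
Qed.

Lemma same_integral_distribution d (T : measurableType d) (P : probability T R)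
    (V W : {RV P >-> E}) K :
  (normmoment P K V < +oo)%E -> (normmoment P K W < +oo)%E ->
  (forall k, (1 <= k <= K.-1)%N -> forall idx : 'I_k -> 'I_p,
    tensormoment P V idx = tensormoment P W idx) ->
  forall k (idx : 'I_k -> 'I_p), (k < K)%N ->
    same_integral (distribution P V) (distribution P W) (monomial idx).
Proof.
move=> hV hW hVW k idx kK.
have mM : measurable_fun setT (monomial idx : E -> R).
  by rewrite /monomial; apply: measurable_prod => l _; exact: measurable_cV_entry.
have id_int (lam : probability E R) : (\int[lam]_x (enorm x ^+ K)%:E < +oo)%E ->
    lam.-integrable setT (EFin \o monomial idx).
  move=> h; pose I : {RV lam >-> E} := HB.pack (@id E)
    (isMeasurableFun.Build _ _ _ _ (@id E) (@measurable_id _ E setT)).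
  exact: (@integrable_monomial _ _ lam I K k idx (ltnW kK) h).
have tr (Q : {RV P >-> E}) : (normmoment P K Q < +oo)%E ->
    (\int[distribution P Q]_x (monomial idx x)%:E = tensormoment P Q idx)%E.
  move=> hQ; apply: etrans (@integral_distribution _ _ _ _ _ _ Q (EFin \o monomial idx) _ _) _.
  - exact/measurable_EFinP.
  - by apply: (integrable_monomial _ (ltnW kK)); move: hQ; rewrite /normmoment unlock.
  - by rewrite /tensormoment unlock.
split.
- by apply: id_int; rewrite integral_enorm_distribution.
- by apply: id_int; rewrite integral_enorm_distribution.
(* Degree zero lies outside the range of the moment hypothesis; there the monomial is the constant
   one. *)
- rewrite !tr//; case: k idx kK mM id_int tr => [|k] idx kK mM id_int tr.
    rewrite /tensormoment unlock; apply: eq_integral => t _.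
    by rewrite !big_ord0.
  by apply: hVW; rewrite /= -ltnS prednK// (leq_ltn_trans _ kK).
Qed.

(** Here [rho] is the law of [B g + U], with [g] standard Gaussian independent of [U] and [B] from
    [gaussian_split]. The proof moves the integral through the laws of [Z + U], [Z], [A W] and
    [gauss p], which live on different spaces. *)
Lemma gaussian_component d (T : measurableType d) (P : probability T R) (Y : {RV P >-> E})
    d' (T' : measurableType d') (P' : probability T' R) (Z U : {RV P' >-> E}) Sigma :
  (0 < p)%N -> sym_posdef Sigma -> eq_dist P Y P' (fun t => Z t + U t) ->
  independent2 P' Z U -> centered_gaussian P' Sigma Z ->
  exists rho : probability E R, forall f, nnmeas f ->
    cv (distribution P Y) f = gs (opnorm (invsqrtmx Sigma))^-1 (cv rho f).
Proof.
move=> p0 hSig YZU indZU [d2 [T2 [P2 [W [A [gW AA ZA]]]]]].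
have [B hB] := gaussian_split p0 hSig AA; set s := (opnorm _)^-1 in hB *.
have mB : measurable_fun setT (fun y : E => B *m y) by exact: measurable_cV_mulmx.
have mA : measurable_fun setT (fun t => A *m W t).
  by apply: measurable_cV_mulmx; exact: measurable_funP.
have mZU : measurable_fun setT (fun t => Z t + U t).
  by apply: measurable_cVD; exact: measurable_funP.
pose Bf : {RV (gauss p) >-> E} := HB.pack (fun y : E => B *m y)
  (isMeasurableFun.Build _ _ _ _ (fun y : E => B *m y) mB).
pose AW : {RV P2 >-> E} := HB.pack (fun t => A *m W t)
  (isMeasurableFun.Build _ _ _ _ (fun t => A *m W t) mA).
pose ZU : {RV P' >-> E} := HB.pack (fun t => Z t + U t)
  (isMeasurableFun.Build _ _ _ _ (fun t => Z t + U t) mZU).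
exists (distribution (distribution (gauss p) Bf \x distribution P' U)%E (@addv_pair R p)).
move=> f nf; apply/funext => x.
have nfx (y : E) : nnmeas (fun z => f (y + z)).
  have [mf f0] := nf; split => [|z]; last exact: f0.
  by apply: (measurableT_comp mf); exact: measurable_cVD.
have [mfx fx0] := nfx x.
pose h (z : E) : \bar R := (\int[distribution P' U]_u f (x + (z + u))%R)%E.
have [mh h0] : nnmeas h.
  apply: (nnmeas_ind (k := fun z u => x + (z + u)) _ _ nf).
  by apply: measurable_cVD => //; exact: measurable_cVD.
rewrite /cv.
transitivity (\int[distribution P' ZU]_y f (x + y)%R)%E.
  by apply: eq_measure_integral => D mD _; exact: YZU.
rewrite ge0_integral_distribution//.
transitivity (\int[distribution P' Z]_z h z)%E.
  exact: (law_add indZU (nfx x)).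
transitivity (\int[distribution P2 AW]_z h z)%E.
  by apply: eq_measure_integral => D mD _; exact: ZA.
rewrite ge0_integral_distribution//.
transitivity (\int[gauss p]_w h (A *m w))%E.
  apply: (ge0_integral_standard_gaussian (f := fun w => h (A *m w)) gW) => [|w].
    by apply: (measurableT_comp mh); exact: measurable_cV_mulmx.
  exact: h0.
rewrite hB//; apply: eq_integral => g _; rewrite /cv.
rewrite ge0_integral_addv; last exact: nfx.
pose F (y : E) : \bar R := (\int[distribution P' U]_u f (x + s *: g + (y + u))%R)%E.
have [mF F0] : nnmeas F.
  apply: (nnmeas_ind (k := fun y u => x + s *: g + (y + u)) _ _ nf).
  by apply: measurable_cVD => //; exact: measurable_cVD.
apply: etrans _ (esym (@ge0_integral_distribution _ _ _ _ _ (gauss p) Bf F mF F0)).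
by apply: eq_integral => y _; apply: eq_integral => u _; rewrite /= !addrA.
Qed.

Lemma normalized_sum_ball d (T : measurableType d) (P : probability T R) n
    (X : 'I_n -> {RV P >-> E}) (i0 : 'I_n) c r : iid P X -> 0 <= r ->
  P (normalized_sum X @^-1` closed_eball c r) =
  (prb (lawn (distribution P (X i0)) n) (sqball (Num.sqrt n%:R *: c) (n%:R * r ^+ 2)))%:E.
Proof.
move=> [indX eqX] r0; rewrite prbE; last exact: measurable_sqball.
have n0 : 0 < n%:R :> R by rewrite ltr0n (leq_ltn_trans _ (ltn_ord i0)).
have s0 : 0 < Num.sqrt (n%:R : R) by rewrite sqrtr_gt0.
rewrite -(@law_sum _ _ _ _ P n X (distribution P (X i0)) indX).
- have e t : sqn (\sum_(i < n) X i t - Num.sqrt n%:R *: c) =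
      n%:R * enorm (normalized_sum X t - c) ^+ 2.
    rewrite enorm_sqr /normalized_sum -[in RHS](sqr_sqrtr (ltW n0)) -sqnZ scalerBr scalerA.
    by rewrite sqr_sqrtr ?ltW// divff ?gt_eqF// scale1r.
  congr (P _); apply/seteqP; split => t /=; rewrite /closed_eball /sqball /= e ler_pM2l// => h.
    by rewrite lerXn2r ?nnegrE ?enorm_ge0.
  by rewrite -(@ler_pXn2r _ 2)// ?nnegrE ?enorm_ge0.
- by move=> i D mD; exact: eqX.
- exact: measurable_sqball.
Qed.

End transfer.

Theorem theorem2p1 (R : realType) (K : nat) (hK : (3 <= K)%N) :
  exists C : R, 0 < C /\
  forall (n p : nat) (hn : (0 < n)%N) (hp : (0 < p)%N)
    (d : measure_display) (T : measurableType d) (P : probability T R)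
    (X Y : 'I_n -> {RV P >-> 'cV[R]_p})
    (d' : measure_display) (T' : measurableType d') (P' : probability T' R)
    (Z U : 'I_n -> {RV P' >-> 'cV[R]_p})
    (Sigma : 'M[R]_p),
  iid P X ->
  (forall i, centered P (X i)) ->
  (forall i, sym_posdef (covmx P (X i))) ->
  (forall i, (normmoment P K (X i) < +oo)%E) ->
  iid P Y ->
  independent2 P (fun t => [tuple X i t | i < n]) (fun t => [tuple Y i t | i < n]) ->
  (forall i, (normmoment P K (Y i) < +oo)%E) ->
  (forall i (k : nat), (1 <= k <= K.-1)%N ->
    forall idx : 'I_k -> 'I_p,
      tensormoment P (X i) idx = tensormoment P (Y i) idx) ->
  (forall i, eq_dist P (Y i) P' (fun t => Z i t + U i t)) ->
  (forall i, independent2 P' (Z i) (U i)) ->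
  (forall i, centered P' (Z i) /\ centered P' (U i)) ->
  sym_posdef Sigma ->
  (forall i, centered_gaussian P' Sigma (Z i)) ->
  let X1 := X (Ordinal hn) in
  let Y1 := Y (Ordinal hn) in
  let Cz := opnorm (invsqrtmx Sigma) in
  (ereal_sup
     [set `|P (normalized_sum X @^-1` B) - P (normalized_sum Y @^-1` B)|
       | B in @closed_eballs R p]
   <= (C * (Cz ^+ K *
             fine 'E_P[fun t => (enorm (X1 t) ^+ K + enorm (Y1 t) ^+ K)%R])
             `^ (K - 2)%:R^-1
         / Num.sqrt n%:R)%R%:E)%E.
Proof.
(* This will bound [Cz^K] times the moment sum from below. It depends on [K] only, hence so does the
   constant built from it. *)
pose th0 : R := @smallr R ^+ K / 2.
have th0_gt0 : 0 < th0 by rewrite divr_gt0// exprn_gt0// smallr_gt0.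
have th0_le1 : th0 <= 1.
  have h : @smallr R ^+ K <= 1 by rewrite exprn_ile1 ?smallr_le1// ltW// smallr_gt0.
  by rewrite /th0; lra.
exists (beC K th0); split; first exact: beC_gt0.
move=> n p hn hp d T P X Y d' T' P' Z U Sigma iidX _ _ hX iidY _ hY XY YZU ZU _ hSig gZ; cbv zeta.
set X1 := X _; set Y1 := Y _; set Cz := opnorm _.
have Cz0 : 0 < Cz by apply: opnorm_gt0 => //; have [] := invsqrtmxP hSig.
pose i0 := Ordinal hn; pose mu := distribution P X1; pose nu := distribution P Y1.
have [rho nuE] := gaussian_component hp hSig (YZU i0) (ZU i0) (gZ i0).
have same := same_integral_distribution (hX i0) (hY i0) (XY i0).
pose MX := fine (normmoment P K X1); pose MY := fine (normmoment P K Y1).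
have mom_ge0 (V : {RV P >-> 'cV[R]_p}) : (0 <= normmoment P K V)%E.
  rewrite /normmoment unlock; apply: integral_ge0 => t _.
  by rewrite lee_fin exprn_ge0// enorm_ge0.
have MXE : normmoment P K X1 = MX%:E by rewrite fineK// ge0_fin_numE ?mom_ge0// hX.
have MYE : normmoment P K Y1 = MY%:E by rewrite fineK// ge0_fin_numE ?mom_ge0// hY.
have MX0 : 0 <= MX by rewrite -lee_fin -MXE mom_ge0.
have mK (V : {RV P >-> 'cV[R]_p}) : measurable_fun setT (fun t => enorm (V t) ^+ K).
  by apply: measurable_funX; apply: measurable_enorm; exact: measurable_funP.
have -> : fine 'E_P[fun t => (enorm (X1 t) ^+ K + enorm (Y1 t) ^+ K)%R] = MX + MY.
  apply: EFin_inj; rewrite EFinD -MXE -MYE /normmoment unlock.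
  rewrite -ge0_integralD//; last 4 first.
  - by move=> t _; rewrite lee_fin exprn_ge0// enorm_ge0.
  - exact/measurable_EFinP.
  - by move=> t _; rewrite lee_fin exprn_ge0// enorm_ge0.
  - exact/measurable_EFinP.
  rewrite fineK//; under eq_integral do rewrite EFinD.
  rewrite ge0_integralD//; last 4 first.
  - by move=> t _; rewrite lee_fin exprn_ge0// enorm_ge0.
  - exact/measurable_EFinP.
  - by move=> t _; rewrite lee_fin exprn_ge0// enorm_ge0.
  - exact/measurable_EFinP.
  move: MXE MYE; rewrite /normmoment unlock => -> ->.
  by rewrite -EFinD.
set theta := _ `^ _.
have hmu : (\int[mu]_x (enorm x ^+ K)%:E <= MX%:E)%E by rewrite integral_enorm_distribution MXE.
have hnu : (\int[nu]_x (enorm x ^+ K)%:E <= MY%:E)%E by rewrite integral_enorm_distribution MYE.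
have s0 : 0 < Cz^-1 by rewrite invr_gt0.
have bK : th0 <= Cz ^+ K * (MX + MY).
  have := moment_ge_smallr s0 hp nuE hnu; rewrite exprMn exprVn => h.
  rewrite mulrC -ler_pdivrMr ?exprn_gt0//; apply: (@le_trans _ _ MY); last by rewrite lerDr.
  by apply: le_trans h; rewrite /th0 mulrC mulrA.
have b0 : 0 < Cz ^+ K * (MX + MY) := lt_le_trans th0_gt0 bK.
have K2 : (0 < K - 2)%N by rewrite subn_gt0.
have thK : theta ^+ (K - 2) = Cz ^+ K * (MX + MY).
  rewrite -powR_mulrn ?powR_ge0// -powRrM mulVf ?powRr1// ?(ltW b0)//.
  by rewrite pnatr_eq0 -lt0n.
have theta0 : 0 < theta by exact: powR_gt0.
(* Since [th0 <= 1], the bound [theta^(K-2) >= th0] gives [theta^(K-2) >= th0^(K-2)]. *)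
have th0_le : th0 <= theta.
  rewrite -(@ler_pXn2r _ (K - 2))// ?nnegrE ?(ltW th0_gt0) ?(ltW theta0)// thK.
  apply: le_trans bK; rewrite -[leRHS]expr1; apply: ler_wiXn2l => //; exact: ltW.
have theta_ge : Cz^-1 ^- K * (MX + MY) <= theta ^+ (K - 2).
  by rewrite thK exprVn invrK.
apply: ge_ereal_sup => _ [B [c [r [r0 ->]]] <-].
rewrite (normalized_sum_ball i0 c iidX r0) (normalized_sum_ball i0 c iidY r0).
rewrite -EFinB abse_EFin lee_fin -mulrA.
exact: (prb_lawn_le s0 hK hp same nuE hmu hnu th0_gt0 th0_le theta_ge _ _ hn).
Qed.
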